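(* Let $r\geqslant 2$ and $k\geqslant 4$ be fixed integers. For every $\varepsilon>0$ and every large real $T\geqslant 2$, \[ \int_1^T\Delta_{r,k}^2(x)\,dx\ll T^{2r-1+2\beta_k+\varepsilon}. \]
   Context: $\tau_k(n)$ is the number of ordered $k$-tuples of positive integers with product $n$. For $k\geqslant 3$ let $\Delta_k(x)=\sum_{n\leqslant x}\tau_k(n)-xP_{k-1}(\log x)$, where $xP_{k-1}(\log x)$ is the residue of $\zeta^k(s)x^s/s$ at $s=1$. Define $\alpha_k=\inf\{a:\Delta_k(x)=O(x^a)\}$ (so $0<\alpha_k<1$) and $\beta_k=\inf\{b:\int_1^x\Delta_k^2(t)\,dt=O(x^{1+2b})\}$ (known values/bounds: $\beta_4=3/8$, $\beta_5\leqslant 119/260$, $\beta_6\leqslant 1/2$, $\beta_7\leqslant 39/70$, ...). For fixed integers $r\geqslant 2$, $k\geqslant 3$ there are unique constants $d_{r,k,\ell}$ ($0\leqslant\ell\leqslant r(k-1)$) such that, with $M_{r,k}(x)=x^r\sum_{\ell=0}^{r(k-1)}d_{r,k,\ell}(\log x)^\ell$, one has $\sum_{n_1,\dots,n_r\leqslant x}\tau_k(n_1\cdots n_r)=M_{r,k}(x)+O(x^{r-1+\alpha_k+\varepsilon})$ for every $\varepsilon>0$. Define $\Delta_{r,k}(x)=\sum_{n_1,\dots,n_r\leqslant x}\tau_k(n_1\cdots n_r)-M_{r,k}(x)$. The implied constant may depend on $r,k,\varepsilon$. *)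

(* Defs.v *)
From mathcomp Require Import all_boot all_order all_algebra complex.
From mathcomp Require Import all_classical all_reals all_analysis.

Set Implicit Arguments.
Unset Strict Implicit.
Unset Printing Implicit Defensive.

Import Order.TTheory GRing.Theory Num.Theory.
Import numFieldNormedType.Exports.
Local Open Scope classical_set_scope.
Local Open Scope ring_scope.
Local Open Scope complex_scope.

(* f x = O(g x) as x tends to +oo. *)
Definition isO (R : realType) (f g : R -> R) : Prop :=
  exists C : R, \forall x \near +oo, `|f x| <= C * `|g x|.

(* Every factor of a positive n lies in {0, ..., n} and is positive; only
   n > 0 is meaningful. *)
Definition tau (k n : nat) : nat :=
  #|[set t : {ffun 'I_k -> 'I_n.+1} | (\prod_(i < k) t i)%N == n]%SET|.

(* x ^ s = exp (s * log x), for x > 0 real and s complex. *)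
Definition cpow (R : realType) (x : R) (s : R[i]) : R[i] :=
  (x `^ complex.Re s)%:C *
  (cos (complex.Im s * ln x) +i* sin (complex.Im s * ln x)).

(* zeta s = lim_N (\sum_(1 <= n <= N) n ^ - s - N ^ (1 - s) / (1 - s)).
   For Re s > 1 the correction N ^ (1 - s) tends to 0 and this is the Dirichlet
   series; for Re s > 0, s != 1, it is its analytic continuation (the partial
   sums differ from 1 / (s - 1) by a locally uniformly convergent series of
   holomorphic functions).  The definition is meant for that half-plane only,
   which contains a punctured neighbourhood of 1. *)
Definition zeta (R : realType) (s : R[i]) : R[i] :=
  lim ((fun N : nat => \sum_(1 <= n < N.+1) cpow n%:R (- s)
          - cpow N%:R (1 - s) / (1 - s) : R[i]^o) @ \oo).

(* f has at a an isolated singularity that is at worst a pole, of order at most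
   m.+1, with Laurent expansion \sum_j c_j (s - a) ^ (j - m.+1); the residue is
   the coefficient of (s - a) ^ -1. *)
Definition is_residue (R : realType) (f : R[i] -> R[i]) (a rho : R[i]) : Prop :=
  exists (m : nat) (c : nat -> R[i]) (delta : R[i]),
    [/\ 0 < delta,
        (forall s : R[i], 0 < `|s - a| < delta ->
           (series (fun j => c j * (s - a) ^+ j) : nat -> R[i]^o) @ \oo
             --> ((s - a) ^+ m.+1 * f s : R[i]^o))
      & c m = rho].

Definition residue (R : realType) (f : R[i] -> R[i]) (a : R[i]) : R[i] :=
  xget 0 [set rho | is_residue f a rho].

(* x * P_{k-1}(log x); the residue is real. *)
Definition mainTerm (R : realType) (k : nat) (x : R) : R :=
  complex.Re (residue (fun s => zeta s ^+ k * cpow x s / s) 1).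

Definition Delta (R : realType) (k : nat) (x : R) : R :=
  (\sum_(1 <= n < (Num.truncn x).+1) tau k n)%N%:R - mainTerm k x.

Definition alpha (R : realType) (k : nat) : R :=
  inf [set a : R | isO (@Delta R k) (fun x => x `^ a)].

Definition beta (R : realType) (k : nat) : R :=
  inf [set b : R |
    isO (fun x => \int[@lebesgue_measure R]_(t in `[1, x]) (Delta k t ^+ 2))
        (fun x => x `^ (1 + 2 * b))].

(* The index t stands for (n_1, ..., n_r) = (t 0 + 1, ..., t (r-1) + 1). *)
Definition tauSum (R : realType) (r k : nat) (x : R) : nat :=
  (\sum_(t : {ffun 'I_r -> 'I_(Num.truncn x)}) tau k (\prod_(i < r) (t i).+1))%N.

Definition polyLog (R : realType) (r k : nat)
    (d : {ffun 'I_(r * (k - 1)).+1 -> R}) (x : R) : R :=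
  x ^+ r * \sum_l d l * ln x ^+ l.

(* At most one d satisfies this, because alpha R k < 1. *)
Definition is_mainCoefs (R : realType) (r k : nat)
    (d : {ffun 'I_(r * (k - 1)).+1 -> R}) : Prop :=
  forall eps : R, 0 < eps ->
    isO (fun x => (tauSum r k x)%:R - polyLog d x)
        (fun x => x `^ (r%:R - 1 + alpha R k + eps)).

Definition mainCoefs (R : realType) (r k : nat) :
    {ffun 'I_(r * (k - 1)).+1 -> R} :=
  xget [ffun=> 0] [set d | is_mainCoefs d].

Definition mainTermMulti (R : realType) (r k : nat) (x : R) : R :=
  polyLog (mainCoefs R r k) x.

Definition DeltaMulti (R : realType) (r k : nat) (x : R) : R :=
  (tauSum r k x)%:R - mainTermMulti r k x.

(* Main.v *)
(** The argument needs nothing about the main terms beyond their shape.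
    Moebius inversion writes tau_k(n_1 ... n_r) as the convolution of the
    product tau_k(n_1) ... tau_k(n_r) with a coefficient h(m_1, ..., m_r) that
    vanishes as soon as some prime divides exactly one of the m_i, so that
    sums such as \sum |h(m)| (m_1 ... m_r)^(e-1) \sum_i m_i^(1-e-s) converge
    for s > 0 and e small.  The multiple sum up to x is therefore
    \sum_m h(m) \prod_i D(x / m_i), where D(y) = \sum_(n <= y) tau_k(n), and
    replacing every D(y) by y Q(log y) costs at most
    x^((r-1)(1+e)) \sum_m |h(m)| (m_1 ... m_r)^(e-1) \sum_i m_i^(1-e) |Delta_k(x / m_i)|.
    Pointwise bounds for Delta_k identify the polynomial part with M_(r,k), and
    Cauchy-Schwarz with a change of variables transfers the mean square bound.
    If beta_k >= 1 the trivial bound for the multiple sum suffices; if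
    beta_k < 1, the slow variation of Delta_k turns the mean square bound into
    a pointwise one, which gives alpha_k < 1 and deg Q < k. *)
Require Import Defs.
From mathcomp Require Import all_boot all_order all_algebra.
From mathcomp Require Import all_classical all_reals all_analysis.
From mathcomp Require Import measurable_realfun complex zify ring lra.

Import Order.TTheory GRing.Theory Num.Theory.
Import numFieldNormedType.Exports.
Local Open Scope classical_set_scope.
Local Open Scope ring_scope.

(** * Divisor functions *)

(** [mainTerm] and [mainCoefs] are fixed through a choice operator: if no residue, or no admissible
    coefficient vector, exists, the value is a default. No analytic fact about zeta at 1 is
    established, so the shape of the main terms comes from elsewhere. A residue at one x is
    transported to all others, and the default corresponds to Q = 0. The degree of Q is read off by
    comparing x Q(log x) with the size of the summatory function, once some exponent below 1 is
    admissible for alpha_k. Identifying [mainCoefs] takes existence and uniqueness of the vector,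
    hence alpha_k < 1; this is what the case beta_k < 1 supplies. Infinite series over m are
    avoided. All sums run over boxes of side Y, where the convolution identity is exact as soon as Y
    >= x. The coefficients of the truncated main polynomial are bounded in Y, and a cluster point of
    them serves as the coefficient vector; the weighted bounds are uniform in Y, so Y may be taken
    as large as the approximation requires. *)

Definition ffcons {r : nat} {T : finType} (a : T) (t : {ffun 'I_r -> T}) :
    {ffun 'I_r.+1 -> T} :=
  [ffun i => oapp t a (unlift ord0 i)].

Lemma ffcons0 (r : nat) (T : finType) (a : T) (t : {ffun 'I_r -> T}) :
  ffcons a t ord0 = a.
Proof. by rewrite ffunE unlift_none. Qed.

Lemma ffcons_lift (r : nat) (T : finType) (a : T) (t : {ffun 'I_r -> T}) i :
  ffcons a t (lift ord0 i) = t i.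
Proof. by rewrite ffunE liftK. Qed.

Lemma big_ffun_cons (V : nmodType) (r : nat) (T : finType)
    (F : {ffun 'I_r.+1 -> T} -> V) :
  \sum_t F t = \sum_a \sum_t F (ffcons a t).
Proof.
rewrite pair_big /=.
rewrite (reindex (fun p : T * {ffun 'I_r -> T} => ffcons p.1 p.2)) //=.
exists (fun t => (t ord0, [ffun i => t (lift ord0 i)])).
  move=> [a t] _ /=; rewrite ffcons0; congr pair.
  by apply/ffunP => i; rewrite ffunE ffcons_lift.
move=> t _ /=; apply/ffunP => i.
case: (unliftP ord0 i) => [j ->|->]; last by rewrite ffcons0.
by rewrite ffcons_lift ffunE.
Qed.

Lemma perm_divisors_mul (n e : nat) : (0 < n)%N -> (e %| n)%N ->
  perm_eq [seq d <- divisors n | (e %| d)%N]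
          [seq (e * c)%N | c <- divisors (n %/ e)].
Proof.
move=> n0 en.
have e0 : (0 < e)%N by apply: dvdn_gt0 en.
have ne0 : (0 < n %/ e)%N by rewrite divn_gt0 // dvdn_leq.
apply: uniq_perm.
- by rewrite filter_uniq // divisors_uniq.
- rewrite map_inj_uniq ?divisors_uniq // => a b /eqP.
  by rewrite eqn_pmul2l // => /eqP.
move=> d; rewrite mem_filter -dvdn_divisors //.
apply/andP/mapP => [[ed dn]|[c]].
  exists (d %/ e)%N; last by rewrite mulnC divnK.
  by rewrite -dvdn_divisors // dvdn_divRL // divnK.
rewrite -dvdn_divisors // => cn ->; split; first exact: dvdn_mulr.
by rewrite mulnC -dvdn_divRL.
Qed.

Lemma sum_divisors_mul (V : nmodType) (n e : nat) (G : nat -> V) :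
  (0 < n)%N -> (e %| n)%N ->
  \sum_(d <- divisors n | (e %| d)%N) G d =
  \sum_(c <- divisors (n %/ e)) G (e * c)%N.
Proof.
move=> n0 en.
by rewrite -big_filter (perm_big _ (perm_divisors_mul _ _ n0 en)) big_map.
Qed.

Lemma sum_divisors_pair (V : nmodType) (n : nat) (F : nat -> nat -> V) :
  (0 < n)%N ->
  \sum_(d <- divisors n) \sum_(e <- divisors d) F e d =
  \sum_(e <- divisors n) \sum_(c <- divisors (n %/ e)) F e (e * c)%N.
Proof.
move=> n0.
transitivity (\sum_(d <- divisors n) \sum_(e <- divisors n | (e %| d)%N) F e d).
  rewrite big_seq [RHS]big_seq; apply: eq_bigr => d.
  rewrite -dvdn_divisors // => dn.
  have d0 : (0 < d)%N by apply: dvdn_gt0 dn.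
  rewrite -[RHS]big_filter; apply: perm_big; apply: uniq_perm.
  - exact: divisors_uniq.
  - by rewrite filter_uniq // divisors_uniq.
  move=> e; rewrite mem_filter -!dvdn_divisors //.
  by case: (boolP (e %| d)%N) => //= ed; rewrite (dvdn_trans ed dn).
under eq_bigr do rewrite big_mkcond.
rewrite exchange_big /= big_seq [RHS]big_seq; apply: eq_bigr => e.
rewrite -dvdn_divisors // => en.
by rewrite -big_mkcond sum_divisors_mul.
Qed.

Lemma perm_divisors_coprime (m n : nat) : (0 < m)%N -> (0 < n)%N ->
  coprime m n ->
  perm_eq (divisors (m * n)) [seq (d * e)%N | d <- divisors m, e <- divisors n].
Proof.
move=> m0 n0 mn; apply: uniq_perm; first exact: divisors_uniq.
  apply: allpairs_uniq; rewrite ?divisors_uniq //.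
  move=> _ _ /allpairsP[[a b] /= [am bn ->]] /allpairsP[[c d] /= [cm dn ->]] /= E.
  move: am bn cm dn; rewrite -!dvdn_divisors // => am bn cm dn.
  have ad : coprime a d by apply: coprime_dvdl am (coprime_dvdr dn mn).
  have cb : coprime c b by apply: coprime_dvdl cm (coprime_dvdr bn mn).
  have ac : a = c.
    apply/eqP; rewrite eqn_dvd; apply/andP; split.
      by rewrite -(Gauss_dvdl _ ad) -E dvdn_mulr.
    by rewrite -(Gauss_dvdl _ cb) E dvdn_mulr.
  have a0 : (0 < a)%N by apply: dvdn_gt0 am.
  by move: E; rewrite -ac => /eqP; rewrite eqn_pmul2l // => /eqP ->.
move=> d; rewrite -dvdn_divisors ?muln_gt0 ?m0 //.
apply/idP/allpairsP => [dmn|[[a b] /= [am bn ->]]]; last first.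
  by apply: dvdn_mul; rewrite dvdn_divisors.
(* A divisor d of m n is the product of its gcds with the two coprime factors. *)
exists (gcdn d m, gcdn d n) => /=; split; rewrite -?dvdn_divisors ?dvdn_gcdr //.
apply/eqP; rewrite eqn_dvd; apply/andP; split.
  rewrite muln_gcdr dvdn_gcd dvdn_mull //= muln_gcdl dvdn_gcd dmn.
  by rewrite dvdn_mulr.
rewrite Gauss_dvd ?dvdn_gcdl //.
by apply: coprime_dvdl (dvdn_gcdr _ _) (coprime_dvdr (dvdn_gcdr _ _) mn).
Qed.

Lemma sum_divisors_coprime (V : nmodType) (m n : nat) (G : nat -> V) :
  (0 < m)%N -> (0 < n)%N -> coprime m n ->
  \sum_(d <- divisors (m * n)) G d =
  \sum_(d <- divisors m) \sum_(e <- divisors n) G (d * e)%N.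
Proof.
move=> m0 n0 mn.
by rewrite (perm_big _ (perm_divisors_coprime _ _ m0 n0 mn)) big_allpairs_dep.
Qed.

Lemma sum_divisors_inv (V : nmodType) (n : nat) (G : nat -> V) : (0 < n)%N ->
  \sum_(d <- divisors n) G (n %/ d)%N = \sum_(d <- divisors n) G d.
Proof.
move=> n0; rewrite -[LHS](big_map (fun d => n %/ d)%N predT).
apply: perm_big; apply: uniq_perm.
- rewrite map_inj_in_uniq ?divisors_uniq // => a b.
  rewrite -!dvdn_divisors //.
  move=> an bn E; have H1 := divnK an; have H2 := divnK bn; rewrite E in H1.
  apply/eqP; rewrite -(@eqn_pmul2l (n %/ b)) ?H1 ?H2 //.
  by rewrite divn_gt0 ?(dvdn_leq n0 bn) // (dvdn_gt0 n0 bn).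
- exact: divisors_uniq.
move=> d; rewrite -dvdn_divisors //; apply/mapP/idP => [[e]|dn].
  by rewrite -dvdn_divisors // => en ->; rewrite dvdn_div.
exists (n %/ d)%N; first by rewrite -dvdn_divisors // dvdn_div.
by rewrite divnA // mulKn.
Qed.

(** Dirichlet convolution. Its laws are stated value by value at positive arguments, where
    [eq_dconv] takes the place of functional extensionality. *)
Definition dconv {R : pzSemiRingType} (f g : nat -> R) (n : nat) : R :=
  \sum_(d <- divisors n) f d * g (n %/ d)%N.

Lemma dconvC (R : comPzSemiRingType) (f g : nat -> R) n : (0 < n)%N ->
  dconv f g n = dconv g f n.
Proof.
move=> n0; rewrite /dconv -sum_divisors_inv // big_seq [RHS]big_seq.
apply: eq_bigr => d; rewrite -dvdn_divisors // => dn.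
by rewrite divnA // mulKn // mulrC.
Qed.

Lemma eq_dconv (R : pzSemiRingType) (f f' g g' : nat -> R) n : (0 < n)%N ->
  (forall m, (0 < m)%N -> f m = f' m) -> (forall m, (0 < m)%N -> g m = g' m) ->
  dconv f g n = dconv f' g' n.
Proof.
move=> n0 ff gg; rewrite /dconv big_seq [RHS]big_seq; apply: eq_bigr => d.
rewrite -dvdn_divisors // => dn.
have d0 := dvdn_gt0 n0 dn.
by rewrite ff // gg // divn_gt0 // dvdn_leq.
Qed.

Lemma dconvA (R : pzSemiRingType) (f g h : nat -> R) n : (0 < n)%N ->
  dconv (dconv f g) h n = dconv f (dconv g h) n.
Proof.
move=> n0; rewrite /dconv.
under eq_bigr do rewrite big_distrl /=.
rewrite (sum_divisors_pair _ _ (fun e d => f e * g (d %/ e)%N * h (n %/ d)%N)) //.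
rewrite big_seq [RHS]big_seq; apply: eq_bigr => e.
rewrite -dvdn_divisors // => en; rewrite big_distrr /= .
have e0 := dvdn_gt0 n0 en.
by apply: eq_bigr => c _; rewrite mulKn // divnMA mulrA.
Qed.

Lemma dconv1 (R : pzSemiRingType) (f : nat -> R) n : (0 < n)%N ->
  dconv (fun m => (m == 1)%:R) f n = f n.
Proof.
move=> n0; rewrite /dconv.
rewrite (bigD1_seq 1%N) ?divisors_uniq -?dvdn_divisors ?dvd1n //=.
by rewrite mul1r divn1 big1 ?addr0 // => d /negPf ->; rewrite mul0r.
Qed.

Lemma sum_ord_dvdn (V : nmodType) (n N : nat) (G : nat -> V) :
  (0 < n)%N -> (n <= N)%N ->
  \sum_(a < N.+1 | (a %| n)%N) G a = \sum_(a <- divisors n) G a.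
Proof.
move=> n0 nN; rewrite -(big_mkord (fun a => a %| n)%N) -big_filter.
apply: perm_big; apply: uniq_perm.
- by rewrite filter_uniq // iota_uniq.
- exact: divisors_uniq.
move=> d; rewrite mem_filter mem_index_iota -dvdn_divisors //.
case: (boolP (d %| n)%N) => //= dn; rewrite ltnS (leq_trans _ nN) //.
exact: dvdn_leq.
Qed.

Fixpoint tau_rec (k n : nat) : nat :=
  if k is k'.+1 then (\sum_(d <- divisors n) tau_rec k' d)%N else (n == 1)%N.

(** The side N of the box is decoupled from n because the induction passes to the quotients n / a
    while the entries keep ranging over the original box. *)
Lemma tau_rec_box (k n N : nat) : (0 < n)%N -> (n <= N)%N ->
  (\sum_(t : {ffun 'I_k -> 'I_N.+1}) ((\prod_(i < k) t i)%N == n))%N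
  = tau_rec k n.
Proof.
elim: k n => [|k IH] n n0 nN.
  rewrite (bigD1 [ffun i => ord0]) //= [X in (_ + X)%N]big1 ?addn0.
    by rewrite big_ord0 eq_sym.
  by move=> t /eqP[]; apply/ffunP => -[].
rewrite big_ffun_cons /=.
rewrite -(sum_divisors_inv _ _ (tau_rec k)) // -(sum_ord_dvdn _ _ N) //.
rewrite [RHS]big_mkcond /=; apply: eq_bigr => a _.
have E t : (\prod_(i < k.+1) ffcons a t i)%N = (a * \prod_(i < k) t i)%N.
  rewrite big_ord_recl ffcons0; congr muln.
  by apply: eq_bigr => i _; rewrite ffcons_lift.
under eq_bigr do rewrite E.
case: ifP => an; last first.
  rewrite big1 // => t _; case: eqP => // En.
  by rewrite -En dvdn_mulr in an.
have a0 : (0 < a)%N by apply: dvdn_gt0 an.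
rewrite -IH; last 2 first.
- by rewrite divn_gt0 // dvdn_leq.
- by rewrite (leq_trans _ nN) // leq_div.
apply: eq_bigr => t _; congr nat_of_bool.
by rewrite -{1}(divnK an) mulnC eqn_pmul2r.
Qed.

Lemma tauE (k n : nat) : (0 < n)%N -> tau k n = tau_rec k n.
Proof.
move=> n0; rewrite -(@tau_rec_box k n n) // /tau -sum1_card big_mkcond /=.
by apply: eq_bigr => t _; rewrite inE; case: (_ == _).
Qed.

Lemma tau0 (n : nat) : (0 < n)%N -> tau 0 n = (n == 1)%N.
Proof. by move=> n0; rewrite tauE. Qed.

Lemma tauS (k n : nat) : (0 < n)%N ->
  tau k.+1 n = (\sum_(d <- divisors n) tau k d)%N.
Proof.
move=> n0; rewrite tauE //= big_seq [RHS]big_seq; apply: eq_bigr => d.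
by rewrite -dvdn_divisors // => dn; rewrite tauE // (dvdn_gt0 n0 dn).
Qed.

Lemma tau_gt0 (k n : nat) : (0 < k)%N -> (0 < n)%N -> (0 < tau k n)%N.
Proof.
elim: k n => // -[_|k IH] n _ n0.
  rewrite tauS // (bigD1_seq 1%N) ?divisors_uniq -?dvdn_divisors ?dvd1n //=.
  by rewrite tau0 // eqxx.
rewrite tauS // (bigD1_seq 1%N) ?divisors_uniq -?dvdn_divisors ?dvd1n //=.
by rewrite (leq_trans (IH 1%N _ _)) // leq_addr.
Qed.

Lemma tau1 (n : nat) : (0 < n)%N -> tau 1 n = 1%N.
Proof.
move=> n0; rewrite tauS // (bigD1_seq 1%N) ?divisors_uniq -?dvdn_divisors ?dvd1n //=.
rewrite tau0 // big_seq_cond big1 // => d; rewrite -dvdn_divisors //.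
by move=> /andP[dn /negPf]; rewrite tau0 ?(dvdn_gt0 n0 dn) // => ->.
Qed.

Lemma tau_coprime (k m n : nat) : (0 < m)%N -> (0 < n)%N -> coprime m n ->
  tau k (m * n) = (tau k m * tau k n)%N.
Proof.
elim: k m n => [|k IH] m n m0 n0 mn.
  rewrite !tau0 ?muln_gt0 ?m0 //.
  have [->|m1] := eqVneq m 1%N; first by rewrite !mul1n.
  by rewrite muln_eq1 (negPf m1).
rewrite !tauS ?muln_gt0 ?m0 // sum_divisors_coprime //.
rewrite big_distrl /= big_seq [RHS]big_seq; apply: eq_bigr => d.
rewrite -dvdn_divisors // => dm; rewrite big_distrr /= big_seq [RHS]big_seq.
apply: eq_bigr => e; rewrite -dvdn_divisors // => en.
rewrite IH ?(dvdn_gt0 m0 dm) ?(dvdn_gt0 n0 en) //.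
exact: coprime_dvdl dm (coprime_dvdr en mn).
Qed.

(** * Moebius inversion and the multiple divisor sum *)

Definition mobius {R : comNzRingType} (n : nat) : R :=
  if all (fun p => logn p n == 1%N) (primes n) then (-1) ^+ size (primes n)
  else 0.

Lemma perm_primes_mul (p a n : nat) : prime p -> (0 < a)%N -> (0 < n)%N ->
  ~~ (p %| n)%N -> perm_eq (primes (p ^ a * n)) (p :: primes n).
Proof.
move=> pp a0 n0 pn.
have pa0 : (0 < p ^ a)%N by rewrite expn_gt0 prime_gt0.
apply: uniq_perm.
- exact: primes_uniq.
- by rewrite /= primes_uniq andbT mem_primes (negPf pn) !andbF.
move=> q; rewrite inE primesM // primesX //.
by rewrite primes_prime // inE.
Qed.

Lemma mobius_prime_mul (R : comNzRingType) (p n : nat) : prime p -> (0 < n)%N ->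
  ~~ (p %| n)%N -> mobius (p * n) = - mobius n :> R.
Proof.
move=> pp n0 pn; have p0 := prime_gt0 pp.
have := perm_primes_mul p 1 n pp isT n0 pn; rewrite expn1 => H.
rewrite /mobius (perm_all _ H) (perm_size H) /=.
have -> : logn p (p * n) = 1%N.
  rewrite lognM // logn_prime // eqxx /=.
  by rewrite (@lognE p n) (negPf pn) !andbF.
rewrite eqxx /= exprS mulN1r.
have -> : all (fun q => logn q (p * n) == 1%N) (primes n)
        = all (fun q => logn q n == 1%N) (primes n).
  apply: eq_in_all => q; rewrite mem_primes => /and3P[pq _ qn].
  rewrite lognM // logn_prime //.
  by have [qp|] := eqVneq p q => //; rewrite qp qn in pn.
by case: ifP => _; rewrite ?oppr0.
Qed.

Lemma mobius_pfactor_mul (R : comNzRingType) (p a n : nat) : prime p ->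
  (0 < n)%N -> ~~ (p %| n)%N -> mobius (p ^ a.+2 * n) = 0 :> R.
Proof.
move=> pp n0 pn; have H := perm_primes_mul p a.+2 n pp isT n0 pn.
rewrite /mobius (perm_all _ H) /=.
have -> : logn p (p ^ a.+2 * n) = a.+2.
  rewrite lognM //; last by rewrite expn_gt0 prime_gt0.
  rewrite pfactorK //.
  by rewrite (@lognE p n) (negPf pn) !andbF addn0.
by [].
Qed.

Lemma sum_divisors_pfactor (V : nmodType) (p a : nat) (G : nat -> V) :
  prime p -> \sum_(d <- divisors (p ^ a)) G d = \sum_(i < a.+1) G (p ^ i)%N.
Proof.
move=> pp; rewrite -(big_mkord predT (fun i => G (p ^ i)%N)).
rewrite -(big_map (expn p) predT); apply: perm_big; apply: uniq_perm.
- exact: divisors_uniq.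
- rewrite map_inj_uniq ?iota_uniq // => i j /eqP.
  by rewrite eqn_exp2l ?prime_gt1 // => /eqP.
move=> d; rewrite -dvdn_divisors ?expn_gt0 ?prime_gt0 //.
apply/(dvdn_pfactor _ _ pp)/mapP => [[j ja ->]|[j]].
  by exists j => //; rewrite mem_index_iota.
by rewrite mem_index_iota => ja ->; exists j.
Qed.

Lemma sum_divisors_prime_split (V : nmodType) (p a n : nat) (G : nat -> V) :
  prime p -> (0 < n)%N -> ~~ (p %| n)%N ->
  \sum_(d <- divisors (p ^ a * n)) G d =
  \sum_(i < a.+1) \sum_(e <- divisors n) G (p ^ i * e)%N.
Proof.
move=> pp n0 pn.
have pa0 : (0 < p ^ a)%N by rewrite expn_gt0 prime_gt0.
rewrite sum_divisors_coprime //; first exact: sum_divisors_pfactor.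
by rewrite coprimeXl // prime_coprime.
Qed.

(** Let p be the least prime factor of n and n = p ^ a u with u prime to p. Among the divisors p ^ i
    e, those with i >= 2 contribute nothing, and those with i = 0 and i = 1 cancel. *)
Lemma sum_mobius (R : comNzRingType) (n : nat) : (0 < n)%N ->
  \sum_(d <- divisors n) mobius d = (n == 1%N)%:R :> R.
Proof.
move=> n0; have [->|n1] := eqVneq n 1%N.
  by rewrite big_seq1 /mobius /= expr0.
have pp : prime (pdiv n) by rewrite pdiv_prime // ltn_neqAle eq_sym n1.
have [u pu En] := pfactor_coprime pp n0.
have a0 : (0 < logn (pdiv n) n)%N.
  by rewrite logn_gt0 mem_primes pp n0 pdiv_dvd.
move: pu; rewrite prime_coprime // => pu.
have u0 : (0 < u)%N by move: n0; rewrite En muln_gt0 => /andP[].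
rewrite En mulnC; case: (logn _ _) a0 => // a _.
rewrite sum_divisors_prime_split // !big_ord_recl [X in _ + (_ + X)]big1 /=; last first.
  move=> i _; rewrite big_seq big1 // => e; rewrite -dvdn_divisors // => eu.
  rewrite mobius_pfactor_mul // ?(dvdn_gt0 u0 eu) //.
  by apply: contra pu => /dvdn_trans; apply.
rewrite addr0 big_seq [X in _ + X]big_seq -big_split big1 //= => e.
rewrite -dvdn_divisors // => eu; rewrite expn0 expn1 mul1n mobius_prime_mul ?subrr //.
  exact: dvdn_gt0 eu.
by apply: contra pu => /dvdn_trans; apply.
Qed.

Lemma mobius_le1 (R : numDomainType) (n : nat) : `|mobius n : R| <= 1.
Proof.
rewrite /mobius; case: ifP => _; last by rewrite normr0 ler01.
by rewrite normrX normrN1 expr1n.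
Qed.

(** The k-fold Dirichlet power of [mobius], with generating series zeta ^ (- k); it is the
    convolution inverse of [tau k]. *)
Fixpoint mobius_iter {R : comNzRingType} (k : nat) : nat -> R :=
  if k is k'.+1 then dconv mobius (mobius_iter k') else fun n => (n == 1%N)%:R.

Lemma mobius_iter_tau (R : comNzRingType) (k n : nat) : (0 < n)%N ->
  dconv (mobius_iter k) (fun m => (tau k m)%:R) n = (n == 1%N)%:R :> R.
Proof.
elim: k n => [|k IH] n n0.
  by rewrite dconv1 // tau0.
rewrite (@eq_dconv _ _ (dconv mobius (mobius_iter k)) _
  (dconv (fun m => (tau k m)%:R) (fun _ => 1))) //; last first.
  move=> m m0; rewrite tauS // /dconv natr_sum.
  by apply: eq_bigr => d _; rewrite mulr1.
rewrite dconvA // -(sum_mobius R n) // /dconv.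
rewrite big_seq [RHS]big_seq; apply: eq_bigr => d.
rewrite -dvdn_divisors // => dn.
have nd0 : (0 < n %/ d)%N by rewrite divn_gt0 ?(dvdn_gt0 n0 dn) // dvdn_leq.
rewrite -[RHS]mulr1; congr (_ * _).
rewrite -[LHS](dconvA _ (mobius_iter k) (fun m => (tau k m)%:R) (fun=> 1)) //.
rewrite (@eq_dconv _ _ (fun m => (m == 1%N)%:R) _ (fun _ => 1)) ?dconv1 //.
Qed.

(** Since [mobius] is bounded by 1, its k-fold convolution is dominated by that of the constant 1,
    which is [tau k]. *)
Lemma mobius_iter_le (R : numDomainType) (k n : nat) : (0 < n)%N ->
  `|mobius_iter k n : R| <= (tau k n)%:R.
Proof.
elim: k n => [|k IH] n n0.
  by rewrite tau0 //= normr_nat.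
rewrite tauS //= (le_trans (ler_norm_sum _ _ _)) // natr_sum.
rewrite -[leRHS]sum_divisors_inv // big_seq [leRHS]big_seq; apply: ler_sum => d.
rewrite -dvdn_divisors // => dn.
have nd0 : (0 < n %/ d)%N by rewrite divn_gt0 ?(dvdn_gt0 n0 dn) // dvdn_leq.
rewrite normrM -[leRHS]mul1r ler_pM ?normr_ge0 ?mobius_le1 //.
exact: IH.
Qed.

(** * Summatory functions and the convolution identity on boxes *)

Definition tau_sum (k N : nat) : nat := (\sum_(1 <= n < N.+1) tau k n)%N.

Lemma perm_nat_multiples (d Y : nat) : (0 < d)%N ->
  perm_eq [seq m <- index_iota 1 Y.+1 | (d %| m)%N]
          [seq (d * c)%N | c <- index_iota 1 (Y %/ d).+1].
Proof.
move=> d0; apply: uniq_perm.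
- by rewrite filter_uniq // iota_uniq.
- rewrite map_inj_uniq ?iota_uniq // => a b /eqP.
  by rewrite eqn_pmul2l // => /eqP.
move=> m; rewrite mem_filter mem_index_iota; apply/andP/mapP => [[dm /andP[m0 mY]]|[c]].
  exists (m %/ d)%N; last by rewrite mulnC divnK.
  by rewrite mem_index_iota divn_gt0 // dvdn_leq //= ltnS leq_div2r.
rewrite mem_index_iota => /andP[c0 cY] ->; rewrite dvdn_mulr //.
by rewrite muln_gt0 d0 c0 ltnS mulnC -leq_divRL.
Qed.

Lemma sum_nat_divisors (V : nmodType) (Y : nat) (F : nat -> nat -> V) :
  \sum_(1 <= m < Y.+1) \sum_(d <- divisors m) F d m =
  \sum_(1 <= d < Y.+1) \sum_(1 <= c < (Y %/ d).+1) F d (d * c)%N.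
Proof.
transitivity (\sum_(1 <= m < Y.+1) \sum_(1 <= d < Y.+1 | (d %| m)%N) F d m).
  rewrite big_seq [RHS]big_seq; apply: eq_bigr => m.
  rewrite mem_index_iota => /andP[m0 mY]; rewrite -[RHS]big_filter.
  apply: perm_big; apply: uniq_perm.
  - exact: divisors_uniq.
  - by rewrite filter_uniq // iota_uniq.
  move=> d; rewrite mem_filter mem_index_iota -dvdn_divisors //.
  case: (boolP (d %| m)%N) => //= dm.
  by rewrite (dvdn_gt0 m0 dm) (leq_ltn_trans (dvdn_leq m0 dm) mY).
under eq_bigr do rewrite big_mkcond.
rewrite exchange_big /= big_seq [RHS]big_seq; apply: eq_bigr => d.
rewrite mem_index_iota => /andP[d0 _]; rewrite -big_mkcond -big_filter.
by rewrite (perm_big _ (perm_nat_multiples d Y d0)) big_map.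
Qed.

(** Grouping by m = c n turns the left side into the inversion identity summed over m <= N. For c >
    N the quotient N / c is 0 and the summand vanishes, so the range may extend to any Z >= N. *)
Lemma sum_mobius_iter_tau_sum (R : comNzRingType) (k N Z : nat) : (N <= Z)%N ->
  \sum_(1 <= c < Z.+1) mobius_iter k c * (tau_sum k (N %/ c))%:R
  = (0 < N)%:R :> R.
Proof.
move=> NZ; rewrite (big_cat_nat (n := N.+1)) //= [X in _ + X]big_nat_cond.
rewrite [X in _ + X]big1 ?addr0; last first.
  move=> c /andP[/andP[Nc _] _].
  by rewrite divn_small // /tau_sum big_geq // mulr0.
transitivity (\sum_(1 <= m < N.+1) dconv (mobius_iter k) (fun m => (tau k m)%:R) m : R).
  rewrite /dconv (sum_nat_divisors _ _ (fun d m => mobius_iter k d * (tau k (m %/ d))%:R)).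
  rewrite big_nat [RHS]big_nat; apply: eq_bigr => c /andP[c0 _].
  rewrite /tau_sum natr_sum big_distrr /=; apply: eq_bigr => n _.
  by rewrite mulKn.
transitivity (\sum_(1 <= m < N.+1) (m == 1%N)%:R : R).
  rewrite big_nat [RHS]big_nat; apply: eq_bigr => m /andP[m0 _].
  exact: mobius_iter_tau.
case: N {NZ} => [|N]; first by rewrite big_geq.
rewrite big_nat_recl // big1_seq ?addr0 // => m.
by rewrite mem_index_iota => /andP[_ /andP[m0 _]]; case: m m0.
Qed.

(** The coefficient h(m_1, ..., m_r) of the overview, with a cofactor E: the map sending (d_1, ...,
    d_r) to tau_k(d_1 ... d_r E), convolved with the inverse of tau_k in each variable. The
    recursion moves the divisor chosen in one variable into E. *)
Fixpoint corr {R : comNzRingType} (k : nat) (ms : seq nat) (E : nat) : R :=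
  if ms is m :: ms' then dconv (mobius_iter k) (fun d => corr k ms' (d * E)) m
  else (tau k E)%:R.

Fixpoint boxes (r Y : nat) : seq (seq nat) :=
  if r is r'.+1 then [seq m :: ms | m <- index_iota 1 Y.+1, ms <- boxes r' Y]
  else [:: [::]].

(** The multiple sum with a cofactor E that collects the variables already fixed; [tauSum] is the
    case E = 1. *)
Fixpoint tau_box_sum (r k E N : nat) : nat :=
  if r is r'.+1 then (\sum_(1 <= n < N.+1) tau_box_sum r' k (n * E) N)%N
  else tau k E.

(** In one variable put m = d c, with d going into [tau] and c into the inverse. The sum over c is
    [sum_mobius_iter_tau_sum] at N / d, equal to 1 for d <= N and to 0 beyond, so Y only has to
    reach N. *)
Lemma corr_convolution (R : comNzRingType) (r k E N Y : nat) : (N <= Y)%N ->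
  \sum_(ms <- boxes r Y)
    corr k ms E * \prod_(m <- ms) (tau_sum k (N %/ m))%:R
  = (tau_box_sum r k E N)%:R :> R.
Proof.
move=> NY; elim: r E => [|r IH] E /=; first by rewrite big_seq1 big_nil mulr1.
rewrite big_allpairs_dep /=.
transitivity (\sum_(1 <= m < Y.+1) \sum_(d <- divisors m)
    mobius_iter k (m %/ d) * (tau_sum k (N %/ m))%:R
    * (tau_box_sum r k (d * E) N)%:R : R).
  rewrite big_nat [RHS]big_nat; apply: eq_bigr => m /andP[m0 _].
  under eq_bigr do rewrite big_cons /dconv big_distrl /=.
  rewrite exchange_big /=.
  rewrite -[RHS]sum_divisors_inv // big_seq [RHS]big_seq.
  apply: eq_bigr => d; rewrite -dvdn_divisors // => dm.
  rewrite divnA // mulKn // -IH big_distrr /=; apply: eq_bigr => ms _.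
  by rewrite -!mulrA; congr (_ * _); rewrite mulrCA.
rewrite (sum_nat_divisors _ _ (fun d m => mobius_iter k (m %/ d)
   * (tau_sum k (N %/ m))%:R * (tau_box_sum r k (d * E) N)%:R)) natr_sum.
rewrite (big_cat_nat (n := N.+1)) //= [X in _ + X]big_nat_cond.
rewrite [X in _ + X]big1 ?addr0; last first.
  move=> d /andP[/andP[Nd _] _]; rewrite big_nat_cond big1 // => c /andP[/andP[c0 _] _].
  rewrite (_ : (N %/ (d * c)) = 0)%N; last first.
    by rewrite divn_small // (leq_trans Nd) // leq_pmulr.
  by rewrite /tau_sum big_geq // mulr0 mul0r.
rewrite big_nat [RHS]big_nat; apply: eq_bigr => d /andP[d0 dN].
rewrite -[RHS]mul1r -big_distrl /=; congr (_ * _).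
rewrite -[RHS](_ : (0 < N %/ d)%:R = 1 :> R); last by rewrite divn_gt0 // -ltnS dN.
rewrite -(@sum_mobius_iter_tau_sum R k (N %/ d) (Y %/ d)) ?leq_div2r //.
by apply: eq_bigr => c _; rewrite mulKn // divnMA.
Qed.

Lemma tauSum_box (R : realType) (r k : nat) (x : R) :
  tauSum r k x = tau_box_sum r k 1 (Num.truncn x).
Proof.
rewrite /tauSum; set N := Num.truncn x.
suff H E : (\sum_(t : {ffun 'I_r -> 'I_N}) tau k (\prod_(i < r) (t i).+1 * E))%N
    = tau_box_sum r k E N.
  by rewrite -H; apply: eq_bigr => t _; rewrite muln1.
elim: r E => [|r IH] E.
  rewrite (eq_bigr (fun _ => tau k E)) ?sum_nat_const ?card_ffun ?card_ord ?expn0 ?mul1n //.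
  by move=> t _; rewrite big_ord0 mul1n.
rewrite big_ffun_cons /= big_add1 big_mkord; apply: eq_bigr => a _.
rewrite -IH; apply: eq_bigr => t _; congr tau.
rewrite big_ord_recl ffcons0 -mulnA mulnCA; congr (_ * _)%N.
by apply: eq_bigr => i _; rewrite ffcons_lift.
Qed.

(** As p divides neither E nor any entry, p ^ b passes unchanged through each convolution down to
    [tau], where multiplicativity splits it off. *)
Lemma corr_pfactor (R : comNzRingType) (k p b E : nat) (ms : seq nat) :
  prime p -> (0 < E)%N -> ~~ (p %| E)%N -> all (leq 1) ms ->
  ~~ has (fun m => p %| m)%N ms ->
  corr k ms (p ^ b * E) = (tau k (p ^ b))%:R * corr k ms E :> R.
Proof.
move=> pp; elim: ms E => [|m ms IH] E E0 pE /=.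
  have pb0 : (0 < p ^ b)%N by rewrite expn_gt0 prime_gt0.
  by rewrite tau_coprime ?natrM // coprimeXl // prime_coprime.
move=> /andP[m0 ms0]; rewrite negb_or => /andP[pm pms].
rewrite /dconv big_distrr /= big_seq [RHS]big_seq; apply: eq_bigr => d.
rewrite -dvdn_divisors // => dm.
have md0 : (0 < m %/ d)%N by rewrite divn_gt0 ?(dvdn_gt0 m0 dm) // dvdn_leq.
rewrite mulnCA IH // ?muln_gt0 ?md0 //; first by rewrite mulrCA.
rewrite Euclid_dvdM // negb_or pE andbT.
by apply: contra pm => /dvdn_trans; apply; apply: dvdn_div.
Qed.

(* [mobius_iter k * g] is supported on the integers prime to [p]: convolving
   its restriction to those integers with [tau k] gives back [g]. *)
Lemma dconv_mobius_iter_vanish (R : comNzRingType) (k p m : nat) (g : nat -> R) :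
  prime p -> (0 < m)%N -> (p %| m)%N ->
  (forall b u, (0 < u)%N -> ~~ (p %| u)%N -> g (p ^ b * u)%N = (tau k (p ^ b))%:R * g u) ->
  dconv (mobius_iter k) g m = 0.
Proof.
move=> pp m0 pm Hg.
pose t n : R := (tau k n)%:R.
pose w : nat -> R := dconv (mobius_iter k) g.
pose w' n := if (p %| n)%N then 0 else w n.
have tw n : (0 < n)%N -> dconv t w n = g n.
  move=> n0; rewrite /w -dconvA //.
  rewrite (@eq_dconv _ _ (fun m => (m == 1%N)%:R) _ g) ?dconv1 // => l l0.
  by rewrite dconvC // mobius_iter_tau.
have tw' n : (0 < n)%N -> dconv w' t n = g n.
  move=> n0; have [u pu En] := pfactor_coprime pp n0.
  move: pu; rewrite prime_coprime // => pu.
  have u0 : (0 < u)%N by move: n0; rewrite En muln_gt0 => /andP[].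
  rewrite En mulnC; move: (logn p n) => a; rewrite Hg // -tw // [dconv t w u]dconvC //.
  rewrite /dconv sum_divisors_prime_split // big_ord_recl [X in _ + X]big1 ?addr0; last first.
    move=> i _; rewrite big1 // => e _.
    have pd : (p %| p ^ lift ord0 i * e)%N.
      by rewrite lift0 expnS -mulnA dvdn_mulr.
    by rewrite /w' pd mul0r.
  rewrite big_distrr /= big_seq [RHS]big_seq; apply: eq_bigr => e.
  rewrite -dvdn_divisors // => eu; rewrite expn0 mul1n /w' ifN; last first.
    by apply: contra pu => /dvdn_trans; apply.
  rewrite mulrCA; congr (_ * _); rewrite /t -muln_divA // tau_coprime ?natrM //.
  - by rewrite expn_gt0 prime_gt0.
  - by rewrite divn_gt0 ?(dvdn_gt0 u0 eu) // dvdn_leq.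
  rewrite coprimeXl // prime_coprime //.
  by apply: contra pu => /dvdn_trans; apply; apply: dvdn_div.
rewrite (@eq_dconv _ _ (mobius_iter k) _ (dconv t w')) //; last first.
  by move=> l l0; rewrite dconvC // tw'.
rewrite -dconvA // (@eq_dconv _ _ (fun m => (m == 1%N)%:R) _ w') //.
  by rewrite dconv1 // /w' pm.
by move=> l l0; rewrite mobius_iter_tau.
Qed.

(** At the only entry divisible by p, the inner function factors as [dconv_mobius_iter_vanish]
    requires, by [corr_pfactor] for the later entries. Earlier entries contribute only divisors
    prime to p, which keep E prime to p. *)
Lemma corr_vanish (R : comNzRingType) (k p E : nat) (ms : seq nat) :
  prime p -> (0 < E)%N -> ~~ (p %| E)%N -> all (leq 1) ms ->
  count (fun m => p %| m)%N ms = 1%N -> corr k ms E = 0 :> R.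
Proof.
move=> pp; elim: ms E => [|m ms IH] E E0 pE //= /andP[m0 ms0].
case: (boolP (p %| m)%N) => [pm|pm] /=.
  rewrite addSn add0n => -[/eqP]; rewrite -leqn0 leqNgt -has_count => pms.
  apply: (@dconv_mobius_iter_vanish R k p m) => // b u u0 pu.
  rewrite -mulnA corr_pfactor ?muln_gt0 ?u0 //.
  by rewrite Euclid_dvdM // negb_or pu.
rewrite add0n => Hc; rewrite /dconv big_seq big1 // => d.
rewrite -dvdn_divisors // => dm.
have md0 : (0 < m %/ d)%N by rewrite divn_gt0 ?(dvdn_gt0 m0 dm) // dvdn_leq.
rewrite IH ?mulr0 ?muln_gt0 ?md0 //.
rewrite Euclid_dvdM // negb_or pE andbT.
by apply: contra pm => /dvdn_trans; apply; apply: dvdn_div.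
Qed.

(** * Convergence of the weighted correlation sums *)

Lemma one_powR {R : realType} (r : R) : 1 `^ r = 1.
Proof. by rewrite powR1. Qed.

Lemma gt0_powRD {R : realType} (x r s : R) : 0 < x -> x `^ (r + s) = x `^ r * x `^ s.
Proof. by move=> x0; rewrite powRD // (gt_eqF x0) implybT. Qed.

Lemma natr_ge1 {R : realType} (n : nat) : (0 < n)%N -> (1 : R) <= n%:R.
Proof. by rewrite ler1n. Qed.

Lemma natr_gt0 {R : realType} (n : nat) : (0 < n)%N -> (0 : R) < n%:R.
Proof. by rewrite ltr0n. Qed.

Lemma powR_le_powRr {R : realType} (x y r : R) : 0 <= x -> x <= y -> 0 <= r ->
  x `^ r <= y `^ r.
Proof.
move=> x0 xy r0; apply: ge0_ler_powR => //; rewrite nnegrE //.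
exact: le_trans xy.
Qed.

Lemma powRN_le {R : realType} (x y r : R) : 0 < x -> x <= y -> 0 <= r ->
  y `^ (- r) <= x `^ (- r).
Proof.
move=> x0 xy r0; rewrite !powRN lef_pV2 ?posrE ?powR_gt0 //.
  by apply: powR_le_powRr => //; exact: ltW.
exact: lt_le_trans xy.
Qed.

Lemma powR_ge1 {R : realType} (x r : R) : 1 <= x -> 0 <= r -> 1 <= x `^ r.
Proof. by move=> x1 r0; rewrite -(powRr0 x) ler_powR. Qed.

Lemma powR_Nlt1 {R : realType} (x r : R) : 1 < x -> 0 < r -> x `^ (- r) < 1.
Proof.
move=> x1 r0; have x0 : 0 < x := lt_trans ltr01 x1.
rewrite powRN invf_lt1 ?powR_gt0 // -[ltLHS](one_powR r).
by apply: gt0_ltr_powR; rewrite ?nnegrE ?ler01 // ltW.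
Qed.

Lemma natr_prod_powR {R : realType} (ms : seq nat) (s : R) :
  (\prod_(m <- ms) m)%N%:R `^ s = \prod_(m <- ms) (m%:R `^ s).
Proof.
elim: ms => [|m ms IH]; first by rewrite !big_nil powR1.
by rewrite !big_cons natrM powRM // IH.
Qed.

(** * Integers with prescribed prime factors, and divisor bounds *)

Definition smooth (s : seq nat) (m : nat) : bool := all (mem s) (primes m).

Definition smooth_sum {R : realType} (c : R) (s : seq nat) (Y : nat) : R :=
  \sum_(1 <= m < Y.+1 | smooth s m) m%:R `^ (- c).

Lemma sub_smooth_sum (R : realType) (c : R) (s : seq nat) (Y Z : nat) :
  (Z <= Y)%N -> smooth_sum c s Z <= smooth_sum c s Y.
Proof.
move=> ZY; rewrite /smooth_sum [leRHS](big_cat_nat (n := Z.+1)) //= lerDl.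
by apply: sumr_ge0 => m _; exact: powR_ge0.
Qed.

Lemma smooth_sum_nil (R : realType) (c : R) (Y : nat) : smooth_sum c [::] Y <= 1.
Proof.
rewrite /smooth_sum; case: Y => [|Y]; first by rewrite big_geq // ler01.
rewrite big_mkcond big_nat_recl //= powR1 big1_seq ?addr0 //= => m.
rewrite mem_index_iota => /andP[m0 _]; case: ifP => // sm; exfalso.
have pp : prime (pdiv m.+1) by rewrite pdiv_prime // ltnS.
have : pdiv m.+1 \in primes m.+1 by rewrite mem_primes pp /= pdiv_dvd.
by move/allP: sm => H /H.
Qed.

(** Splitting by divisibility by p gives S(p :: s, Y) <= S(s, Y) + p ^ (- c) S(p :: s, Y / p), and
    the last sum is at most S(p :: s, Y). Solving for it yields one Euler factor. *)
Lemma smooth_sum_cons (R : realType) (c : R) (p : nat) (s : seq nat) (Y : nat) :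
  prime p -> 0 < c ->
  smooth_sum c (p :: s) Y <= (1 - p%:R `^ (- c))^-1 * smooth_sum c s Y.
Proof.
move=> pp c0.
have p0 := prime_gt0 pp; have p1 := prime_gt1 pp.
have pc : p%:R `^ (- c) < 1 :> R.
  by rewrite powR_Nlt1 // ltr1n.
rewrite mulrC ler_pdivlMr ?subr_gt0 // mulrBr mulr1 lerBlDr.
rewrite {1}/smooth_sum (bigID (fun m => p %| m)%N) /= addrC lerD //.
  rewrite /smooth_sum big_mkcond [leRHS]big_mkcond /= big_nat [leRHS]big_nat.
  apply: ler_sum => m /andP[m0 _].
  have [sm|] := boolP (smooth s m); last first.
    move=> nsm; case: ifP => // /andP[/allP sm pm]; exfalso; move/negP: nsm; apply.
    apply/allP => q qm; have := sm q qm; rewrite !inE => /orP[/eqP E|//].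
    by move: qm; rewrite E mem_primes (negPf pm) !andbF.
  by case: ifP => // _; exact: powR_ge0.
rewrite mulrC; apply: le_trans (ler_wpM2l (powR_ge0 _ _) (sub_smooth_sum R c (p :: s) Y (Y %/ p) (leq_div _ _))).
rewrite /smooth_sum big_distrr /= (eq_bigl (fun m => (p %| m)%N && smooth (p :: s) m)); last first.
  by move=> m; rewrite andbC.
rewrite -big_filter_cond (perm_big _ (perm_nat_multiples p Y p0)) big_map.
rewrite big_mkcond [leRHS]big_mkcond /= big_nat [leRHS]big_nat.
apply: ler_sum => m /andP[m0 _].
case: ifP => [sm|_]; last by case: ifP => // _; rewrite mulr_ge0 ?powR_ge0.
rewrite ifT; first by rewrite natrM powRM.
apply/allP => q qm; apply: (allP sm).
by rewrite primesM // qm orbT.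
Qed.

Lemma smooth_sum_le (R : realType) (c : R) (s : seq nat) (Y : nat) :
  0 < c -> all prime s ->
  smooth_sum c s Y <= \prod_(p <- s) (1 - p%:R `^ (- c))^-1.
Proof.
move=> c0; elim: s => [|p s IH] /=; first by rewrite big_nil smooth_sum_nil.
move=> /andP[pp ps]; rewrite big_cons.
apply: le_trans (@smooth_sum_cons R c p s Y pp c0) _.
rewrite ler_wpM2l ?IH // invr_ge0 subr_ge0 powRN invf_le1.
  by rewrite powR_ge1 ?natr_ge1 ?prime_gt0 // ltW.
by rewrite powR_gt0 // natr_gt0 // prime_gt0.
Qed.

Lemma dvdn_prod_primesX (e : nat) (s : seq nat) (n : nat) : uniq s -> all prime s ->
  all (fun p => p ^ e %| n)%N s -> (\prod_(p <- s) p ^ e %| n)%N.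
Proof.
elim: s => [|p s IH] /=; first by rewrite big_nil dvd1n.
move=> /andP[ps us] /andP[pp pps] /andP[pn psn]; rewrite big_cons Gauss_dvd ?pn ?IH //.
rewrite coprimeXl // prime_coprime //; apply/negP => pd; move/negP: ps; apply.
elim: s pps pd {IH us psn} => [|q s IH] /=; first by rewrite big_nil dvdn1 => _ /eqP E; rewrite E in pp.
move=> /andP[pq pps]; rewrite big_cons Euclid_dvdM // inE => /orP[|pd].
  by rewrite Euclid_dvdX // dvdn_prime2 // => /andP[->].
by rewrite IH ?orbT.
Qed.

Lemma dvdn_prod_primes (s : seq nat) (n : nat) : uniq s -> all prime s ->
  all (fun p => p %| n)%N s -> (\prod_(p <- s) p %| n)%N.
Proof. exact: (@dvdn_prod_primesX 1 s n). Qed.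

Lemma prod_primes_le (n : nat) : (0 < n)%N -> (\prod_(p <- primes n) p <= n)%N.
Proof.
move=> n0; rewrite dvdn_leq // dvdn_prod_primes ?primes_uniq //.
  by apply/allP => p; rewrite mem_primes => /andP[].
by apply/allP => p; rewrite mem_primes => /and3P[].
Qed.

(** The bound is an Euler product over the primes of P. Each factor is at most A, its value at 2,
    and a factor at p >= p0 is at most p ^ eta because A ^ (1 / eta) < p0. At most p0 primes lie
    below p0, and the product of the primes of P is at most P. *)
Lemma smooth_sum_primes_le (R : realType) (c eta : R) : 0 < c -> 0 < eta ->
  exists2 C : R, 0 < C & forall P Y : nat, (0 < P)%N ->
    smooth_sum c (primes P) Y <= C * P%:R `^ eta.
Proof.
move=> c0 e0.
pose A : R := (1 - 2 `^ (- c))^-1.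
have h2 : 2 `^ (- c) < 1 :> R.
  by rewrite powR_Nlt1 // ltr1n.
have A1 : 1 <= A by rewrite /A invf_ge1 ?subr_gt0 // gerBl powR_ge0.
have A0 : 0 < A := lt_le_trans ltr01 A1.
pose p0 := (Num.truncn (A `^ eta^-1)).+1.
have Hp p : prime p -> (1 - p%:R `^ (- c))^-1 <= A.
  move=> pp; have p2 : (2 : R) <= p%:R by rewrite ler_nat prime_gt1.
  have pc : p%:R `^ (- c) <= 2 `^ (- c) :> R by rewrite powRN_le ?ltr0n // ltW.
  rewrite lef_pV2 ?posrE ?subr_gt0 ?lerB //.
  exact: le_lt_trans pc h2.
have Hbig p : (p0 <= p)%N -> A <= p%:R `^ eta.
  move=> pp; have Ap : A `^ eta^-1 <= p%:R.
    apply: ltW; apply: lt_le_trans (_ : p0%:R <= _); last by rewrite ler_nat.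
    exact: truncnS_gt.
  have -> : A = (A `^ eta^-1) `^ eta.
    by rewrite -powRrM mulVf ?gt_eqF // powRr1 // ltW.
  by apply: powR_le_powRr; rewrite ?powR_ge0 // ltW.
have key s : all prime s -> \prod_(p <- s) (1 - p%:R `^ (- c))^-1
    <= A ^+ count (fun p => p < p0)%N s * (\prod_(p <- s) p)%N%:R `^ eta.
  elim: s => [|p s IH] /=; first by rewrite !big_nil powR1 mulr1.
  move=> /andP[pp ps]; rewrite !big_cons natrM powRM // exprD mulrACA.
  have pc : p%:R `^ (- c) <= 2 `^ (- c) :> R by rewrite powRN_le ?ltr0n ?ler_nat ?prime_gt1 // ltW.
  have f0 q : prime q -> 0 <= (1 - q%:R `^ (- c))^-1 :> R.
    move=> pq; have qc : q%:R `^ (- c) <= 2 `^ (- c) :> R by rewrite powRN_le ?ltr0n ?ler_nat ?prime_gt1 // ltW.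
    by rewrite invr_ge0 subr_ge0 (le_trans qc) // ltW.
  apply: ler_pM => //; first exact: f0.
  - by rewrite big_seq prodr_ge0 // => q qs; apply: f0; exact: (allP ps).
  - have [pp0|pp0] := ltnP p p0 => /=; last first.
      by rewrite expr0 mul1r (le_trans (Hp p pp)) // Hbig.
    rewrite expr1 (le_trans (Hp p pp)) // ler_peMr ?(ltW A0) //.
    by rewrite powR_ge1 ?natr_ge1 ?prime_gt0 // ltW.
  - exact: IH.
exists (A ^+ p0); first exact: exprn_gt0.
move=> P Y P0.
have aP : all prime (primes P) by apply/allP => p; rewrite mem_primes => /andP[].
apply: le_trans (@smooth_sum_le R c (primes P) Y c0 aP) _.
apply: le_trans (key _ aP) _.
apply: ler_pM; rewrite ?exprn_ge0 ?powR_ge0 ?(ltW A0) //.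
  rewrite ler_weXn2l //.
  rewrite -size_filter -[X in (_ <= X)%N](size_iota 0) uniq_leq_size ?filter_uniq ?primes_uniq //.
  by move=> p; rewrite mem_filter mem_iota => /andP[].
apply: powR_le_powRr; rewrite ?ler_nat ?prod_primes_le ?ler0n //.
exact: ltW.
Qed.

(** Rankin's device: each divisor d of n satisfies 1 <= (n / d) ^ (eta / 2), so the count is at most
    n ^ (eta / 2) times a sum over integers built from the primes of n. *)
Lemma size_divisors_le (R : realType) (eta : R) : 0 < eta ->
  exists2 C : R, 0 < C & forall n : nat, (0 < n)%N ->
    (size (divisors n))%:R <= C * n%:R `^ eta.
Proof.
move=> e0; have e20 : 0 < eta / 2 by rewrite divr_gt0.
have [C C0 HC] := smooth_sum_primes_le R _ _ e20 e20.
exists C => // n n0.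
have n1 := natr_gt0 n n0 : 0 < n%:R :> R.
apply: le_trans (_ : n%:R `^ (eta / 2) * smooth_sum (eta / 2) (primes n) n <= _).
  rewrite -sum1_size natr_sum -(sum_ord_dvdn R n n (fun _ => 1%:R)) //.
  rewrite -(big_mkord (fun a => a %| n)%N (fun _ => 1%:R)).
  rewrite big_mkcond big_nat_recl // dvd0n gtn_eqF //= add0r.
  rewrite /smooth_sum big_add1 /= big_distrr /= [leRHS]big_mkcond /=.
  rewrite big_nat [leRHS]big_nat; apply: ler_sum => d /andP[_ dn].
  case: ifP => [dvd|_]; last by case: ifP => // _; rewrite mulr_ge0 // powR_ge0.
  rewrite ifT; last first.
    apply/allP => q qd; change (q \in primes n).
    move: qd; rewrite !mem_primes n0 => /and3P[-> _ qd] /=.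
    exact: dvdn_trans qd dvd.
  rewrite powRN ler_pdivlMr ?powR_gt0 ?natr_gt0 // mul1r.
  by rewrite powR_le_powRr ?ler0n ?ler_nat // ltW.
rewrite {3}(splitr eta) gt0_powRD // mulrCA ler_wpM2l ?powR_ge0 //.
exact: HC.
Qed.

Lemma tau_le (R : realType) (k : nat) (eta : R) : 0 < eta ->
  exists2 C : R, 0 < C & forall n : nat, (0 < n)%N ->
    (tau k n)%:R <= C * n%:R `^ eta.
Proof.
elim: k eta => [|k IH] eta e0.
  exists 1 => // n n0; rewrite tau0 // mul1r.
  apply: le_trans (_ : 1 <= _); first by case: eqP.
  by rewrite powR_ge1 ?natr_ge1 // ltW.
have e20 : 0 < eta / 2 by rewrite divr_gt0.
have [C C0 HC] := IH _ e20; have [D D0 HD] := size_divisors_le R _ e20.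
exists (C * D); first exact: mulr_gt0.
move=> n n0; have n1 := natr_gt0 n n0 : 0 < n%:R :> R.
rewrite tauS // natr_sum.
apply: le_trans (_ : \sum_(d <- divisors n) C * n%:R `^ (eta / 2) <= _).
  rewrite big_seq [leRHS]big_seq; apply: ler_sum => d; rewrite -dvdn_divisors // => dn.
  apply: le_trans (HC d (dvdn_gt0 n0 dn)) _; rewrite ler_wpM2l ?(ltW C0) //.
  by rewrite powR_le_powRr ?ler0n ?ler_nat ?(dvdn_leq n0 dn) // ltW.
rewrite big_const_seq count_predT iter_addr_0 -[leLHS]mulr_natr {2}(splitr eta) gt0_powRD //.
rewrite -!mulrA ler_wpM2l ?(ltW C0) // [leRHS]mulrCA ler_wpM2l ?powR_ge0 //.
exact: HD.
Qed.

(** Each Moebius factor is at most [tau k d], and these sum over d | m to [tau k.+1 m]. Half of eta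
    pays for that sum, the other half for the induction. *)
Lemma corr_le (R : realType) (k r : nat) (eta : R) : 0 < eta ->
  exists2 C : R, 0 < C & forall (ms : seq nat) (E : nat), size ms = r ->
    all (leq 1) ms -> (0 < E)%N ->
    `|corr k ms E : R| <= C * (\prod_(m <- ms) m * E)%N%:R `^ eta.
Proof.
elim: r eta => [|r IH] eta e0.
  have [C C0 HC] := tau_le R k _ e0; exists C => // -[|//] E _ _ E0 /=.
  by rewrite normr_nat big_nil mul1n HC.
have e20 : 0 < eta / 2 by rewrite divr_gt0.
have [C C0 HC] := IH _ e20; have [D D0 HD] := tau_le R k.+1 _ e20.
exists (C * D); first exact: mulr_gt0.
move=> [//|m ms] E [sms] /= /andP[m0 ms0] E0.
have p0 : (0 < \prod_(j <- ms) j)%N.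
  by rewrite big_seq prodn_cond_gt0 // => j /(allP ms0).
rewrite big_cons; set P := (m * _ * E)%N.
have P0 : 0 < P%:R :> R by rewrite natr_gt0 // /P !muln_gt0 m0 p0.
apply: le_trans (_ : \sum_(d <- divisors m) (tau k d)%:R * (C * P%:R `^ (eta / 2)) <= _).
  apply: le_trans (ler_norm_sum _ _ _) _.
  rewrite big_seq [leRHS]big_seq; apply: ler_sum => d; rewrite -dvdn_divisors // => dm.
  have d0 := dvdn_gt0 m0 dm.
  have md0 : (0 < m %/ d)%N by rewrite divn_gt0 // dvdn_leq.
  rewrite normrM ler_pM ?normr_ge0 ?mobius_iter_le //.
  apply: le_trans (HC _ _ sms ms0 _) _; first by rewrite muln_gt0 md0.
  rewrite ler_wpM2l ?(ltW C0) // powR_le_powRr ?ler0n ?ler_nat //; last exact: ltW.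
  by rewrite /P [X in (_ <= X * _)%N]mulnC -mulnA leq_mul2l leq_mul2r leq_div !orbT.
rewrite -big_distrl /= -natr_sum -tauS //.
apply: le_trans (_ : D * P%:R `^ (eta / 2) * (C * P%:R `^ (eta / 2)) <= _).
  rewrite ler_wpM2r ?mulr_ge0 ?powR_ge0 ?(ltW C0) //.
  apply: le_trans (HD m m0) _; rewrite ler_wpM2l ?(ltW D0) //.
  rewrite powR_le_powRr ?ler0n ?ler_nat //; last exact: ltW.
  by rewrite /P -mulnA leq_pmulr // muln_gt0 p0.
by rewrite {3}(splitr eta) gt0_powRD // mulrACA [D * C]mulrC.
Qed.

Lemma sum_powR_le (R : realType) (s : R) : 0 < s -> exists2 B : R, 0 < B &
  forall Z : nat, \sum_(1 <= n < Z.+1) n%:R `^ (- (1 + s)) <= B.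
Proof.
move=> s0; exists (1 + s^-1); first by rewrite addr_gt0 ?invr_gt0.
case=> [|Z]; first by rewrite big_geq // addr_ge0 // invr_ge0 ltW.
(* The comparison term is 1 plus the integral of t ^ (- 1 - s) over [1, Z + 1]; the induction step
   reduces to 1 + s / P <= (P / (P - 1)) ^ s. *)
apply: le_trans (_ : 1 + s^-1 * (1 - Z.+1%:R `^ (- s)) <= _); last first.
  by rewrite lerD2l ler_piMr ?invr_ge0 ?(ltW s0) // gerBl powR_ge0.
elim: Z => [|Z IH].
  by rewrite big_nat1 !one_powR subrr mulr0 addr0.
rewrite big_nat_recr //=; apply: le_trans (lerD IH (lexx _)) _.
have E (a c : R) : 1 - c - (1 - a) = a - c by ring.
rewrite -addrA lerD2l -lerBrDl -mulrBr E.
rewrite -ler_pdivrMl ?invr_gt0 // invrK.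
set P : R := Z.+2%:R.
have P0 : 0 < P by rewrite natr_gt0.
have PZ : P = Z.+1%:R + 1 by rewrite /P -natr1.
have Z0 : 0 < Z.+1%:R :> R by rewrite natr_gt0.
rewrite opprD [- 1 - s]addrC gt0_powRD // powR_inv1 ?(ltW P0) //.
rewrite lerBrDr; have -> : s * (P `^ (- s) / P) + P `^ (- s) = P `^ (- s) * (1 + s / P).
  by ring.
rewrite powRN ler_pdivrMl ?powR_gt0 //.
apply: le_trans (expR_ge1Dx _) _.
rewrite /powR !gt_eqF // -expRD ler_expR mulNr -mulrBr ler_wpM2l ?(ltW s0) //.
rewrite -ln_div ?posrE //.
have -> : P / Z.+1%:R = (Z.+1%:R / P)^-1 by rewrite invf_div.
rewrite lnV ?posrE ?divr_gt0 // lerNr.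
have -> : Z.+1%:R / P = 1 + (- P^-1).
  have Z1 : Z.+1%:R = P - 1 by rewrite PZ addrK.
  by rewrite Z1 mulrBl divff ?gt_eqF // mul1r.
apply: le_ln1Dx; rewrite ltrN2 invf_lt1 // PZ ltrDr //.
Qed.

Lemma mem_boxes (r Y : nat) (ms : seq nat) :
  (ms \in boxes r Y) = (size ms == r) && all (fun m => 0 < m <= Y)%N ms.
Proof.
elim: r ms => [|r IH] ms /=; first by rewrite inE -size_eq0; case: ms.
apply/allpairsP/idP => [[[m ms'] /= [mY H ->]] /=|].
  by move: mY H; rewrite mem_index_iota IH ltnS => -> /andP[/eqP -> ->]; rewrite eqxx.
case: ms => // m ms; rewrite /= eqSS => /andP[sms /andP[mY aY]].
by exists (m, ms); split=> //=; rewrite ?mem_index_iota // IH sms.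
Qed.

Lemma prod_sum_boxes (R : comNzRingType) (r Y : nat) (P : pred nat) (F : nat -> R) :
  \sum_(ms <- boxes r Y | all P ms) \prod_(m <- ms) F m =
  (\sum_(1 <= m < Y.+1 | P m) F m) ^+ r.
Proof.
elim: r => [|r IH] /=; first by rewrite big_mkcond big_seq1 big_nil.
rewrite exprS -IH big_mkcond big_allpairs_dep /= big_distrl /= [RHS]big_mkcond /=.
apply: eq_bigr => m _; case: ifP => _; last by rewrite big1.
rewrite big_distrr /= [RHS]big_mkcond /=; apply: eq_bigr => ms _.
by rewrite big_cons.
Qed.

Lemma powR_expR {R : realType} (x s : R) : 0 < x -> x `^ s = expR (s * ln x).
Proof. by move=> x0; rewrite /powR gt_eqF. Qed.

Lemma all_prime_primes (n : nat) : all prime (primes n).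
Proof. by apply/allP => p; rewrite mem_primes => /andP[]. Qed.

Lemma radical_dvd_rem (ms : seq nat) (m : nat) : m \in ms ->
  (forall p, prime p -> count (fun j => p %| j)%N ms != 1%N) ->
  all (fun p => p %| \prod_(j <- rem m ms) j)%N (primes (\prod_(j <- ms) j)).
Proof.
move=> mms H; apply/allP => p; rewrite mem_primes => /and3P[pp _].
have := H p pp; rewrite (perm_big _ (perm_to_rem mms)) big_cons /=.
rewrite (permP (perm_to_rem mms)) /= Euclid_dvdM // => Hc /orP[pm|//].
apply/negPn/negP => Hn; move/negP: Hc; apply; rewrite pm add1n eqSS.
rewrite -leqn0 leqNgt -has_count; apply/hasP => -[j jms pj]; move/negP: Hn; apply.
by rewrite (perm_big _ (perm_to_rem jms)) big_cons dvdn_mulr.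
Qed.

Lemma radical_sqr_dvd (ms : seq nat) :
  (forall p, prime p -> count (fun j => p %| j)%N ms != 1%N) ->
  ((\prod_(p <- primes (\prod_(j <- ms) j)) p) ^ 2 %| \prod_(j <- ms) j)%N.
Proof.
move=> H.
have -> (s : seq nat) : ((\prod_(p <- s) p) ^ 2 = \prod_(p <- s) p ^ 2)%N.
  by rewrite -mulnn -big_split; apply: eq_bigr => p _; rewrite -mulnn.
apply: dvdn_prod_primesX; rewrite ?primes_uniq ?all_prime_primes //.
apply/allP => p pN.
have /hasP[m mms pm] : has (fun j => p %| j)%N ms.
  move: pN; rewrite mem_primes => /and3P[pp _].
  elim: ms {H} => [|m ms IH]; first by rewrite big_nil Euclid_dvd1.
  by rewrite big_cons Euclid_dvdM //= => /orP[->//|/IH ->]; rewrite orbT.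
have := allP (radical_dvd_rem ms m mms H) p pN.
by rewrite (perm_big _ (perm_to_rem mms)) big_cons -mulnn; apply: dvdn_mul.
Qed.

(** Here n stands for N / m, the product of the other entries. In logarithms the claim is a
    combination of P <= n and P ^ 2 <= m n with nonnegative coefficients ([h1], [h2]), and eps <=
    sigma / 8 leaves a nonnegative multiple of log P ([h3]). One power sigma / 16 of N is spent on
    the bound for [corr]; another is kept for the convergence of the sum. *)
Lemma radical_weight_le (R : realType) (sigma eps : R) (m n P : nat) :
  (0 < m)%N -> (0 < P)%N -> (P <= n)%N -> (P ^ 2 <= m * n)%N ->
  0 < sigma -> 0 < eps <= sigma / 8 -> sigma + eps <= 1 ->
  m%:R `^ (1 - eps - sigma) * (m * n)%N%:R `^ (- (1 - eps)) * (m * n)%N%:R `^ (sigma / 16)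
  <= (m * n)%N%:R `^ (- (sigma / 16)) * P%:R `^ (- (1 + sigma / 2)) :> R.
Proof.
move=> m0 P0 Pn Pmn s0 /andP[e0 es] s1.
have n0 : (0 < n)%N := leq_trans P0 Pn.
have m0' : 0 < m%:R :> R by rewrite natr_gt0.
have n0' : 0 < n%:R :> R by rewrite natr_gt0.
have P0' : 0 < P%:R :> R by rewrite natr_gt0.
have mn0' : 0 < (m * n)%N%:R :> R by rewrite natrM mulr_gt0.
rewrite !powR_expR // -!expRD ler_expR natrM lnM ?posrE //.
set a := ln m%:R; set b := ln n%:R; set q := ln P%:R.
have q0 : 0 <= q by rewrite ln_ge0 // natr_ge1.
have qb : q <= b by rewrite ler_ln ?posrE // ler_nat.
have qab : 2 * q <= a + b.
  have -> : 2 * q = ln (P%:R ^+ 2) by rewrite lnXn // mulr_natl.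
  rewrite -lnM ?posrE // ler_ln ?posrE ?exprn_gt0 ?mulr_gt0 //.
  by rewrite -natrX -natrM ler_nat.
have h1 : 0 <= (a + b - 2 * q) * (sigma - sigma / 8) by apply: mulr_ge0; lra.
have h2 : 0 <= (b - q) * (1 - eps - sigma) by apply: mulr_ge0; lra.
have h3 : 0 <= q * (sigma / 2 - eps - sigma / 8 - sigma / 8) by apply: mulr_ge0; lra.
nra.
Qed.

(** Tuples are grouped by the radical P of their product. Their entries are composed of primes of P,
    so one P contributes at most the r-th power of a [smooth_sum], that is C ^ r P ^ (r eta); as r
    eta <= delta / 2, the sum over P converges. Admitting every tuple whose entries are built from
    primes of P only enlarges the sum. *)
Lemma sum_radical_bounded (R : realType) (r : nat) (c delta : R) : 0 < c -> 0 < delta ->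
  exists2 B : R, 0 < B & forall Y : nat,
    \sum_(ms <- boxes r Y) (\prod_(m <- ms) m)%N%:R `^ (- c) *
      (\prod_(p <- primes (\prod_(m <- ms) m)) p)%N%:R `^ (- (1 + delta)) <= B.
Proof.
move=> c0 d0.
pose eta := delta / (2 * r.+1%:R).
have e0 : 0 < eta by rewrite divr_gt0 ?mulr_gt0 ?natr_gt0.
have [C C0 HC] := smooth_sum_primes_le R c eta c0 e0.
have d20 : 0 < delta / 2 by rewrite divr_gt0.
have [B B0 HB] := sum_powR_le R _ d20.
exists (C ^+ r * B); first by rewrite mulr_gt0 ?exprn_gt0.
move=> Y.
pose rad n := (\prod_(p <- primes n) p)%N.
pose w P : R := P%:R `^ (- (1 + delta)).
apply: le_trans (_ : \sum_(ms <- boxes r Y) \sum_(1 <= P < (Y ^ r).+1)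
   (if all (smooth (primes P)) ms then w P * \prod_(m <- ms) m%:R `^ (- c) else 0) <= _).
  rewrite big_seq [leRHS]big_seq; apply: ler_sum => ms; rewrite mem_boxes => /andP[/eqP sms ams].
  set N := (\prod_(m <- ms) m)%N.
  have ms0 : all (leq 1) ms by apply: sub_all ams => m /andP[].
  have N0 : (0 < N)%N by rewrite /N big_seq prodn_cond_gt0 // => j /(allP ms0).
  have NY : (N <= Y ^ r)%N.
    rewrite /N -sms; elim: (ms) ams => [|m s IH] /=; first by rewrite big_nil.
    by move=> /andP[/andP[_ mY] /IH]; rewrite big_cons expnS; exact: leq_mul.
  have rN0 : (0 < rad N)%N.
    by rewrite /rad big_seq prodn_cond_gt0 // => j /(allP (all_prime_primes _)) /prime_gt0.
  have rin : rad N \in index_iota 1 (Y ^ r).+1.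
    by rewrite mem_index_iota rN0 ltnS (leq_trans (prod_primes_le _ N0)).
  rewrite [leRHS](bigD1_seq (rad N) rin (iota_uniq _ _)) /=.
  rewrite ifT; last first.
    apply/allP => m mms; apply/allP => q; rewrite mem_primes => /and3P[pq _ qm].
    change (q \in primes (rad N)); rewrite mem_primes pq rN0 /=.
    have qN : q \in primes N.
      by rewrite mem_primes pq N0 /N (perm_big _ (perm_to_rem mms)) big_cons dvdn_mulr.
    by rewrite /rad (perm_big _ (perm_to_rem qN)) big_cons dvdn_mulr.
  rewrite -natr_prod_powR mulrC lerDl; apply: sumr_ge0 => P _.
  by case: ifP => // _; rewrite mulr_ge0 ?powR_ge0 // prodr_ge0 // => m _; rewrite powR_ge0.
rewrite exchange_big /=.
apply: le_trans (_ : \sum_(1 <= P < (Y ^ r).+1) C ^+ r * P%:R `^ (- (1 + delta / 2)) <= _);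
  last first.
  by rewrite -big_distrr /= ler_wpM2l ?exprn_ge0 ?(ltW C0).
rewrite big_nat [leRHS]big_nat; apply: ler_sum => P /andP[P0 _].
rewrite -big_mkcond -big_distrr /= prod_sum_boxes -/(smooth_sum c (primes P) Y).
have P0' : 0 < P%:R :> R by rewrite natr_gt0.
apply: le_trans (_ : w P * (C * P%:R `^ eta) ^+ r <= _).
  rewrite ler_wpM2l ?powR_ge0 // lerXn2r ?nnegrE ?mulr_ge0 ?powR_ge0 ?(ltW C0) ?HC //.
  by apply: sumr_ge0 => m _; rewrite powR_ge0.
rewrite exprMn mulrCA ler_wpM2l ?exprn_ge0 ?(ltW C0) // /w -powR_mulrn ?powR_ge0 //.
rewrite -powRrM -gt0_powRD // ler_powR ?natr_ge1 //.
have : eta * r%:R <= delta / 2.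
  rewrite /eta invfM mulrA -mulrA ler_piMr ?(ltW d20) // ler_pdivrMl ?natr_gt0 // mulr1.
  by rewrite ler_nat.
lra.
Qed.

(* A nonzero [corr k ms 1] forces every prime factor of an entry of [ms] to
   divide another entry too, so the radical P of the product N satisfies
   P | N / m for each entry m, and P ^ 2 | N. *)
Lemma corr_weight_bounded (R : realType) (k r : nat) (sigma eps : R) :
  0 < sigma -> 0 < eps <= sigma / 8 -> sigma + eps <= 1 ->
  exists2 B : R, 0 < B & forall Y : nat,
    \sum_(ms <- boxes r Y) `|corr k ms 1 : R| * (\prod_(m <- ms) m)%N%:R `^ (- (1 - eps))
       * \sum_(m <- ms) m%:R `^ (1 - eps - sigma) <= B.
Proof.
move=> s0 eP s1.
have s160 : 0 < sigma / 16 by rewrite divr_gt0.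
have s20 : 0 < sigma / 2 by rewrite divr_gt0.
have [C C0 HC] := corr_le R k r _ s160.
have [B B0 HB] := sum_radical_bounded R r _ _ s160 s20.
exists (r.+1%:R * C * B); first by rewrite !mulr_gt0 ?natr_gt0.
move=> Y; apply: le_trans (ler_wpM2l _ (HB Y)); last by rewrite mulr_ge0 ?ler0n ?(ltW C0).
rewrite big_distrr /= big_seq [leRHS]big_seq; apply: ler_sum => ms.
rewrite mem_boxes => /andP[/eqP sms ams].
set N := (\prod_(m <- ms) m)%N; set P := (\prod_(p <- primes N) p)%N.
have ms0 : all (leq 1) ms by apply: sub_all ams => m /andP[].
have N0 : (0 < N)%N by rewrite /N big_seq prodn_cond_gt0 // => j /(allP ms0).
have [->|nz] := eqVneq (corr k ms 1 : R) 0.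
  by rewrite normr0 !mul0r !mulr_ge0 ?ler0n ?powR_ge0 ?(ltW C0).
have Hc p : prime p -> count (fun j => p %| j)%N ms != 1%N.
  move=> pp; apply/negP => /eqP H1; move/negP: nz; apply; apply/eqP.
  by apply: (corr_vanish R k p 1 ms pp) => //; rewrite dvdn1 neq_ltn prime_gt1 ?orbT.
have P0 : (0 < P)%N.
  by rewrite /P big_seq prodn_cond_gt0 // => j /(allP (all_prime_primes _)) /prime_gt0.
apply: le_trans (_ : \sum_(m <- ms) C * (N%:R `^ (- (sigma / 16)) * P%:R `^ (- (1 + sigma / 2))) <= _);
  last first.
  rewrite big_const_seq count_predT iter_addr_0 sms -[leLHS]mulr_natl mulrA.
  by rewrite ler_wpM2r ?mulr_ge0 ?powR_ge0 // ler_wpM2r ?(ltW C0) // ler_nat.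
rewrite big_distrr /= big_seq [leRHS]big_seq; apply: ler_sum => m mms.
have m0 : (0 < m)%N := allP ms0 m mms.
have EN : N = (m * \prod_(j <- rem m ms) j)%N.
  by rewrite /N (perm_big _ (perm_to_rem mms)) big_cons.
have n0 : (0 < \prod_(j <- rem m ms) j)%N by move: N0; rewrite EN muln_gt0 => /andP[].
apply: le_trans (_ : C * (m%:R `^ (1 - eps - sigma) * N%:R `^ (- (1 - eps)) * N%:R `^ (sigma / 16)) <= _).
  have := HC ms 1%N sms ms0 isT; rewrite muln1 -/N => H.
  rewrite -mulrA [X in _ * X]mulrC.
  apply: le_trans (ler_wpM2r _ H) _; first by rewrite mulr_ge0 ?powR_ge0.
  by rewrite le_eqVlt; apply/orP; left; apply/eqP; ring.
rewrite ler_wpM2l ?(ltW C0) // EN; apply: radical_weight_le => //.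
- apply: dvdn_leq => //; apply: dvdn_prod_primes; rewrite ?primes_uniq ?all_prime_primes //.
  exact: radical_dvd_rem.
- by rewrite -EN; apply: dvdn_leq => //; exact: radical_sqr_dvd.
Qed.

(** * The residue is x times a polynomial in log x *)

Section ComplexPowerSeries.
Import Normc.
Local Open Scope complex_scope.

(** The norm of [R[i]] takes its values in [R[i]]; this form keeps all estimates in R, and [ccvgP]
    equates it with the filter limit of the definitions. *)
Definition ccvg {R : realType} (u : nat -> R[i]) (l : R[i]) : Prop :=
  forall e : R, 0 < e -> exists N, forall n, (N <= n)%N -> normc (u n - l) < e.

Definition csum {R : realType} (a : nat -> R[i]) (n : nat) : R[i] := \sum_(0 <= j < n) a j.

Lemma complex_normE (R : realType) (z : R[i]) : `|z| = (normc z)%:C.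
Proof. by []. Qed.

Lemma normc_ge0 (R : realType) (z : R[i]) : 0 <= normc z.
Proof. by case: z => a b; exact: sqrtr_ge0. Qed.

Lemma normcB_comm (R : realType) (x y : R[i]) : normc (x - y) = normc (y - x).
Proof. by rewrite -normcN opprB. Qed.

Lemma normc_real (R : realType) (x : R) : normc x%:C = `|x|.
Proof. by rewrite /normc /= expr0n addr0 sqrtr_sqr. Qed.

Lemma normcX (R : realType) (z : R[i]) n : normc (z ^+ n) = normc z ^+ n.
Proof. by elim: n => [|n IH]; rewrite ?expr0 ?normc1 // !exprS normcM IH. Qed.

Lemma normc_sum_le (R : realType) (I : Type) (s : seq I) (P : pred I) (F : I -> R[i]) :
  normc (\sum_(j <- s | P j) F j) <= \sum_(j <- s | P j) normc (F j).
Proof.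
elim/big_rec2: _ => [|j y x _ H]; first by rewrite normc0.
by apply: le_trans (le_normcD _ _) _; rewrite lerD2l.
Qed.

Lemma normc_le_ReIm (R : realType) (z : R[i]) :
  normc z <= `|complex.Re z| + `|complex.Im z|.
Proof.
rewrite {1}(complexE z); apply: le_trans (le_normcD _ _) _.
rewrite normcM !normc_real lerD2l ler_piMl //.
by rewrite /normc /= expr0n add0r expr1n sqrtr1.
Qed.

Lemma ccvgP (R : realType) (u : nat -> R[i]) (l : R[i]) :
  ((u : nat -> R[i]^o) @ \oo --> (l : R[i]^o)) <-> ccvg u l.
Proof.
split=> [/cvgrPdist_lt H e e0|H].
  have e0' : (0 : R[i]) < e%:C by rewrite ltcR.
  have [N _ HN] := H _ e0'; exists N => n Nn; have := HN n Nn.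
  by rewrite complex_normE ltcR normcB_comm.
apply/cvgrPdist_lt => e e0.
have Ee : e = (complex.Re e)%:C.
  by move: e0; rewrite ltcE => /andP[/eqP /= Im0 _]; rewrite [LHS]complexE Im0 mulr0 addr0.
have e0' : 0 < complex.Re e by move: e0; rewrite {1}Ee ltcR.
have [N HN] := H _ e0'; exists N => // n /= Nn.
by rewrite Ee complex_normE ltcR normcB_comm; exact: HN.
Qed.

Lemma ccvgM (R : realType) (u v : nat -> R[i]) (l m : R[i]) :
  ccvg u l -> ccvg v m -> ccvg (fun n => u n * v n) (l * m).
Proof. by move=> /ccvgP ul /ccvgP vm; apply/ccvgP; exact: cvgM ul vm. Qed.

Lemma ccvgB (R : realType) (u v : nat -> R[i]) (l m : R[i]) :
  ccvg u l -> ccvg v m -> ccvg (fun n => u n - v n) (l - m).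
Proof. by move=> /ccvgP ul /ccvgP vm; apply/ccvgP; exact: cvgB ul vm. Qed.

Lemma ccvg_cst (R : realType) (l : R[i]) : ccvg (fun _ => l) l.
Proof. by move=> e e0; exists 0%N => n _; rewrite subrr normc0. Qed.

Lemma ccvg_terms_bounded (R : realType) (a : nat -> R[i]) (l : R[i]) :
  ccvg (csum a) l -> exists2 B : R, 0 < B & forall j, normc (a j) <= B.
Proof.
move=> H; have [N HN] := H 1 ltr01.
exists (2 + \sum_(j < N) normc (a j)).
  by rewrite ltr_pwDl // sumr_ge0 // => j _; exact: normc_ge0.
move=> j; have [Nj|jN] := leqP N j; last first.
  rewrite (bigD1 (Ordinal jN)) //= addrCA lerDl addr_ge0 //.
  by apply: sumr_ge0 => i _; exact: normc_ge0.
have -> : a j = (csum a j.+1 - l) + (l - csum a j).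
  by rewrite addrA subrK /csum big_nat_recr //= addrC addKr.
apply: le_trans (le_normcD _ _) _.
have h1 := HN j.+1 (leqW Nj); have h2 := HN j Nj; rewrite normcB_comm in h2.
have h3 : 0 <= \sum_(j < N) normc (a j) by apply: sumr_ge0 => i _; exact: normc_ge0.
by lra.
Qed.

Lemma sum_triangle (V : nmodType) (n : nat) (F : nat -> nat -> V) :
  \sum_(0 <= m < n) \sum_(0 <= p < m.+1) F p (m - p)%N =
  \sum_(0 <= p < n) \sum_(0 <= q < n - p) F p q.
Proof.
elim: n => [|n IH]; first by rewrite !big_geq.
rewrite big_nat_recr //= IH [RHS]big_nat_recr //= subSnn big_nat1.
rewrite [X in _ + X]big_nat_recr //= subnn addrA; congr (_ + _).
rewrite -big_split /= big_nat [RHS]big_nat; apply: eq_bigr => p /andP[_ pn].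
by rewrite subSn ?(ltnW pn) // big_nat_recr.
Qed.

(* The geometric decay makes the difference between the product of the n-th
   partial sums and the n-th partial sum of the Cauchy product at most
   n ^ 2 K ^ 2 8 ^ - n. *)
Lemma cauchy_product (R : realType) (a b : nat -> R[i]) (K : R) (A B : R[i]) :
  (forall j, normc (a j) <= K * 8 ^- j) -> (forall j, normc (b j) <= K * 8 ^- j) ->
  ccvg (csum a) A -> ccvg (csum b) B ->
  ccvg (csum (fun n => \sum_(0 <= p < n.+1) a p * b (n - p)%N)) (A * B).
Proof.
move=> ha hb cA cB.
have K0 : 0 <= K by have := le_trans (normc_ge0 _ (a 0%N)) (ha 0%N); rewrite expr0 invr1 mulr1.
have hd n : normc (csum a n * csum b n
    - csum (fun n => \sum_(0 <= p < n.+1) a p * b (n - p)%N) n) <= K ^+ 2 * 2 ^- n.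
  rewrite /csum (sum_triangle _ n (fun p q => a p * b q)) big_distrl -sumrB /=.
  apply: le_trans (normc_sum_le _ _ _ _ _) _.
  apply: le_trans (_ : \sum_(0 <= p < n) n%:R * (K ^+ 2 * 8 ^- n) <= _).
    apply: ler_sum_nat => p /andP[_ pn].
    (* Only pairs with p + q >= n survive in the difference, and for them the product of the two
       bounds is at most K ^ 2 8 ^ - n. *)
    rewrite big_distrr /= (big_cat_nat (n := (n - p)%N)) ?leq_subr //= addrC addrK.
    apply: le_trans (normc_sum_le _ _ _ _ _) _.
    apply: le_trans (_ : \sum_(n - p <= q < n) K ^+ 2 * 8 ^- n <= _).
      apply: ler_sum_nat => q /andP[npq qn].
      rewrite normcM; apply: le_trans (ler_pM _ _ (ha p) (hb q)) _; rewrite ?normc_ge0 //.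
      rewrite mulrACA -expr2 ler_wpM2l ?exprn_ge0 // -invfM -exprD.
      rewrite lef_pV2 ?posrE ?exprn_gt0 // ler_weXn2l ?ler1n //.
      by rewrite -leq_subLR.
    rewrite big_const_nat iter_addr_0 subKn ?(ltnW pn) // -[leLHS]mulr_natl.
    by rewrite ler_wpM2r ?mulr_ge0 ?exprn_ge0 ?invr_ge0 // ler_nat ltnW.
  rewrite big_const_nat iter_addr_0 subn0 -[leLHS]mulr_natl mulrA mulrCA.
  rewrite ler_wpM2l ?exprn_ge0 //.
  (* Two of the three factors 2 ^ - n absorb the two factors n, since n <= 2 ^ n. *)
  have -> : (8 : R) = 2 * 2 * 2 by rewrite -!natrM.
  rewrite !exprMn !invfM mulrA ler_piMl ?invr_ge0 ?exprn_ge0 //.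
  rewrite mulrACA -[leRHS](mulr1 1) ler_pM ?mulr_ge0 ?invr_ge0 ?exprn_ge0 //;
    by rewrite ler_pdivrMr ?exprn_gt0 // mul1r -natrX ler_nat ltnW // ltn_expl.
have h0 : ccvg (fun n => csum a n * csum b n
    - csum (fun n => \sum_(0 <= p < n.+1) a p * b (n - p)%N) n) 0.
  move=> e e0.
  have ek : 0 < e / (K ^+ 2 + 1) by rewrite divr_gt0 // ltr_wpDl // exprn_ge0.
  pose N := Num.truncn (e / (K ^+ 2 + 1))^-1.
  exists N.+1 => n Nn; rewrite subr0; apply: le_lt_trans (hd n) _.
  have hn : (e / (K ^+ 2 + 1))^-1 < 2 ^+ n.
    apply: lt_trans (truncnS_gt _) _.
    by rewrite -natrX ltr_nat (leq_ltn_trans Nn) // ltn_expl.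
  have h2 : 2 ^- n < e / (K ^+ 2 + 1).
    by rewrite -[ltRHS]invrK ltf_pV2 ?posrE ?exprn_gt0 ?invr_gt0.
  apply: le_lt_trans (_ : (K ^+ 2 + 1) * 2 ^- n < _).
    by rewrite ler_wpM2r ?invr_ge0 ?exprn_ge0 // lerDl.
  by rewrite -ltr_pdivlMl 1?mulrC // ltr_wpDl // exprn_ge0.
have := ccvgB _ _ _ _ _ (ccvgM _ _ _ _ _ cA cB) h0; rewrite subr0.
move=> H e e0; have [N HN] := H e e0; exists N => n Nn.
by have := HN n Nn; rewrite subKr.
Qed.
End ComplexPowerSeries.

(** * The exponential series of [cpow] *)

Section Residues.
Import Normc.
Local Open Scope complex_scope.

Definition cexp_coeff {R : realType} (z : R[i]) (j : nat) : R[i] := z ^+ j * (j`!%:R^-1)%:C.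

Lemma factr_gt0 (R : realType) (j : nat) : 0 < j`!%:R :> R.
Proof. by rewrite ltr0n fact_gt0. Qed.

(** A single term (8 |z|) ^ j / j! of the exponential series is at most exp(8 |z|). The rate 8 ^ - j
    is the one that [cauchy_product] asks for. *)
Lemma normc_cexp_coeff (R : realType) (z : R[i]) (j : nat) :
  normc (cexp_coeff z j) <= expR (8 * normc z) * 8 ^- j.
Proof.
rewrite /cexp_coeff normcM normcX normc_real ger0_norm ?invr_ge0 ?ler0n //.
rewrite ler_pdivlMr ?exprn_gt0 // mulrAC -exprMn.
case: j => [|j]; first by rewrite expr0 fact0 mul1r invr1 -[leLHS]expR0 ler_expR mulr_ge0 ?normc_ge0.
have h : 0 <= 8 * normc z by rewrite mulr_ge0 ?normc_ge0.
apply: le_trans (expR_ge1Dxn j h); rewrite [_ * 8]mulrC.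
by rewrite lerDr.
Qed.

Lemma ccvg_ReIm (R : realType) (u : nat -> R[i]) (a b : R) :
  (fun n => complex.Re (u n)) @ \oo --> a -> (fun n => complex.Im (u n)) @ \oo --> b ->
  ccvg u (a +i* b).
Proof.
move=> /cvgrPdist_lt ha /cvgrPdist_lt hb e e0.
have e20 : 0 < e / 2 by rewrite divr_gt0.
have [N _ HN] := ha _ e20; have [M _ HM] := hb _ e20.
exists (maxn N M) => n; rewrite geq_max => /andP[Nn Mn].
have h1 := HN n Nn; have h2 := HM n Mn; rewrite /= distrC in h1; rewrite /= distrC in h2.
have := normc_le_ReIm _ (u n - (a +i* b)).
by rewrite !raddfB /= => h; lra.
Qed.

Lemma csum_cexp_real (R : realType) (a : R) : ccvg (csum (cexp_coeff a%:C)) (expR a)%:C.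
Proof.
have E n : csum (cexp_coeff a%:C) n = (series (exp_coeff a) n)%:C.
  rewrite /csum /series /= rmorph_sum; apply: eq_bigr => j _.
  by rewrite /cexp_coeff /exp_coeff /= rmorphM rmorphXn.
apply: ccvg_ReIm.
  under eq_fun do rewrite E /=.
  exact: is_cvg_series_exp_coeff.
by under eq_fun do rewrite E /=; exact: cvg_cst.
Qed.

Lemma expr_i (R : realType) (b : R) (j : nat) :
  ('i * b%:C) ^+ j = ((~~ odd j)%:R * (-1) ^+ j./2 * b ^+ j)
     +i* ((odd j)%:R * (-1) ^+ j.-1./2 * b ^+ j) :> R[i].
Proof.
rewrite exprMn -rmorphXn /=.
have Hi : forall n, 'i ^+ n = ((~~ odd n)%:R * (-1) ^+ n./2) +i* ((odd n)%:R * (-1) ^+ n.-1./2) :> R[i].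
  move=> n; rewrite -{1}(odd_double_half n) exprD -mul2n exprM sqr_i.
  have -> : (-1) ^+ n./2 = ((-1) ^+ n./2)%:C :> R[i] by rewrite rmorphXn rmorphN rmorph1.
  case: (boolP (odd n)) => on.
    have -> : (n.-1)./2 = n./2.
      rewrite -[n in LHS](odd_double_half n) on add1n /= doubleK.
      by rewrite -[n in RHS](odd_double_half n) on /= uphalf_double.
    by rewrite expr1 /=; simpc; rewrite ?(mul1r, mul0r, mulr1, mulr0, addr0, add0r).
  by rewrite expr0 mul1r /=; simpc; rewrite ?(mul1r, mul0r, mulr1, mulr0, addr0, add0r).
by rewrite Hi; simpc.
Qed.

Lemma csum_cexp_imag (R : realType) (b : R) :
  ccvg (csum (cexp_coeff ('i * b%:C))) (cos b +i* sin b).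
Proof.
have E n : csum (cexp_coeff ('i * b%:C)) n = series (cos_coeff b) n +i* series (sin_coeff b) n.
  rewrite /csum /series /=.
  elim: n => [|n IH]; first by rewrite !big_geq.
  rewrite !big_nat_recr //= IH /cexp_coeff expr_i; simpc.
  by rewrite /cos_coeff /sin_coeff /=.
apply: ccvg_ReIm.
  under eq_fun do rewrite E /=.
  by rewrite cos.unlock; exact: is_cvg_series_cos_coeff.
under eq_fun do rewrite E /=.
by rewrite sin.unlock; exact: is_cvg_series_sin_coeff.
Qed.

Lemma cexp_coeffD (R : realType) (x y : R[i]) (n : nat) :
  \sum_(0 <= p < n.+1) cexp_coeff x p * cexp_coeff y (n - p)%N = cexp_coeff (x + y) n.
Proof.
rewrite /cexp_coeff addrC exprDn big_mkord mulr_suml; apply: eq_bigr => p _.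
have pn : (p <= n)%N by rewrite -ltnS ltn_ord.
have this : (n`!%:R^-1)%:C *+ 'C(n, p) = (p`!%:R^-1)%:C * ((n - p)`!%:R^-1)%:C :> R[i].
  rewrite -rmorphMn -rmorphM /=; congr (_%:C).
  rewrite -mulr_natr -(bin_fact pn) !natrM.
  have := factr_gt0 R p; have := factr_gt0 R (n - p); have : 0 < 'C(n, p)%:R :> R by rewrite ltr0n bin_gt0.
  by move=> h1 h2 h3; field; rewrite !gt_eqF.
by rewrite mulrnAl -mulrnAr this mulrACA; congr (_ * _); rewrite mulrC.
Qed.

(** The series at a + i b is the Cauchy product of a real exponential series with the one whose real
    and imaginary parts are the cosine and sine series. *)
Lemma csum_cexp (R : realType) (a b : R) :
  ccvg (csum (cexp_coeff (a +i* b))) ((expR a)%:C * (cos b +i* sin b)).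
Proof.
pose K := expR (8 * normc a%:C) + expR (8 * normc ('i * b%:C)).
have hK z (j : nat) : expR (8 * normc z) <= K -> normc (cexp_coeff z j) <= K * 8 ^- j.
  move=> h; apply: le_trans (normc_cexp_coeff _ _ _) _.
  by rewrite ler_wpM2r ?invr_ge0 ?exprn_ge0.
have := cauchy_product _ _ _ K _ _ (fun j => hK _ j _) (fun j => hK _ j _)
  (csum_cexp_real _ a) (csum_cexp_imag _ b).
rewrite lerDl lerDr !expR_ge0 => /(_ isT isT).
have -> : a +i* b = a%:C + 'i * b%:C by rewrite [LHS]complexE.
move=> H e e0; have [N HN] := H e e0; exists N => n /HN.
rewrite /csum; under eq_bigr do rewrite cexp_coeffD.
by [].
Qed.

Lemma cpowE (R : realType) (x : R) (s : R[i]) : 0 < x ->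
  cpow x s = (expR (complex.Re s * ln x))%:C *
    (cos (complex.Im s * ln x) +i* sin (complex.Im s * ln x)).
Proof. by move=> x0; rewrite /cpow /powR gt_eqF. Qed.

Lemma cpow_series (R : realType) (x : R) (s : R[i]) : 0 < x ->
  ccvg (csum (cexp_coeff (s * (ln x)%:C))) (cpow x s).
Proof.
move=> x0; rewrite cpowE //; case: s => a b /=.
have -> : (a +i* b) * (ln x)%:C = (a * ln x) +i* (b * ln x) by simpc.
exact: csum_cexp.
Qed.

Lemma cexpD (R : realType) (a b a' b' : R) :
  (expR (a + a'))%:C * (cos (b + b') +i* sin (b + b')) =
  (expR a)%:C * (cos b +i* sin b) * ((expR a')%:C * (cos b' +i* sin b')) :> R[i].
Proof.
rewrite expRD cosD sinD rmorphM /= mulrACA; congr (_ * _).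
by simpc; congr (_ +i* _); ring.
Qed.

Lemma cpowM (R : realType) (x y : R) (s : R[i]) : 0 < x -> 0 < y ->
  cpow (x * y) s = cpow x s * cpow y s.
Proof.
by move=> x0 y0; rewrite !cpowE ?mulr_gt0 // lnM ?posrE // !mulrDr cexpD.
Qed.

Lemma cpow1D (R : realType) (x : R) (w : R[i]) : 0 < x ->
  cpow x (1 + w) = x%:C * cpow x w.
Proof.
move=> x0; rewrite !cpowE //; case: w => a b /=.
rewrite !mulrDl cexpD mul1r lnK ?posrE // mul0r cos0 sin0; congr (_ * _).
by simpc.
Qed.
End Residues.

(** * Laurent coefficients and the shape of the residue *)

Section MainTerm.
Import Normc.
Local Open Scope complex_scope.

Lemma power_series_bound (R : realType) (d : nat -> R[i]) (rho : R) (l : R[i]) : 0 <= rho ->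
  ccvg (csum (fun j => d j * rho%:C ^+ j)) l ->
  exists2 B : R, 0 < B & forall j, normc (d j) * rho ^+ j <= B.
Proof.
move=> r0 /ccvg_terms_bounded [B B0 HB]; exists B => // j.
by have := HB j; rewrite normcM normcX normc_real ger0_norm.
Qed.

Lemma geometric_tail_le (R : realFieldType) (x : R) (n N : nat) : 0 <= x -> x <= 2^-1 ->
  \sum_(n <= j < N) x ^+ j <= 2 * x ^+ n.
Proof.
move=> x0 x2; have [Nn|nN] := leqP N n.
  by rewrite big_geq // mulr_ge0 ?exprn_ge0.
apply: le_trans (_ : 2 * x ^+ n - 2 * x ^+ N <= _); last first.
  by rewrite gerBl mulr_ge0 ?exprn_ge0.
rewrite -(subnKC (ltnW nN)); elim: (N - n)%N => [|k IH].
  by rewrite addn0 big_geq // subrr.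
rewrite addnS big_nat_recr ?leq_addr //=.
apply: le_trans (lerD IH (lexx _)) _.
have h : 0 <= x ^+ (n + k) by rewrite exprn_ge0.
rewrite [x ^+ (n + k).+1]exprS.
have : x * x ^+ (n + k) <= 2^-1 * x ^+ (n + k) by rewrite ler_wpM2r.
lra.
Qed.

(** Induction on the index: once the earlier coefficients vanish, the term d_n t ^ n is balanced by
    the tail, which is at most 2 B (t / rho) ^ (n + 1); letting t be small forces d_n = 0. *)
Lemma power_series_zero (R : realType) (d : nat -> R[i]) (delta : R) : 0 < delta ->
  (forall w : R[i], 0 < normc w < delta -> ccvg (csum (fun j => d j * w ^+ j)) 0) ->
  forall j, d j = 0.
Proof.
move=> d0 H; pose rho := delta / 2.
have r0 : 0 < rho by rewrite divr_gt0.
have rd : rho < delta by rewrite /rho; lra.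
have nrho : 0 < normc rho%:C < delta by rewrite normc_real gtr0_norm // r0.
have [B B0 HB] := power_series_bound _ _ _ _ (ltW r0) (H _ nrho).
elim/ltn_ind => n IH.
have key t : 0 < t <= rho / 2 -> normc (d n) * t ^+ n <= 2 * B * (t / rho) ^+ n.+1.
  move=> /andP[t0 tr].
  have nt : 0 < normc t%:C < delta by rewrite normc_real gtr0_norm // t0 /=; lra.
  rewrite leNgt; apply/negP => lt0.
  have gap : 0 < normc (d n) * t ^+ n - 2 * B * (t / rho) ^+ n.+1 by rewrite subr_gt0.
  have [N HN] := H _ nt _ gap.
  pose M := maxn N n.+1.
  have := HN M (leq_maxl _ _); rewrite subr0 /csum.
  have nM : (n.+1 <= M)%N by rewrite leq_maxr.
  rewrite (big_cat_nat (n := n)) ?(ltnW nM) //= big_nat_cond big1 ?add0r; last first.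
    by move=> j /andP[/andP[_ jn] _]; rewrite IH // mul0r.
  rewrite big_ltn //; apply/negP; rewrite -leNgt.
  set T := \sum_(_ <= _ < _) _.
  have hT : normc T <= 2 * B * (t / rho) ^+ n.+1.
    apply: le_trans (normc_sum_le _ _ _ _ _) _.
    apply: le_trans (_ : \sum_(n.+1 <= j < M) B * (t / rho) ^+ j <= _).
      apply: ler_sum_nat => j _; rewrite normcM normcX normc_real gtr0_norm //.
      rewrite expr_div_n mulrA mulrAC ler_wpM2r ?exprn_ge0 ?(ltW t0) //.
      by rewrite ler_pdivlMr ?exprn_gt0.
    rewrite -big_distrr /= [2 * B]mulrC -mulrA ler_wpM2l ?(ltW B0) //.
    apply: geometric_tail_le; first by rewrite divr_ge0 ?(ltW t0) ?(ltW r0).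
    by rewrite ler_pdivrMr // mulrC.
  have := le_normcD (d n * t%:C ^+ n + T) (- T); rewrite addrK normcN.
  rewrite normcM normcX normc_real gtr0_norm // => h.
  lra.
apply: eq0_normc; apply/eqP; rewrite eq_le normc_ge0 andbT leNgt; apply/negP => dn0.
have rn : 0 < rho ^+ n.+1 by rewrite exprn_gt0.
(* For this t the quantity 2 B t / rho ^ (n + 1) is at most half of [normc (d n)], against [key]. *)
pose t := Num.min (rho / 2) (normc (d n) * rho ^+ n.+1 / (4 * B)).
have t0 : 0 < t by rewrite lt_min !divr_gt0 ?mulr_gt0.
have tr : t <= rho / 2 by rewrite ge_min lexx.
have tB : t <= normc (d n) * rho ^+ n.+1 / (4 * B) by rewrite ge_min lexx orbT.
have := key t; rewrite t0 tr => /(_ isT).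
have -> : 2 * B * (t / rho) ^+ n.+1 = 2 * B * t / rho ^+ n.+1 * t ^+ n.
  by rewrite expr_div_n [t ^+ n.+1]exprS; ring.
rewrite ler_pM2r ?exprn_gt0 // ler_pdivlMr // => h.
move: tB; rewrite ler_pdivlMr ?mulr_gt0 // => tB.
have : 0 < normc (d n) * rho ^+ n.+1 by rewrite mulr_gt0.
lra.
Qed.

(** The expansion data of [is_residue], with a real radius and the displacement w in place of s -
    a. *)
Definition laurent {R : realType} (f : R[i] -> R[i]) (a : R[i]) (m : nat)
    (c : nat -> R[i]) (delta : R) : Prop :=
  0 < delta /\ forall w : R[i], 0 < normc w < delta ->
    ccvg (csum (fun j => c j * w ^+ j)) (w ^+ m.+1 * f (a + w)).

Lemma is_residueP (R : realType) (f : R[i] -> R[i]) (a rho : R[i]) :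
  is_residue f a rho <-> exists m c delta, laurent f a m c delta /\ c m = rho.
Proof.
split=> [[m [c [delta [d0 H cm]]]]|[m [c [delta [[d0 H] cm]]]]].
  have Ed : delta = (complex.Re delta)%:C.
    by move: d0; rewrite ltcE => /andP[/eqP /= Im0 _]; rewrite [LHS]complexE Im0 mulr0 addr0.
  exists m, c, (complex.Re delta); split=> //; split.
    by rewrite -ltcR -Ed.
  move=> w /andP[w0 wd].
  have := H (a + w); rewrite addrC addKr complex_normE Ed !ltcR w0 wd.
  by move=> /(_ isT) /ccvgP.
exists m, c, delta%:C; split=> //; first by rewrite ltcR.
move=> s; rewrite complex_normE !ltcR => h; apply/ccvgP.
by have := H _ h; rewrite addrCA subrr addr0.
Qed.

Lemma ccvg_shift (R : realType) (u : nat -> R[i]) (l : R[i]) (k : nat) :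
  ccvg (fun n => u (n + k)%N) l -> ccvg u l.
Proof.
move=> H e e0; have [N HN] := H e e0; exists (N + k)%N => n Nn.
have kn : (k <= n)%N by apply: leq_trans Nn; rewrite leq_addl.
by rewrite -(subnK kn); apply: HN; rewrite -(leq_add2r k) subnK.
Qed.

(** A pole order may be overstated by k at the price of k leading zero coefficients. Expansions of
    different orders become comparable in this way, which gives uniqueness of the residue. *)
Lemma laurent_shift (R : realType) (f : R[i] -> R[i]) (a : R[i]) m c delta (k : nat) :
  laurent f a m c delta ->
  laurent f a (m + k) (fun j => if (j < k)%N then 0 else c (j - k)%N) delta.
Proof.
move=> [d0 H]; split=> // w wd; apply: (@ccvg_shift _ _ _ k).
have := ccvgM _ _ _ _ _ (ccvg_cst _ (w ^+ k)) (H w wd).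
rewrite mulrA -exprD addnS addnC => h e e0; have [N HN] := h e e0; exists N => n Nn.
have E : csum (fun j => (if (j < k)%N then 0 else c (j - k)%N) * w ^+ j) (n + k)
    = w ^+ k * csum (fun j => c j * w ^+ j) n.
  rewrite /csum [LHS](big_cat_nat (n := k)) ?leq_addl //= [X in X + _]big_nat_cond.
  rewrite [X in X + _]big1 ?add0r; last first.
    by move=> j /andP[/andP[_ jk] _]; rewrite jk mul0r.
  rewrite -[X in index_iota X]add0n big_addn addnK big_distrr /=.
  by apply: eq_bigr => j _; rewrite ltnNge leq_addl /= addnK exprD; ring.
by rewrite E; exact: HN.
Qed.

Lemma laurent_unique (R : realType) (f : R[i] -> R[i]) (a : R[i]) m c c' delta delta' :
  laurent f a m c delta -> laurent f a m c' delta' -> forall j, c j = c' j.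
Proof.
move=> [d0 H] [d0' H'] j; apply/eqP; rewrite -subr_eq0; apply/eqP.
apply: (@power_series_zero _ (fun j => c j - c' j) (Num.min delta delta')).
  by rewrite lt_min d0.
move=> w /andP[w0]; rewrite lt_min => /andP[w1 w2].
have h := H w; have h' := H' w; rewrite w0 w1 in h; rewrite w0 w2 in h'.
have := ccvgB _ _ _ _ _ (h isT) (h' isT); rewrite subrr => h2 e e0.
have [N HN] := h2 e e0; exists N => n /HN; rewrite /csum -sumrB.
by under eq_bigr do rewrite -mulrBl.
Qed.

Lemma is_residue_unique (R : realType) (f : R[i] -> R[i]) (a rho rho' : R[i]) :
  is_residue f a rho -> is_residue f a rho' -> rho = rho'.
Proof.
move=> /is_residueP[m [c [delta [H <-]]]] /is_residueP[m' [c' [delta' [H' <-]]]].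
have h := laurent_shift _ _ _ _ _ _ m' H; have h' := laurent_shift _ _ _ _ _ _ m H'.
rewrite addnC in h'; have := laurent_unique _ _ _ _ _ _ _ _ h h' (m + m')%N.
rewrite ifN -?leqNgt ?leq_addl // ifN -?leqNgt ?leq_addr // addnK addKn.
exact.
Qed.

(** Since y ^ (1 + w) = y exp(w log y), the new coefficients come from a Cauchy product. The radius
    shrinks to delta / 16 because the coefficients are controlled at rho = delta / 2, and |w| <= rho
    / 8 then yields the decay 8 ^ - j. *)
Lemma laurent_cpow (R : realType) (f : R[i] -> R[i]) m c delta (y : R) : 0 < y ->
  laurent f 1 m c delta ->
  laurent (fun s => f s * cpow y s) 1 m
    (fun n => \sum_(0 <= p < n.+1) c p * (y * ln y ^+ (n - p) / (n - p)`!%:R)%:C)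
    (delta / 16).
Proof.
move=> y0 [d0 H]; split=> [|w /andP[w0 wd]]; first by rewrite divr_gt0.
pose rho := delta / 2; have r0 : 0 < rho by rewrite divr_gt0.
have nrho : 0 < normc rho%:C < delta.
  by rewrite normc_real gtr0_norm // r0 /rho; lra.
have [B B0 HB] := power_series_bound _ _ _ _ (ltW r0) (H _ nrho).
have wr : normc w <= rho / 8 by rewrite /rho; lra.
have wdelta : 0 < normc w < delta by rewrite w0 /=; lra.
pose E := y * expR (8 * normc (w * (ln y)%:C)).
have E0 : 0 < E by rewrite mulr_gt0 ?expR_gt0.
have ha j : normc (c j * w ^+ j) <= (B + E) * 8 ^- j.
  rewrite normcM normcX; apply: le_trans (_ : B * 8 ^- j <= _); last first.
    by rewrite ler_wpM2r ?invr_ge0 ?exprn_ge0 // lerDl ltW.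
  apply: le_trans (_ : normc (c j) * (rho / 8) ^+ j <= _).
    by rewrite ler_wpM2l ?normc_ge0 // lerXn2r // nnegrE ?normc_ge0 // divr_ge0 // ltW.
  by rewrite expr_div_n mulrA ler_wpM2r ?invr_ge0 ?exprn_ge0.
have hb j : normc (y%:C * cexp_coeff (w * (ln y)%:C) j) <= (B + E) * 8 ^- j.
  rewrite normcM normc_real gtr0_norm //; apply: le_trans (_ : E * 8 ^- j <= _); last first.
    by rewrite ler_wpM2r ?invr_ge0 ?exprn_ge0 // lerDr ltW.
  by rewrite /E -mulrA ler_wpM2l ?(ltW y0) // normc_cexp_coeff.
have cb : ccvg (csum (fun j => y%:C * cexp_coeff (w * (ln y)%:C) j)) (cpow y (1 + w)).
  rewrite cpow1D //.
  have := ccvgM _ _ _ _ _ (ccvg_cst _ y%:C) (cpow_series _ _ w y0).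
  move=> h e e0; have [N HN] := h e e0; exists N => n /HN.
  by rewrite /csum big_distrr.
have := cauchy_product _ _ _ _ _ _ ha hb (H w wdelta) cb.
rewrite -mulrA => h e e0; have [N HN] := h e e0; exists N => n /HN.
rewrite /csum; congr (normc (_ - _) < _); apply: eq_bigr => j _.
rewrite mulr_suml big_nat [RHS]big_nat; apply: eq_bigr => p /andP[_ pj].
have Ew : w ^+ j = w ^+ p * w ^+ (j - p) by rewrite -exprD subnKC.
by rewrite /cexp_coeff exprMn !rmorphM rmorphXn /= Ew; ring.
Qed.

Lemma Re_mul_real (R : realType) (z : R[i]) (r : R) :
  complex.Re (z * r%:C) = complex.Re z * r.
Proof. by case: z => a b; simpc. Qed.

(** A residue at a single x0 suffices: x ^ s = x0 ^ s (x / x0) ^ s, and [laurent_cpow] makes the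
    residue at x equal to x / x0 times a polynomial in log(x / x0). If there is no residue for any
    x, the default value 0 of [residue] gives the zero polynomial. *)
Lemma mainTerm_poly (R : realType) (k : nat) :
  exists Q : {poly R}, forall x : R, 0 < x -> mainTerm k x = x * Q.[ln x].
Proof.
pose f (x : R) s := zeta s ^+ k * cpow x s / s.
have [[x0 [x00 [rho Hrho]]]|none] := pselect (exists x0 : R, 0 < x0 /\ exists rho, is_residue (f x0) 1 rho);
  last first.
  exists 0 => x x0; rewrite horner0 mulr0 /mainTerm /residue xgetPN // => rho Hrho.
  by apply: none; exists x; split=> //; exists rho.
have [m [c [delta [H _]]]] := (is_residueP _ _ _ _).1 Hrho.
exists (x0^-1 *: \sum_(0 <= p < m.+1)
  (complex.Re (c p) / (m - p)`!%:R) *: ('X - (ln x0)%:P) ^+ (m - p)).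
move=> x xp; have y0 : 0 < x / x0 by rewrite divr_gt0.
have := laurent_cpow _ _ _ _ _ _ y0 H.
have -> : (fun s => f x0 s * cpow (x / x0) s) = f x.
  apply/funext => s; rewrite /f.
  have -> : cpow x s = cpow x0 s * cpow (x / x0) s.
    by rewrite -cpowM // mulrCA divff ?gt_eqF // mulr1.
  by ring.
set c' := fun n => _; set delta' := _ / _ => H'.
have Hres : is_residue (f x) 1 (c' m) by apply/is_residueP; exists m, c', delta'.
have -> : mainTerm k x = complex.Re (c' m).
  rewrite /mainTerm /residue; case: xgetP => [rho' _ H1|/(_ (c' m))//].
  by rewrite (is_residue_unique _ _ _ _ _ H1 Hres).
rewrite /c' raddf_sum hornerZ horner_sum mulrA big_distrr /=; apply: eq_bigr => p _.
rewrite Re_mul_real hornerZ horner_exp !hornerE ln_div ?posrE // /=; ring.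
Qed.
End MainTerm.

(** * Elementary bounds for the error term *)

Definition poly_norm {R : numDomainType} (P : {poly R}) : R := \sum_(j < size P) `|P`_j|.

Lemma poly_norm_ge0 (R : numDomainType) (P : {poly R}) : 0 <= poly_norm P.
Proof. exact: sumr_ge0. Qed.

Lemma horner_le_norm (R : numFieldType) (P : {poly R}) (t w : R) (n : nat) :
  (size P <= n)%N -> `|t| <= w -> `|P.[t]| <= poly_norm P * (1 + w) ^+ n.
Proof.
move=> Pn tw; rewrite horner_coef (le_trans (ler_norm_sum _ _ _)) // /poly_norm mulr_suml.
have w0 : 0 <= w := le_trans (normr_ge0 _) tw.
apply: ler_sum => j _; rewrite normrM normrX ler_wpM2l //.
apply: le_trans (_ : (1 + w) ^+ j <= _).
  by rewrite lerXn2r ?nnegrE ?addr_ge0 // (le_trans tw) // lerDr.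
by rewrite ler_weXn2l ?lerDl // (leq_trans _ Pn) // ltnW.
Qed.

Lemma exprB_le (R : numFieldType) (u v w : R) (n : nat) : `|u| <= w -> `|v| <= w ->
  `|u ^+ n - v ^+ n| <= n%:R * (1 + w) ^+ n * `|u - v|.
Proof.
move=> uw vw; have w0 : 0 <= w := le_trans (normr_ge0 _) uw.
elim: n => [|n IH]; first by rewrite !expr0 subrr normr0 mul0r mul0r.
have -> : u ^+ n.+1 - v ^+ n.+1 = u * (u ^+ n - v ^+ n) + v ^+ n * (u - v).
  by rewrite !exprS; ring.
have h1w : 0 <= (1 + w) ^+ n by rewrite exprn_ge0 ?addr_ge0.
apply: le_trans (ler_normD _ _) _; rewrite !normrM.
apply: le_trans (_ : w * (n%:R * (1 + w) ^+ n * `|u - v|) + (1 + w) ^+ n * `|u - v| <= _).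
  rewrite lerD ?ler_pM // normrX lerXn2r ?nnegrE ?addr_ge0 //.
  by rewrite (le_trans vw) // lerDr.
have -> : n.+1%:R * (1 + w) ^+ n.+1 * `|u - v| =
  w * (n%:R * (1 + w) ^+ n * `|u - v|) + (1 + w) ^+ n * `|u - v|
  + (n%:R + w) * (1 + w) ^+ n * `|u - v| by rewrite exprS -natr1; ring.
by rewrite lerDl !mulr_ge0 ?addr_ge0.
Qed.

Lemma hornerB_le (R : numFieldType) (P : {poly R}) (u v w : R) : `|u| <= w -> `|v| <= w ->
  `|P.[u] - P.[v]| <= poly_norm P * (size P)%:R * (1 + w) ^+ size P * `|u - v|.
Proof.
move=> uw vw; have w0 : 0 <= w := le_trans (normr_ge0 _) uw.
rewrite !horner_coef -sumrB (le_trans (ler_norm_sum _ _ _)) // /poly_norm !mulr_suml.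
apply: ler_sum => j _; rewrite -mulrBr normrM -!mulrA ler_wpM2l //.
apply: le_trans (exprB_le _ _ _ _ _ uw vw) _; rewrite mulrA ler_wpM2r //.
rewrite ler_pM ?exprn_ge0 ?addr_ge0 // ?ler_nat ?(ltnW (ltn_ord j)) //.
by rewrite ler_weXn2l ?lerDl // ltnW.
Qed.

Lemma log_power_le (R : realType) (p : nat) (eps : R) : 0 < eps ->
  exists2 C : R, 0 < C & forall t : R, 0 <= t -> (1 + t) ^+ p <= C * expR (eps * t).
Proof.
move=> e0; pose d := eps / p.+1%:R.
have d0 : 0 < d by rewrite divr_gt0 ?ltr0n.
exists ((1 + d^-1) ^+ p); first by rewrite exprn_gt0 // addr_gt0 ?invr_gt0.
move=> t t0.
have h : 1 + t <= (1 + d^-1) * expR (d * t).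
  apply: le_trans (_ : (1 + d^-1) * (1 + d * t) <= _); last first.
    by rewrite ler_wpM2l ?expR_ge1Dx // addr_ge0 // invr_ge0 ltW.
  have -> : (1 + d^-1) * (1 + d * t) = 1 + t + d * t + d^-1.
    by field; rewrite gt_eqF.
  have h1 : 0 <= d * t by rewrite mulr_ge0 ?(ltW d0).
  have h2 : 0 <= d^-1 by rewrite invr_ge0 ltW.
  lra.
apply: le_trans (_ : ((1 + d^-1) * expR (d * t)) ^+ p <= _).
  by rewrite lerXn2r // nnegrE ?(le_trans _ h) ?addr_ge0.
rewrite exprMn ler_wpM2l ?exprn_ge0 ?addr_ge0 ?invr_ge0 ?(ltW d0) //.
rewrite -expRM_natl ler_expR mulrA ler_wpM2r //.
rewrite /d mulrCA ler_piMr ?(ltW e0) // ler_pdivrMr ?ltr0n // mul1r.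
by rewrite ler_nat.
Qed.

Lemma log_power_powR_le (R : realType) (p : nat) (eps : R) : 0 < eps ->
  exists2 C : R, 0 < C & forall x : R, 1 <= x -> (1 + ln x) ^+ p <= C * x `^ eps.
Proof.
move=> e0; have [C C0 HC] := log_power_le R p eps e0; exists C => // x x1.
by rewrite powR_expR ?HC ?ln_ge0 // (lt_le_trans ltr01).
Qed.

(** The term with exponent - eps covers 0 < y < 1, which must be allowed because the arguments x / m
    can be arbitrarily small. *)
Lemma poly_log_le (R : realType) (P : {poly R}) (eps : R) : 0 < eps ->
  exists2 C : R, 0 < C & forall y : R, 0 < y -> `|P.[ln y]| <= C * (y `^ eps + y `^ (- eps)).
Proof.
move=> e0; have [C C0 HC] := log_power_le R (size P) eps e0.
have P0 := poly_norm_ge0 _ P.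
exists ((poly_norm P + 1) * C); first by rewrite mulr_gt0 // ltr_wpDl.
move=> y y0; rewrite !powR_expR //.
apply: le_trans (horner_le_norm _ _ _ `|ln y| _ (leqnn _) (lexx _)) _.
rewrite -mulrA ler_pM ?exprn_ge0 ?addr_ge0 // ?lerDl //.
apply: le_trans (HC _ (normr_ge0 _)) _; rewrite ler_wpM2l ?(ltW C0) //.
case: (lerP 0 (ln y)) => h; first by rewrite ger0_norm // lerDl expR_ge0.
by rewrite ltr0_norm // mulrN -mulNr lerDr expR_ge0.
Qed.

Lemma ln_ratio_ge (R : realType) (n : nat) : n.+2%:R^-1 <= ln n.+2%:R - ln n.+1%:R :> R.
Proof.
have h1 : 0 < n.+1%:R :> R by rewrite ltr0n.
have h2 : 0 < n.+2%:R :> R by rewrite ltr0n.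
rewrite -ln_div ?posrE // -[n.+2%:R / _]invrK lnV ?posrE ?invr_gt0 ?divr_gt0 // lerNr.
have -> : (n.+2%:R / n.+1%:R)^-1 = 1 + - n.+2%:R^-1 :> R.
  rewrite invf_div; have -> : n.+1%:R = n.+2%:R - 1 :> R by rewrite -[n.+2%:R]natr1 addrK.
  by rewrite mulrBl divff ?gt_eqF // mul1r.
by apply: le_ln1Dx; rewrite ltrN2 invf_lt1 // ltr1n.
Qed.

Lemma harmonic_le_ln (R : realType) (N : nat) :
  \sum_(1 <= d < N.+2) d%:R^-1 <= 1 + ln N.+1%:R :> R.
Proof.
elim: N => [|N IH]; first by rewrite big_nat1 invr1 ln1 addr0.
rewrite big_nat_recr //=; apply: le_trans (lerD IH (ln_ratio_ge R N)) _.
by rewrite -addrA lerD2l addrCA subrr addr0.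
Qed.

Lemma truncn_div (R : realType) (x : R) (m : nat) : 0 <= x -> (0 < m)%N ->
  Num.truncn (x / m%:R) = (Num.truncn x %/ m)%N.
Proof.
move=> x0 m0; have mR : 0 < m%:R :> R by rewrite ltr0n.
apply/eqP; rewrite truncn_eq ?divr_ge0 // ler_pdivlMr // ltr_pdivrMr //.
have /andP[h1 h2] := truncn_itv x0; apply/andP; split.
  by apply: le_trans h1; rewrite -natrM ler_nat leq_divM.
apply: lt_le_trans h2 _; rewrite -natrM ler_nat.
by rewrite ltn_ceil.
Qed.

(** * The summatory function of tau_k and its error term *)

Lemma tau_sumS (k N : nat) :
  tau_sum k.+1 N = (\sum_(1 <= d < N.+1) tau_sum k (N %/ d))%N.
Proof.
rewrite /tau_sum.
transitivity (\sum_(1 <= m < N.+1) \sum_(d <- divisors m) tau k (m %/ d))%N.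
  rewrite big_nat [RHS]big_nat; apply: eq_bigr => m /andP[m0 _].
  by rewrite tauS // (sum_divisors_inv _ m (tau k)).
rewrite (sum_nat_divisors _ _ (fun d m => tau k (m %/ d))).
apply: eq_big_nat => d /andP[d0 _]; apply: eq_bigr => c _; by rewrite mulKn.
Qed.

Definition tau_sumR {R : realType} (k : nat) (y : R) : R := (tau_sum k (Num.truncn y))%:R.

Lemma tau_sumR_lt1 (R : realType) (k : nat) (y : R) : y < 1 -> tau_sumR k y = 0.
Proof.
move=> y1; rewrite /tau_sumR /tau_sum big_geq // ltnS leqn0; apply/eqP.
by apply/truncn0Pn; rewrite -ltNge.
Qed.

(** Each convolution with 1 costs one harmonic sum. The exact power of the logarithm matters: it
    bounds the degree of Q in [size_main_poly]. *)
Lemma tau_sumR_le (R : realType) (k : nat) (x : R) : 1 <= x ->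
  tau_sumR k.+1 x <= x * (1 + ln x) ^+ k.
Proof.
elim: k x => [|k IH] x x1; have x0 : 0 <= x := le_trans ler01 x1.
  rewrite expr0 mulr1; apply: le_trans (_ : (Num.truncn x)%:R <= x); last by rewrite truncn_le.
  rewrite /tau_sumR ler_nat /tau_sum.
  rewrite (eq_big_nat _ _ (F2 := fun _ => 1%N)); first by rewrite sum_nat_const_nat muln1 subn1.
  by move=> n /andP[n0 _]; rewrite tau1.
have xp : 0 < x := lt_le_trans ltr01 x1.
rewrite /tau_sumR tau_sumS natr_sum.
apply: le_trans (_ : \sum_(1 <= d < (Num.truncn x).+1) x * (1 + ln x) ^+ k * d%:R^-1 <= _).
  apply: ler_sum_nat => d /andP[d0 dx].
  have dR : 0 < d%:R :> R by rewrite ltr0n.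
  have dlex : d%:R <= x by rewrite -truncn_ge_nat.
  rewrite -truncn_div //; apply: le_trans (IH (x / d%:R) _) _.
    by rewrite ler_pdivlMr // mul1r.
  rewrite [leRHS]mulrAC ler_wpM2l ?divr_ge0 //.
  have h1 : 1 <= x / d%:R by rewrite ler_pdivlMr // mul1r.
  rewrite lerXn2r ?nnegrE ?addr_ge0 ?ln_ge0 // lerD2l ler_ln ?posrE ?divr_gt0 //.
  by rewrite ler_pdivrMr // ler_peMr // ler1n.
rewrite -mulr_sumr exprSr mulrA ler_wpM2l ?mulr_ge0 ?exprn_ge0 ?addr_ge0 ?ln_ge0 //.
have t0 : (0 < Num.truncn x)%N by rewrite truncn_gt0.
rewrite -(prednK t0); apply: le_trans (harmonic_le_ln _ _) _.
by rewrite lerD2l prednK // ler_ln ?posrE ?ltr0n // truncn_le.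
Qed.

(** Delta_k with the residue replaced by its polynomial form, measurable on the whole line; the two
    agree for y > 0 by [DeltaE]. *)
Definition piltz_error {R : realType} (k : nat) (Q : {poly R}) (y : R) : R :=
  tau_sumR k y - y * Q.[ln y].

Lemma DeltaE (R : realType) (k : nat) (Q : {poly R}) (y : R) :
  (forall x : R, 0 < x -> mainTerm k x = x * Q.[ln x]) -> 0 < y ->
  Delta k y = piltz_error k Q y.
Proof. by move=> hQ y0; rewrite /Delta hQ. Qed.

Lemma gt0_powR1D {R : realType} (y s : R) : 0 < y -> y `^ (1 + s) = y * y `^ s.
Proof. by move=> y0; rewrite gt0_powRD // powRr1 // ltW. Qed.

Lemma main_le (R : realType) (Q : {poly R}) (eps : R) : 0 < eps ->
  exists2 C : R, 0 < C & forall y : R, 0 < y ->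
    `|y * Q.[ln y]| <= C * (y `^ (1 + eps) + y `^ (1 - eps)).
Proof.
move=> e0; have [C C0 HC] := poly_log_le R Q eps e0; exists C => // y y0.
rewrite normrM gtr0_norm // !gt0_powR1D // -mulrDr mulrCA ler_wpM2l ?(ltW y0) //.
exact: HC.
Qed.

Lemma tau_sumR_ge0 (R : realType) (k : nat) (y : R) : 0 <= tau_sumR k y.
Proof. exact: ler0n. Qed.

Lemma tau_sumR_powR_le (R : realType) (k : nat) (eps : R) : (0 < k)%N -> 0 < eps ->
  exists2 C : R, 0 < C & forall y : R, 0 < y -> tau_sumR k y <= C * y `^ (1 + eps).
Proof.
case: k => // k _ e0; have [C C0 HC] := log_power_powR_le R k eps e0.
exists C => // y y0; have [y1|y1] := leP 1 y; last first.
  by rewrite tau_sumR_lt1 // mulr_ge0 ?powR_ge0 // ltW.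
apply: le_trans (tau_sumR_le _ _ _ y1) _.
by rewrite gt0_powR1D // mulrCA ler_wpM2l ?(ltW y0) // HC.
Qed.

(** The increment is (y - x) Q(log y) + x (Q(log y) - Q(log x)), and x (log y - log x) <= y - x. As
    the summatory function is monotone, the error can thus fall at most at rate C z ^ eta as its
    argument grows. *)
Lemma main_lipschitz (R : realType) (Q : {poly R}) (eta : R) : 0 < eta ->
  exists2 C : R, 0 < C & forall x y z : R, 1 <= x -> x <= y -> y <= z ->
    `|y * Q.[ln y] - x * Q.[ln x]| <= C * z `^ eta * (y - x).
Proof.
move=> e0; have [C C0 HC] := log_power_powR_le R (size Q) eta e0.
have N0 := poly_norm_ge0 _ Q.
exists ((poly_norm Q + 1) * (1 + (size Q)%:R) * C).
  by rewrite !mulr_gt0 // ltr_wpDl.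
move=> x y z x1 xy yz.
have y1 := le_trans x1 xy; have z1 := le_trans y1 yz.
have x0 : 0 < x := lt_le_trans ltr01 x1.
have y0 : 0 < y := lt_le_trans ltr01 y1.
have z0 : 0 < z := lt_le_trans ltr01 z1.
have lyz : `|ln y| <= ln z by rewrite ger0_norm ?ln_ge0 // ler_ln.
have lxz : `|ln x| <= ln z by rewrite ger0_norm ?ln_ge0 // ler_ln // (le_trans xy).
have -> : y * Q.[ln y] - x * Q.[ln x] = (y - x) * Q.[ln y] + x * (Q.[ln y] - Q.[ln x]).
  by ring.
have yx : 0 <= y - x by rewrite subr_ge0.
have hl : x * (ln y - ln x) <= y - x.
  rewrite -ln_div ?posrE // -ler_pdivlMl //.
  have -> : x^-1 * (y - x) = y / x - 1 by field; rewrite gt_eqF.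
  have := le_ln1Dx (_ : -1 < y / x - 1); rewrite addrCA subrr addr0; apply.
  by rewrite ltrBDr addNr divr_gt0.
have lxy : 0 <= ln y - ln x by rewrite subr_ge0 ler_ln.
set L := (1 + ln z) ^+ size Q.
have L0 : 0 <= L by rewrite exprn_ge0 // addr_ge0 ?ln_ge0.
apply: le_trans (ler_normD _ _) _; rewrite !normrM (ger0_norm yx) (gtr0_norm x0).
apply: le_trans (_ : (y - x) * (poly_norm Q * L) + poly_norm Q * (size Q)%:R * L * (y - x) <= _).
  apply: lerD; first by rewrite ler_wpM2l // horner_le_norm.
  apply: le_trans (_ : poly_norm Q * (size Q)%:R * L * (x * (ln y - ln x)) <= _).
    rewrite mulrCA ler_wpM2l ?(ltW x0) //.
    by apply: le_trans (hornerB_le _ _ _ _ _ lyz lxz) _; rewrite (ger0_norm lxy).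
  by rewrite ler_wpM2l // !mulr_ge0.
have -> : (y - x) * (poly_norm Q * L) + poly_norm Q * (size Q)%:R * L * (y - x)
  = poly_norm Q * (1 + (size Q)%:R) * (L * (y - x)) by ring.
have s0 : 0 <= 1 + (size Q)%:R :> R by rewrite addr_ge0.
have h : L * (y - x) <= C * z `^ eta * (y - x) by rewrite ler_wpM2r // HC.
have -> : (poly_norm Q + 1) * (1 + (size Q)%:R) * C * z `^ eta * (y - x)
  = (poly_norm Q + 1) * (1 + (size Q)%:R) * (C * z `^ eta * (y - x)) by ring.
apply: ler_pM => //; rewrite ?mulr_ge0 //.
by rewrite ler_wpM2r // lerDl.
Qed.

Lemma tau_sumR_mono (R : realType) (k : nat) (x y : R) : x <= y ->
  tau_sumR k x <= tau_sumR k y.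
Proof.
move=> xy; rewrite /tau_sumR ler_nat /tau_sum.
by rewrite [leqRHS](big_cat_nat (n := (Num.truncn x).+1)) ?ltnS ?le_truncn //= leq_addr.
Qed.

Lemma measurable_horner_ln (R : realType) (Q : {poly R}) (D : set R) :
  measurable D -> measurable_fun D (fun y : R => Q.[ln y]).
Proof.
move=> mD; under eq_fun do rewrite horner_coef.
apply: measurable_sum => j; apply: measurable_funM; first exact: measurable_cst.
apply: measurable_funX; apply: measurable_funTS; exact: measurable_ln.
Qed.

Lemma measurable_piltz_error (R : realType) (k : nat) (Q : {poly R}) (D : set R) :
  measurable D -> measurable_fun D (piltz_error k Q).
Proof.
move=> mD; apply: measurable_funB.
  by apply: nondecreasing_measurable => // x y; exact: tau_sumR_mono.
apply: measurable_funM; [exact: measurable_id|exact: measurable_horner_ln].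
Qed.

(** * Square integrals *)

(** Kept in the extended reals, where comparison and additivity for nonnegative integrands ask for
    measurability only; [fine] returns to the real integral of the statement. *)
Definition sqint {R : realType} (f : R -> R) (D : set R) : \bar R :=
  (\int[@lebesgue_measure R]_(x in D) (f x ^+ 2)%:E)%E.

Lemma sqint_ge0 (R : realType) (f : R -> R) (D : set R) : (0 <= sqint f D)%E.
Proof. by apply: integral_ge0 => x _; rewrite lee_fin sqr_ge0. Qed.

Lemma measurable_sqr_EFin (R : realType) (f : R -> R) (D : set R) :
  measurable_fun D f -> measurable_fun D (fun x => (f x ^+ 2)%:E).
Proof. by move=> mf; apply/measurable_EFinP; exact: measurable_funX. Qed.

Lemma lebesgue_itvcc (R : realType) (a b : R) : a <= b ->
  @lebesgue_measure R `[a, b]%classic = (b - a)%:E.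
Proof.
move=> ab; rewrite lebesgue_measure_itv /= lte_fin; case: ltP => // ba.
by rewrite (le_anti (_ : a <= b <= a)) ?subrr // ab.
Qed.

Lemma sqint_sub (R : realType) (f : R -> R) (A B : set R) :
  measurable A -> measurable B -> measurable_fun B f -> A `<=` B ->
  (sqint f A <= sqint f B)%E.
Proof.
move=> mA mB mf AB; apply: ge0_subset_integral => //; first exact: measurable_sqr_EFin.
by move=> x _; rewrite lee_fin sqr_ge0.
Qed.

Lemma sqint_le_cst (R : realType) (f : R -> R) (a b v : R) : a <= b ->
  measurable_fun `[a, b] f -> (forall y, a <= y <= b -> `|f y| <= v) ->
  (sqint f `[a, b] <= (v ^+ 2 * (b - a))%:E)%E.
Proof.
move=> ab mf H; rewrite EFinM -lebesgue_itvcc // -integral_cst //.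
apply: ge0_le_integral => //.
- by move=> x _; rewrite lee_fin sqr_ge0.
- exact: measurable_sqr_EFin.
move=> x; rewrite /= in_itv /= => xab; rewrite lee_fin -(ger0_norm (sqr_ge0 _)) normrX.
have h := H x xab.
by rewrite lerXn2r // nnegrE // (le_trans _ h).
Qed.

Lemma sqint_ge_cst (R : realType) (f : R -> R) (a b v : R) : a <= b -> 0 <= v ->
  measurable_fun `[a, b] f -> (forall y, a <= y <= b -> v <= `|f y|) ->
  ((v ^+ 2 * (b - a))%:E <= sqint f `[a, b])%E.
Proof.
move=> ab v0 mf H; rewrite EFinM -lebesgue_itvcc // -integral_cst //.
apply: ge0_le_integral => //.
- by move=> x _; rewrite lee_fin sqr_ge0.
- exact: measurable_sqr_EFin.
move=> x; rewrite /= in_itv /= => xab; rewrite lee_fin -[leRHS](ger0_norm (sqr_ge0 _)) normrX.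
by rewrite lerXn2r ?nnegrE // H.
Qed.

(** * The exponents alpha and beta *)

Lemma near_pinftyP (R : realType) (P : R -> Prop) :
  (\forall x \near +oo, P x) <-> exists2 M : R, 1 <= M & forall x, M <= x -> P x.
Proof.
split=> [[M [_ H]]|[M M1 H]].
  exists (Num.max 1 (M + 1)); first by rewrite le_max lexx.
  move=> x; rewrite ge_max => /andP[_ Mx]; apply: H.
  by apply: lt_le_trans Mx; rewrite ltrDl.
by exists M; split; [exact: num_real|move=> x Mx; apply: H; exact: ltW].
Qed.

Lemma isO_powRP (R : realType) (f : R -> R) (s : R) :
  isO f (fun x => x `^ s) <->
  exists C M : R, [/\ 0 < C, 1 <= M & forall x, M <= x -> `|f x| <= C * x `^ s].
Proof.
split=> [[C /near_pinftyP[M M1 H]]|[C [M [C0 M1 H]]]].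
  exists (`|C| + 1), M; split=> //.
  move=> x Mx; apply: le_trans (H x Mx) _.
  rewrite ger0_norm ?powR_ge0 // ler_wpM2r ?powR_ge0 //.
  by rewrite (le_trans (ler_norm _)) // lerDl.
exists C; apply/near_pinftyP; exists M => // x Mx.
by rewrite [`|_ `^ _|]ger0_norm ?powR_ge0 // H.
Qed.

Lemma isO_powR_mono (R : realType) (f : R -> R) (s t : R) : s <= t ->
  isO f (fun x => x `^ s) -> isO f (fun x => x `^ t).
Proof.
move=> st /isO_powRP[C [M [C0 M1 H]]]; apply/isO_powRP; exists C, M; split=> // x Mx.
apply: le_trans (H x Mx) _; rewrite ler_wpM2l ?(ltW C0) //.
by rewrite ler_powR // (le_trans M1).
Qed.

Lemma eq_isO (R : realType) (f f' g : R -> R) :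
  (forall x, 1 <= x -> f x = f' x) -> isO f g -> isO f' g.
Proof.
move=> ff [C /near_pinftyP[M M1 H]]; exists C; apply/near_pinftyP; exists M => // x Mx.
by rewrite -ff ?H // (le_trans M1).
Qed.

Lemma piltz_error_le (R : realType) (k : nat) (Q : {poly R}) (eps : R) :
  (0 < k)%N -> 0 < eps ->
  exists2 C : R, 0 < C & forall y : R, 1 <= y -> `|piltz_error k Q y| <= C * y `^ (1 + eps).
Proof.
move=> k0 e0; have [C C0 HC] := tau_sumR_powR_le R k _ k0 e0.
have [D D0 HD] := main_le R Q _ e0.
exists (C + 2 * D); first by rewrite addr_gt0 ?mulr_gt0.
move=> y y1; have y0 : 0 < y := lt_le_trans ltr01 y1.
apply: le_trans (ler_normB _ _) _; rewrite mulrDl lerD //.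
  by rewrite ger0_norm ?HC // tau_sumR_ge0.
apply: le_trans (HD y y0) _.
have -> : 2 * D * y `^ (1 + eps) = D * (y `^ (1 + eps) + y `^ (1 + eps)) by ring.
by rewrite ler_wpM2l ?(ltW D0) // lerD2l ler_powR //; lra.
Qed.

(** [fine] sends an infinite value to 0, so finiteness is what lets a bound on the real integral be
    read as a bound on [sqint]. *)
Lemma sqint_fin (R : realType) (k : nat) (Q : {poly R}) (x : R) : (0 < k)%N -> 1 <= x ->
  sqint (piltz_error k Q) `[1, x] \is a fin_num.
Proof.
move=> k0 x1; have [C C0 HC] := piltz_error_le R k Q 1 k0 ltr01.
rewrite ge0_fin_numE ?sqint_ge0 //.
apply: le_lt_trans (sqint_le_cst _ _ _ _ (C * x `^ (1 + 1)) x1 _ _) (ltry _).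
  exact: measurable_piltz_error.
move=> y /andP[y1 yx]; apply: le_trans (HC y y1) _; rewrite ler_wpM2l ?(ltW C0) //.
by rewrite powR_le_powRr // (le_trans _ y1).
Qed.

Definition is_main_poly {R : realType} (k : nat) (Q : {poly R}) : Prop :=
  forall x : R, 0 < x -> mainTerm k x = x * Q.[ln x].

(** [alpha] and [beta] are the infima of the sets given by [alpha_exp] and [beta_exp]. The infimum
    itself need not be attained, so bounds are used at exponents strictly above it. *)
Definition alpha_exp {R : realType} (k : nat) (a : R) : Prop :=
  isO (@Delta R k) (fun x => x `^ a).

Definition beta_exp {R : realType} (k : nat) (b : R) : Prop :=
  isO (fun x => \int[@lebesgue_measure R]_(t in `[1, x]) (Delta k t ^+ 2))
      (fun x => x `^ (1 + 2 * b)).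

Lemma Rint_Delta (R : realType) (k : nat) (Q : {poly R}) (x : R) : is_main_poly k Q ->
  \int[@lebesgue_measure R]_(t in `[1, x]) (Delta k t ^+ 2) = fine (sqint (piltz_error k Q) `[1, x]).
Proof.
move=> hQ; congr fine; apply: eq_integral => t; rewrite inE /= in_itv /= => /andP[t1 _].
by rewrite (DeltaE _ _ _ _ hQ) // (lt_le_trans ltr01).
Qed.

Lemma alpha_expP (R : realType) (k : nat) (Q : {poly R}) (a : R) : is_main_poly k Q ->
  alpha_exp k a <->
  exists C M : R, [/\ 0 < C, 1 <= M & forall x, M <= x -> `|piltz_error k Q x| <= C * x `^ a].
Proof.
move=> hQ; have E x : 1 <= x -> Delta k x = piltz_error k Q x.
  by move=> x1; rewrite (DeltaE _ _ _ _ hQ) // (lt_le_trans ltr01).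
rewrite -isO_powRP; split; apply: eq_isO => x x1; by rewrite E.
Qed.

Lemma beta_expP (R : realType) (k : nat) (Q : {poly R}) (b : R) : (0 < k)%N ->
  is_main_poly k Q -> beta_exp k b <->
  exists C M : R, [/\ 0 < C, 1 <= M &
    forall x, M <= x -> (sqint (piltz_error k Q) `[1%R, x] <= (C * x `^ (1 + 2 * b))%:E)%E].
Proof.
move=> k0 hQ; rewrite /beta_exp isO_powRP; split=> -[C [M [C0 M1 H]]]; exists C, M; split=> // x Mx;
  have x1 := le_trans M1 Mx; have := H x Mx; rewrite (Rint_Delta _ _ _ _ hQ).
  rewrite -[X in (X <= _)%E]fineK ?sqint_fin // lee_fin.
  by apply: le_trans; exact: ler_norm.
rewrite ger0_norm ?fine_ge0 ?sqint_ge0 //.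
by rewrite -lee_fin fineK ?sqint_fin.
Qed.

(** This witnesses that the set defining [beta] is nonempty. The bound |error| <= C y ^ 2 integrates
    to x ^ 5, and 5 = 1 + 2 * 2. *)
Lemma beta_exp2 (R : realType) (k : nat) (Q : {poly R}) : (0 < k)%N -> is_main_poly k Q ->
  beta_exp k (2 : R).
Proof.
move=> k0 hQ; apply/(beta_expP _ _ _ _ k0 hQ); have [C C0 HC] := piltz_error_le R k Q 1 k0 ltr01.
exists (C ^+ 2), 1; split=> //; first exact: exprn_gt0.
move=> x x1; have x0 : 0 < x := lt_le_trans ltr01 x1.
apply: le_trans (sqint_le_cst _ _ _ _ (C * x `^ (1 + 1)) x1 _ _) _.
- exact: measurable_piltz_error.
- move=> y /andP[y1 yx]; apply: le_trans (HC y y1) _; rewrite ler_wpM2l ?(ltW C0) //.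
  by rewrite powR_le_powRr // (le_trans _ y1).
have -> : 1 + 2 * 2 = 5%:R :> R by ring.
have -> : 1 + 1 = 2%:R :> R by [].
rewrite lee_fin !powR_mulrn ?(ltW x0) // exprMn -mulrA ler_wpM2l ?exprn_ge0 ?(ltW C0) //.
by rewrite -exprM [leRHS]exprSr ler_wpM2l ?exprn_ge0 ?(ltW x0) // gerBl.
Qed.

(* The summatory function jumps by [tau k n >= 1] at [n] while the main term
   moves by at most [1 / 8] within distance [h]. *)
Lemma piltz_error_jump (R : realType) (k : nat) (Q : {poly R}) (C eta z h : R) (n : nat) :
  (0 < k)%N ->
  (forall x y z : R, 1 <= x -> x <= y -> y <= z ->
     `|y * Q.[ln y] - x * Q.[ln x]| <= C * z `^ eta * (y - x)) ->
  (2 <= n)%N -> n.+1%:R <= z -> 0 < h <= 1 / 4 -> 0 <= C -> C * z `^ eta * h <= 1 / 8 ->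
  (forall y : R, n%:R <= y <= n%:R + h -> 3 / 8 <= `|piltz_error k Q y|) \/
  (forall y : R, n%:R - h <= y < n%:R -> 3 / 8 <= `|piltz_error k Q y|).
Proof.
move=> k0 HC n2 nz /andP[h0 h4] C0 Ch.
pose err := piltz_error k Q.
have n2R : 2 <= n%:R :> R by rewrite ler_nat.
have n0 : (0 < n)%N by apply: leq_trans n2.
have nz' : n%:R + 1 <= z by rewrite natr1.
have Cz0 : 0 <= C * z `^ eta by rewrite mulr_ge0 ?powR_ge0.
have right y : n%:R <= y <= n%:R + h -> err n%:R - 1 / 8 <= err y.
  move=> /andP[ny yh]; have := HC n%:R y z; rewrite ny.
  have -> : 1 <= n%:R :> R by lra.
  have -> : y <= z by lra.
  move=> /(_ isT isT isT) /ler_normlP[_].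
  have := tau_sumR_mono _ k _ _ ny; rewrite /err /piltz_error.
  have : C * z `^ eta * (y - n%:R) <= C * z `^ eta * h by rewrite ler_wpM2l //; lra.
  move: (C * _ * (_ - _)) => X h1; lra.
have left y : n%:R - h <= y < n%:R -> err y <= err n%:R - 7 / 8.
  move=> /andP[ny yn]; have := HC y n%:R z; rewrite (ltW yn).
  have -> : 1 <= y by lra.
  have -> : n%:R <= z by lra.
  move=> /(_ isT isT isT) /ler_normlP[_ hn].
  have hD : tau_sumR k y + 1 <= tau_sumR k n%:R :> R.
    have y0 : 0 <= y by lra.
    rewrite /tau_sumR natrK natr1 ler_nat /tau_sum.
    have tn : (Num.truncn y < n)%N by rewrite truncn_lt_nat.
    rewrite [X in (_ < X)%N](big_cat_nat (n := (Num.truncn y).+1)) ?ltnS ?(ltnW tn) //=.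
    rewrite -addn1 leq_add2l big_nat_recr //=.
    by rewrite (leq_trans (tau_gt0 k n k0 n0)) // leq_addl.
  move: hn; rewrite /err /piltz_error.
  have : C * z `^ eta * (n%:R - y) <= C * z `^ eta * h by rewrite ler_wpM2l //; lra.
  move: (C * _ * (_ - _)) => X h1; lra.
(* If the error at n is at least 1 / 2 it stays above 1 / 2 - 1 / 8 to the right; otherwise it is
   below 1 / 2 - 7 / 8 to the left. Both give 3 / 8 in absolute value. *)
have [e12|e12] := leP (1 / 2) (err n%:R); [left|right].
  move=> y /right h1; rewrite -/(err y); apply: le_trans (ler_norm _); lra.
move=> y /left h1; rewrite -/(err y) -normrN; apply: le_trans (ler_norm _); lra.
Qed.

Lemma powR_unbounded (R : realType) (s K : R) : 0 < s -> exists2 M : R, 1 <= M &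
  forall x, M <= x -> K < x `^ s.
Proof.
move=> s0; pose K' := `|K| + 1.
have K0 : 0 < K' by rewrite ltr_wpDl.
exists (Num.max 1 (K' `^ s^-1)); first by rewrite le_max lexx.
move=> x; rewrite ge_max => /andP[x1 xK].
apply: lt_le_trans (_ : K' <= _).
  by rewrite /K' (le_lt_trans (ler_norm _)) // ltrDl.
have -> : K' = (K' `^ s^-1) `^ s by rewrite -powRrM mulVf ?gt_eqF // powRr1 // ltW.
by rewrite powR_le_powRr ?powR_ge0 // ltW.
Qed.

Lemma sqint_cat (R : realType) (f : R -> R) (a b c : R) : measurable_fun setT f ->
  a <= b -> b <= c ->
  sqint f `[a, c] = (sqint f `[a, b] + sqint f `]b, c])%E.
Proof.
move=> mf ab bc; rewrite /sqint -ge0_integral_setU //=.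
- congr (integral _ _ _); apply/seteqP; split=> x; rewrite /= !in_itv /=.
    by move=> /andP[ax xc]; case: (leP x b) => xb; [left; rewrite ax|right; rewrite xc].
  by move=> [/andP[ax xb]|/andP[bx xc]]; rewrite ?ax ?xc ?(le_trans xb) // (le_trans ab) ?ltW.
- by apply: measurable_sqr_EFin; exact: measurable_funTS.
- by move=> x _; rewrite lee_fin sqr_ge0.
- apply/disj_setPS => x [/=]; rewrite !in_itv /= => /andP[_ xb] /andP[bx _].
  by have := lt_le_trans bx xb; rewrite ltxx.
Qed.

(** Each integer 2 <= n <= N contributes at least (3 / 8) ^ 2 h / 2 through its jump, on disjoint
    unit intervals, with h of order z ^ (- eta). The total is of order z ^ (1 - eta); for b = - eta
    < 0 this exceeds the assumed O(z ^ (1 - 2 eta)). *)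
Lemma beta_exp_ge0 (R : realType) (k : nat) (Q : {poly R}) (b : R) : (0 < k)%N ->
  is_main_poly k Q -> beta_exp k b -> 0 <= b.
Proof.
move=> k0 hQ /(beta_expP _ _ _ _ k0 hQ)[C' [M [C'0 M1 H]]].
rewrite leNgt; apply/negP => b0; pose eta := - b.
have eta0 : 0 < eta by rewrite oppr_gt0.
have [C C0 HC] := main_lipschitz R Q eta eta0.
pose err := piltz_error k Q.
have merr : measurable_fun setT err by exact: measurable_piltz_error.
pose c0 : R := (3 / 8) ^+ 2 / (2 * (4 + 8 * C)).
have c00 : 0 < c0 by rewrite divr_gt0 ?exprn_gt0 ?mulr_gt0 ?addr_gt0 ?mulr_gt0.
have [M' M'1 HM'] := powR_unbounded R eta (3 * C' / c0) eta0.
have [N [N2 zMM]] : exists N, (2 <= N)%N /\ M + M' <= N.+1%:R.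
  exists (Num.truncn (M + M')).+2; split=> //.
  apply: ltW; apply: lt_le_trans (truncnS_gt _) _.
  by rewrite ler_nat; exact: leqW (leqW (leqnn _)).
have [z zE] : exists z : R, z = N.+1%:R by exists N.+1%:R.
rewrite -zE in zMM.
have zM : M <= z by lra.
have zM' : M' <= z by lra.
have z1 : 1 <= z := le_trans M1 zM.
have z0 : 0 < z := lt_le_trans ltr01 z1.
have ze1 : 1 <= z `^ eta by rewrite powR_ge1 // ltW.
(* The two summands of the denominator ensure h <= 1 / 4 and C z ^ eta h <= 1 / 8. *)
pose h := (4 + 8 * C * z `^ eta)^-1.
have den0 : 0 < 4 + 8 * C * z `^ eta by rewrite addr_gt0 ?mulr_gt0 // (lt_le_trans ltr01).
have h0 : 0 < h by rewrite invr_gt0.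
have h4 : h <= 1 / 4.
  by rewrite /h div1r lef_pV2 ?posrE // lerDl !mulr_ge0 ?powR_ge0 ?(ltW C0).
have Ch : C * z `^ eta * h <= 1 / 8.
  rewrite /h ler_pdivrMr //; have : 0 <= C * z `^ eta by rewrite mulr_ge0 ?powR_ge0 ?(ltW C0).
  lra.
pose g := (3 / 8) ^+ 2 * (h / 2).
have g0 : 0 <= g by rewrite mulr_ge0 ?exprn_ge0 ?divr_ge0 ?(ltW h0).
have sq (c d : R) : c <= d -> (forall y, c <= y <= d -> 3 / 8 <= `|err y|) -> h / 2 <= d - c ->
    (g%:E <= sqint err `[c, d])%E.
  move=> cd Hy hd; apply: le_trans (sqint_ge_cst _ _ _ _ (3 / 8) cd _ _ Hy) => //.
    by rewrite lee_fin ler_wpM2l.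
  exact: measurable_funTS.
have step (n : nat) : (2 <= n)%N -> (n <= N)%N ->
    (g%:E <= sqint err `](n%:R - 2^-1)%R, (n%:R + 2^-1)%R])%E.
  move=> n2 nN.
  have nz : n.+1%:R <= z by rewrite zE ler_nat ltnS.
  case: (piltz_error_jump R k Q C eta z h n k0 HC n2 nz _ (ltW C0) Ch) => [|Hr|Hl].
  - by rewrite h0.
  - apply: le_trans (sq n%:R (n%:R + h) _ Hr _) _; rewrite ?lerDl ?(ltW h0) //.
      by rewrite addrC addKr; lra.
    apply: sqint_sub => //; first exact: measurable_funTS.
    by move=> y; rewrite /= !in_itv /= => /andP[y1 y2]; apply/andP; split; lra.
  (* The interval to the left of n is half-open; its left half is closed, which is why only the
     length h / 2 is claimed. *)
  - have hd : n%:R - h <= n%:R - h / 2 by lra.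
    have hlen : h / 2 <= n%:R - h / 2 - (n%:R - h) by lra.
    have Hl' y : n%:R - h <= y <= n%:R - h / 2 -> 3 / 8 <= `|err y|.
      by move=> /andP[y1 y2]; apply: Hl; apply/andP; split; lra.
    apply: le_trans (sq _ _ hd Hl' hlen) _.
    apply: sqint_sub => //; first exact: measurable_funTS.
    by move=> y; rewrite /= !in_itv /= => /andP[y1 y2]; apply/andP; split; lra.
have sum (m : nat) : (m.+1 <= N)%N -> ((m%:R * g)%R%:E <= sqint err `[1%R, (m.+1%:R + 2^-1)%R])%E.
  elim: m => [|m IH] mN; first by rewrite mul0r sqint_ge0.
  rewrite (@sqint_cat _ _ _ (m.+1%:R + 2^-1)) //; last 2 first.
  - by rewrite -natr1; have := ler0n R m; lra.
  - by rewrite lerD2r ler_nat.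
  have -> : m.+1%:R * g = m%:R * g + g by rewrite -natr1; ring.
  rewrite EFinD; apply: leeD; first by apply: IH; exact: ltnW.
  apply: le_trans (step m.+2 isT mN) _.
  suff -> : m.+2%:R - 2^-1 = m.+1%:R + 2^-1 :> R by [].
  by rewrite -[m.+2%:R]natr1; lra.
have := H z zM; apply/negP; rewrite -ltNge.
have N1 : (N.-1.+1 <= N)%N by rewrite prednK // (leq_trans _ N2).
apply: lt_le_trans (le_trans (sum N.-1 N1) _); last first.
  apply: sqint_sub => //; first exact: measurable_funTS.
  move=> y; rewrite /= !in_itv /= => /andP[-> y2] /=; apply: le_trans y2 _.
  by rewrite prednK ?(leq_trans _ N2) // zE -[N.+1%:R]natr1 lerD2l; lra.
rewrite lte_fin.
have -> : 1 + 2 * b = 1 + - eta + - eta by rewrite /eta; ring.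
rewrite !gt0_powRD // powRr1 ?(ltW z0) // powRN.
have hz : ((4 + 8 * C) * z `^ eta)^-1 <= h.
  have h4z : 4 <= 4 * z `^ eta by rewrite ler_peMr.
  have den1 : 0 < (4 + 8 * C) * z `^ eta.
    by rewrite mulr_gt0 ?addr_gt0 ?mulr_gt0 // (lt_le_trans ltr01).
  rewrite /h lef_pV2 ?posrE //; lra.
have hN : z / 3 <= N.-1%:R.
  have zN : z = N.-1%:R + 2 by rewrite zE -natrD addn2 prednK // (leq_trans _ N2).
  have N11 : 1 <= N.-1%:R :> R by rewrite ler1n -ltnS prednK // (leq_trans _ N2).
  move: zN N11; move: (N.-1%:R) => X zN N11; lra.
have hg : c0 / z `^ eta <= g.
  have -> : c0 / z `^ eta = (3 / 8) ^+ 2 * (((4 + 8 * C) * z `^ eta)^-1 / 2).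
    by rewrite /c0 !invfM; ring.
  by rewrite ler_wpM2l ?exprn_ge0 // ler_wpM2r.
have w1 : 0 <= z / 3 by rewrite divr_ge0 ?(ltW z0).
have w2 : 0 <= c0 / z `^ eta := divr_ge0 (ltW c00) (powR_ge0 _ _).
clearbody c0.
apply: lt_le_trans (ler_pM w1 w2 hN hg).
have := HM' z zM'; rewrite ltr_pdivrMr // => hh.
have zi : 0 < (z `^ eta)^-1 by rewrite invr_gt0 (lt_le_trans ltr01).
have -> : C' * (z / z `^ eta / z `^ eta) = 3 * C' * (z `^ eta)^-1 * (z / 3 / z `^ eta).
  by field; rewrite gt_eqF // powR_gt0.
have -> : z / 3 * (c0 / z `^ eta) = c0 * (z / 3 / z `^ eta) by ring.
rewrite ltr_pM2r ?mulr_gt0 // ltr_pdivrMr ?powR_gt0 //.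
by rewrite [ltRHS]mulrC.
Qed.

(** A negative exponent would make the error tend to 0, while the jump at a large n keeps it at
    least 3 / 8 at n or at n - h. *)
Lemma alpha_exp_ge0 (R : realType) (k : nat) (Q : {poly R}) (a : R) : (0 < k)%N ->
  is_main_poly k Q -> alpha_exp k a -> 0 <= a.
Proof.
move=> k0 hQ /(alpha_expP _ _ _ _ hQ)[C' [M [C'0 M1 H]]].
rewrite leNgt; apply/negP => a0.
have [C C0 HC] := main_lipschitz R Q 1 ltr01.
have na0 : 0 < - a by rewrite oppr_gt0.
have [M' M'1 HM'] := powR_unbounded R (- a) (4 * C') na0.
pose n := (Num.truncn (M + M' + 1)).+2.
have nMM : M + M' + 1 <= n%:R.
  by apply: ltW; apply: lt_le_trans (truncnS_gt _) _; rewrite ler_nat; exact: leqW (leqnn _).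
pose z : R := n.+1%:R.
have ze : 0 < z `^ 1 by rewrite powR_gt0 // ltr0n.
pose h := (4 + 8 * C * z `^ 1)^-1.
have den0 : 0 < 4 + 8 * C * z `^ 1 by rewrite addr_gt0 ?mulr_gt0.
have h0 : 0 < h by rewrite invr_gt0.
have h4 : h <= 1 / 4.
  by rewrite /h div1r lef_pV2 ?posrE // lerDl !mulr_ge0 ?powR_ge0 ?(ltW C0).
have Ch : C * z `^ 1 * h <= 1 / 8.
  rewrite /h ler_pdivrMr //; have : 0 <= C * z `^ 1 by rewrite mulr_ge0 ?powR_ge0 ?(ltW C0).
  lra.
have small y : M + M' <= y -> `|piltz_error k Q y| < 3 / 8.
  move=> yMM; have yM : M <= y by lra.
  have yM' : M' <= y by lra.
  have y0 : 0 < y := lt_le_trans ltr01 (le_trans M1 yM).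
  apply: le_lt_trans (H y yM) _.
  rewrite -[a]opprK powRN ltr_pdivrMr ?powR_gt0 //.
  by have := HM' y yM'; lra.
have n2 : (2 <= n)%N by [].
have hh : 0 < h <= 1 / 4 by rewrite h0.
case: (piltz_error_jump R k Q C 1 z h n k0 HC n2 (lexx _) hh (ltW C0) Ch) => Hj.
  have := Hj n%:R; rewrite lexx lerDl (ltW h0) => /(_ isT).
  by have := small n%:R; lra.
have := Hj (n%:R - h); rewrite lexx gtrBl h0 => /(_ isT).
by have := small (n%:R - h); lra.
Qed.

(* If |error x| = v, monotonicity of the summatory function keeps the error at
   least v / 2 on one side of x over a length comparable to v / x ^ eta, so
   v ^ 3 is controlled by the mean square. *)
Lemma alpha_exp_of_beta_exp (R : realType) (k : nat) (Q : {poly R}) (b : R) : (0 < k)%N ->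
  is_main_poly k Q -> b < 1 -> beta_exp k b -> alpha_exp k ((2 + b) / 3).
Proof.
move=> k0 hQ b1 /(beta_expP _ _ _ _ k0 hQ)[C' [M [C'0 M1 H]]].
apply/(alpha_expP _ _ _ _ hQ).
(* With this eta, v ^ 3 is at most of order x ^ (1 + 2 b) x ^ eta = x ^ (2 + b), which produces the
   exponent (2 + b) / 3. *)
pose eta := 1 - b; have eta0 : 0 < eta by rewrite subr_gt0.
have [C C0 HC] := main_lipschitz R Q eta eta0.
have [D D0 HD] := piltz_error_le R k Q eta k0 eta0.
pose err := piltz_error k Q.
have merr : measurable_fun setT err by exact: measurable_piltz_error.
(* The summand 2 D keeps h <= x / 2; the summand 2 C 2 ^ eta keeps the drift of the main term over
   length h below v / 2. *)
pose L := 2 * C * 2 `^ eta + 2 * D.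
have L0 : 0 < L by rewrite addr_gt0 ?mulr_gt0 ?powR_gt0.
pose K := 4 * L * C' * 2 `^ (1 + 2 * b).
have K0 : 0 < K by rewrite !mulr_gt0 ?powR_gt0.
exists (1 + K), (M + 2); split; [by rewrite addr_gt0| lra|].
move=> x xM; have x2 : 2 <= x by lra.
have x0 : 0 < x by lra.
set v := `|_|.
have v0 : 0 <= v by rewrite normr_ge0.
pose xe := x `^ eta; have xe0 : 0 < xe by rewrite powR_gt0.
pose h := v / (L * xe).
have Lxe : 0 < L * xe by rewrite mulr_gt0.
have h0 : 0 <= h by rewrite divr_ge0 // ltW.
have hx : h <= x / 2.
  rewrite /h ler_pdivrMr //; apply: le_trans (HD x _) _; first by lra.
  rewrite gt0_powR1D // -/xe.
  have -> : D * (x * xe) = x / 2 * (2 * D * xe) by field.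
  rewrite ler_wpM2l ?divr_ge0 ?(ltW x0) // ler_wpM2r ?(ltW xe0) // lerDr.
  by rewrite !mulr_ge0 ?powR_ge0 ?(ltW C0).
have Ch : C * (2 * x) `^ eta * h <= v / 2.
  rewrite powRM ?(ltW x0) // -/xe /h.
  have -> : C * (2 `^ eta * xe) * (v / (L * xe)) = (2 * C * 2 `^ eta) / L * (v / 2).
    by field; rewrite !gt_eqF.
  rewrite ler_piMl ?divr_ge0 // ler_pdivrMr // mul1r lerDl.
  by rewrite mulr_ge0 // ltW.
have Cz0 : 0 <= C * (2 * x) `^ eta by rewrite mulr_ge0 ?powR_ge0 ?(ltW C0).
have lower : (((v / 2) ^+ 2 * h)%R%:E <= sqint err `[1%R, (2 * x)%R])%E.
  have vv0 : 0 <= v / 2 by rewrite divr_ge0.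
  have sq (c d : R) : c <= d -> d - c = h -> (forall y, c <= y <= d -> v / 2 <= `|err y|) ->
      (((v / 2) ^+ 2 * h)%R%:E <= sqint err `[c, d])%E.
    move=> cd <- Hy; apply: sqint_ge_cst => //; exact: measurable_funTS.
  have [e0|e0] := leP 0 (err x).
    have vE : v = err x by rewrite /v ger0_norm.
    have xh : x <= x + h by rewrite lerDl.
    apply: le_trans (_ : (sqint err `[x, (x + h)%R] <= _)%E); last first.
      apply: sqint_sub => //; first exact: measurable_funTS.
      by move=> y; rewrite /= !in_itv /= => /andP[y1 y2]; apply/andP; split; lra.
    apply: sq => //; first by rewrite addrC addKr.
    move=> y /andP[xy yh]; apply: le_trans (ler_norm _).
    have := HC x y (2 * x); rewrite xy; have -> : 1 <= x by lra.
    have -> : y <= 2 * x by lra.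
    move=> /(_ isT isT isT) /ler_normlP[_].
    have := tau_sumR_mono _ k _ _ xy; move: vE; rewrite /err /piltz_error.
    have : C * (2 * x) `^ eta * (y - x) <= C * (2 * x) `^ eta * h by rewrite ler_wpM2l //; lra.
    move: (C * _ * (y - x)) => X h1 vE; lra.
  have vE : v = - err x by rewrite /v ltr0_norm.
  have xh : x - h <= x by rewrite gerBl.
  apply: le_trans (_ : (sqint err `[(x - h)%R, x] <= _)%E); last first.
    apply: sqint_sub => //; first exact: measurable_funTS.
    by move=> y; rewrite /= !in_itv /= => /andP[y1 y2]; apply/andP; split; lra.
  apply: sq => //; first by rewrite subKr.
  move=> y /andP[xy yh]; rewrite -normrN; apply: le_trans (ler_norm _).
  have := HC y x (2 * x); rewrite yh; have -> : 1 <= y by lra.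
  have -> : x <= 2 * x by lra.
  move=> /(_ isT isT isT) /ler_normlP[_].
  have := tau_sumR_mono _ k _ _ yh; move: vE; rewrite /err /piltz_error.
  have : C * (2 * x) `^ eta * (x - y) <= C * (2 * x) `^ eta * h by rewrite ler_wpM2l //; lra.
  move: (C * _ * (x - y)) => X h1 vE; lra.
have xM2 : M <= 2 * x by lra.
have := le_trans lower (H _ xM2); rewrite lee_fin => cube.
pose a := (2 + b) / 3; pose xa := x `^ a; have xa0 : 0 < xa by rewrite powR_gt0.
have E3 : xa ^+ 3 = x `^ (1 + 2 * b) * xe.
  rewrite /xa /xe -powR_mulrn ?powR_ge0 // -powRrM -gt0_powRD //; congr (_ `^ _).
  by rewrite /a /eta; field.
have v3 : v ^+ 3 <= K * xa ^+ 3.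
  have -> : v ^+ 3 = (v / 2) ^+ 2 * h * (4 * L * xe).
    by rewrite /h; field; rewrite !gt_eqF.
  apply: le_trans (ler_wpM2r _ cube) _; first by rewrite !mulr_ge0 ?(ltW L0) ?(ltW xe0).
  rewrite E3 powRM ?(ltW x0) // /K le_eqVlt; apply/orP; left; apply/eqP; ring.
rewrite leNgt; apply/negP => vbig.
have : ((1 + K) * xa) ^+ 3 < v ^+ 3.
  have h1 : 0 <= (1 + K) * xa by rewrite mulr_ge0 ?addr_ge0 ?(ltW K0) ?(ltW xa0).
  by rewrite ltrXn2r.
apply/negP; rewrite -leNgt; apply: le_trans v3 _.
rewrite exprMn ler_wpM2r ?exprn_ge0 ?(ltW xa0) //.
apply: le_trans (_ : (1 + K) ^+ 1 <= _); first by rewrite expr1 lerDr.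
by rewrite ler_weXn2l // lerDl ltW.
Qed.

(** * Dilations of the Lebesgue measure *)

(** The pushforward under division by c, multiplied by 1 / c, has the Lebesgue value on half-open
    intervals, and these values determine the measure. *)
Lemma lebesgue_measure_scale (R : realType) (c : R) (A : set R) : 0 < c -> measurable A ->
  @lebesgue_measure R [set x | A (x / c)] = (c%:E * @lebesgue_measure R A)%E.
Proof.
move=> c0 mA.
have mphi : measurable_fun [set: measurableTypeR R] (fun x : measurableTypeR R => x / c : measurableTypeR R).
  by apply: measurable_funM; [exact: measurable_id|exact: measurable_cst].
have [P PE] : exists P : {measure set (measurableTypeR R) -> \bar R},
    forall B : set R, P B = @lebesgue_measure R [set x | B (x / c)].
  by unshelve eexists (pushforward (@lebesgue_measure R)
    (fun x : measurableTypeR R => x / c : measurableTypeR R)).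
have ci0 : 0 <= c^-1 by rewrite invr_ge0 ltW.
have -> : @lebesgue_measure R A = mscale (NngNum ci0) P A.
  apply: lebesgue_measure_unique => // _ [[a b] _ <-].
  rewrite /mscale [X in _ = (_ * X)%E]PE.
  have -> : [set x : R | `]a, b]%classic (x / c)] = `](a * c)%R, (b * c)%R]%classic.
    by apply/seteqP; split=> x; rewrite /= !in_itv /= ltr_pdivlMr // ler_pdivrMr.
  rewrite !lebesgue_measure_itv /= !lte_fin ltr_pM2r //.
  case: ifP => _; last by rewrite mule0.
  by rewrite -!EFinB -EFinM -mulrBl mulrCA mulVf ?gt_eqF // mulr1.
by rewrite /mscale [X in (_ * (_ * X))%E]PE muleA -EFinM divff ?gt_eqF // mul1e.
Qed.

Lemma ge0_integral_scale (R : realType) (c : R) (D : set R) (f : R -> \bar R) : 0 < c ->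
  measurable D -> measurable_fun D f -> (forall x, D x -> (0 <= f x)%E) ->
  (\int[@lebesgue_measure R]_(x in [set x | D (x / c)%R]) f (x / c)%R =
   c%:E * \int[@lebesgue_measure R]_(x in D) f x)%E.
Proof.
move=> c0 mD mf f0.
have mphi : measurable_fun [set: measurableTypeR R] (fun x : measurableTypeR R => x / c : measurableTypeR R).
  by apply: measurable_funM; [exact: measurable_id|exact: measurable_cst].
have := ge0_integral_pushforward mphi (@lebesgue_measure R) mD mf.
move=> <-; last by move=> y /[!inE] Dy; exact: f0.
transitivity (\int[mscale (NngNum (ltW c0)) (@lebesgue_measure R)]_(x in D) f x)%E;
  last exact: ge0_integral_mscale.
apply: eq_measure_integral => A mA _; exact: lebesgue_measure_scale.
Qed.

(** The substitution maps the lower end 1 to 1 / c; enlarging the interval down to 0 gives one bound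
    for all dilations, to be met by [sqint_all]. *)
Lemma sqint_scale_le (R : realType) (f : R -> R) (c T : R) : measurable_fun setT f ->
  0 < c -> (sqint (fun x => f (x / c)%R) `[1%R, T] <= c%:E * sqint f `[0%R, (T / c)%R])%E.
Proof.
move=> mf c0.
have mfD (D : set R) : measurable D -> measurable_fun D (fun x => (f x ^+ 2)%:E).
  by move=> mD; apply: measurable_sqr_EFin; exact: measurable_funTS.
rewrite {2}/sqint -(ge0_integral_scale _ _ _ (fun x => (f x ^+ 2)%:E) c0) //; last 2 first.
- exact: mfD.
- by move=> x _; rewrite lee_fin sqr_ge0.
have E : [set x | `[0, T / c]%classic (x / c)] = `[0, T]%classic.
  apply/seteqP; split=> x; rewrite /= !in_itv /=;
    by rewrite ler_pdivlMr // mul0r ler_pM2r // invr_gt0.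
rewrite E; apply: ge0_subset_integral => //.
- apply: measurable_sqr_EFin; apply: measurable_funTS.
  apply: measurableT_comp => //; apply: measurable_funM; [exact: measurable_id|exact: measurable_cst].
- by move=> x _; rewrite lee_fin sqr_ge0.
- by move=> x; rewrite /= !in_itv /= => /andP[x1 ->]; rewrite (le_trans ler01).
Qed.

(** * Exponents near alpha and beta, the degree of Q, and bounds on the whole half-line *)

Lemma has_inf_of_ge0 (R : realType) (A : set R) (a0 : R) :
  A a0 -> (forall a, A a -> 0 <= a) -> has_inf A.
Proof. by move=> Aa0 H; split; [exists a0|exists 0]. Qed.

Lemma beta_ge0 (R : realType) (k : nat) (Q : {poly R}) : (0 < k)%N -> is_main_poly k Q ->
  0 <= beta R k.
Proof.
move=> k0 hQ; apply: lb_le_inf.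
  by exists 2; exact: (beta_exp2 _ _ _ k0 hQ).
by move=> b hb; exact: (beta_exp_ge0 _ _ _ _ k0 hQ hb).
Qed.

Lemma beta_exp_gt (R : realType) (k : nat) (Q : {poly R}) (b : R) : (0 < k)%N ->
  is_main_poly k Q -> beta R k < b -> beta_exp k b.
Proof.
move=> k0 hQ bb.
have hi : has_inf [set b : R | beta_exp k b].
  apply: (has_inf_of_ge0 _ _ 2); first exact: (beta_exp2 _ _ _ k0 hQ).
  by move=> a ha; exact: (beta_exp_ge0 _ _ _ _ k0 hQ ha).
have bb0 : 0 < b - beta R k by rewrite subr_gt0.
have [b' hb' lt] := inf_adherent bb0 hi.
apply: isO_powR_mono hb'; move: lt; rewrite -/(beta R k) addrCA subrr addr0 => lt; lra.
Qed.

Lemma alpha_lt1 (R : realType) (k : nat) (Q : {poly R}) : (0 < k)%N -> is_main_poly k Q ->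
  beta R k < 1 -> alpha R k < 1.
Proof.
move=> k0 hQ b1; pose b := (1 + beta R k) / 2.
have bb : beta R k < b by rewrite /b; lra.
have b1' : b < 1 by rewrite /b; lra.
have ha := alpha_exp_of_beta_exp _ _ _ _ k0 hQ b1' (beta_exp_gt _ _ _ _ k0 hQ bb).
apply: le_lt_trans (_ : (2 + b) / 3 < 1); last by lra.
apply: ge_inf => //; exists 0 => a aa.
exact: (alpha_exp_ge0 _ _ _ _ k0 hQ aa).
Qed.

Lemma alpha_exp_gt (R : realType) (k : nat) (Q : {poly R}) (a a0 : R) : (0 < k)%N ->
  is_main_poly k Q -> alpha_exp k a0 -> alpha R k < a -> alpha_exp k a.
Proof.
move=> k0 hQ h0 aa.
have hi : has_inf [set a : R | alpha_exp k a].
  by apply: (has_inf_of_ge0 _ _ a0) => // a' ha; exact: (alpha_exp_ge0 _ _ _ _ k0 hQ ha).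
have aa0 : 0 < a - alpha R k by rewrite subr_gt0.
have [a' ha' lt] := inf_adherent aa0 hi.
apply: isO_powR_mono ha'; move: lt; rewrite -/(alpha R k) addrCA subrr addr0 => lt; lra.
Qed.

Lemma alpha_ge0 (R : realType) (k : nat) (Q : {poly R}) (a0 : R) : (0 < k)%N ->
  is_main_poly k Q -> alpha_exp k a0 -> 0 <= alpha R k.
Proof.
move=> k0 hQ h0; apply: lb_le_inf; first by exists a0.
by move=> a ha; exact: (alpha_exp_ge0 _ _ _ _ k0 hQ ha).
Qed.

Lemma horner_lower (R : realType) (P : {poly R}) : P != 0 ->
  exists c M : R, [/\ 0 < c, 1 <= M & forall t, M <= t -> c * t ^+ (size P).-1 <= `|P.[t]|].
Proof.
move=> P0; have sP : (0 < size P)%N by rewrite size_poly_gt0.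
pose n := (size P).-1; have En : size P = n.+1 by rewrite /n prednK.
pose l := `|lead_coef P|; have l0 : 0 < l by rewrite normr_gt0 lead_coef_eq0.
pose S := \sum_(j < n) `|P`_j|.
have S0 : 0 <= S by apply: sumr_ge0.
exists (l / 2), (1 + 2 * S / l); split; first by rewrite divr_gt0.
  by rewrite lerDl divr_ge0 ?mulr_ge0 // ltW.
move=> t Mt; have t1 : 1 <= t by apply: le_trans Mt; rewrite lerDl divr_ge0 ?mulr_ge0 // ltW.
have t0 : 0 < t := lt_le_trans ltr01 t1.
rewrite horner_coef -/n En big_ord_recr /=.
have hl : `|P`_n * t ^+ n| = l * t ^+ n.
  by rewrite normrM normrX (gtr0_norm t0) /l lead_coefE -/n.
have hs : `|\sum_(j < n) P`_j * t ^+ j| <= l / 2 * t ^+ n.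
  apply: le_trans (ler_norm_sum _ _ _) _.
  have SE : S = \sum_(j < n) `|P`_j| by [].
  case: n S SE S0 Mt {En hl} => [|n] S SE S0 Mt.
    by rewrite big_ord0 mulr_ge0 ?divr_ge0 ?exprn_ge0 ?(ltW l0) ?(ltW t0).
  apply: le_trans (_ : S * t ^+ n <= _).
    rewrite SE mulr_suml; apply: ler_sum => j _; rewrite normrM normrX (gtr0_norm t0).
    by rewrite ler_wpM2l // ler_weXn2l // -ltnS.
  rewrite exprS mulrA ler_wpM2r ?exprn_ge0 ?(ltW t0) //.
  have : 2 * S / l <= t by lra.
  by rewrite ler_pdivrMr //; lra.
have := lerB_normD (P`_n * t ^+ n) (\sum_(j < n) P`_j * t ^+ j).
rewrite hl [X in _ <= `|X|]addrC => h; apply: le_trans h; lra.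
Qed.

(** Were deg Q >= k, the main term would be at least of order x (log x) ^ k. It is the summatory
    function minus the error, hence O(x (log x) ^ (k - 1)); at x = exp(t) with t large this is a
    contradiction. *)
Lemma size_main_poly (R : realType) (k : nat) (Q : {poly R}) (a : R) : (0 < k)%N ->
  is_main_poly k Q -> a < 1 -> alpha_exp k a -> (size Q <= k)%N.
Proof.
move=> k0 hQ a1 /(alpha_expP _ _ _ _ hQ)[C [M [C0 M1 H]]].
rewrite leqNgt; apply/negP => sQ.
have Q0 : Q != 0 by rewrite -size_poly_gt0 (leq_ltn_trans _ sQ).
have [c [M' [c0 M'1 H']]] := horner_lower _ Q Q0.
pose K := (1 + C) * 2 ^+ k / c + 1.
have K0 : 0 <= (1 + C) * 2 ^+ k / c by rewrite divr_ge0 ?mulr_ge0 ?addr_ge0 ?exprn_ge0 ?(ltW C0) ?(ltW c0).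
pose t := M + M' + K.
have tM' : M' <= t by rewrite /t /K; lra.
have t1 : 1 <= t by lra.
have t0 : 0 < t by lra.
pose x := expR t; have x0 : 0 < x := expR_gt0 _.
have tx : t <= x by apply: le_trans (expR_ge1Dx t); lra.
have x1 : 1 <= x by lra.
have xM : M <= x by move: tx; rewrite /t /K; lra.
have lx : ln x = t by rewrite /x expRK.
have := H' t tM'; apply/negP; rewrite -ltNge.
have hQx : x * `|Q.[t]| <= x * ((1 + C) * (1 + t) ^+ k.-1).
  have -> : x * `|Q.[t]| = `|x * Q.[ln x]| by rewrite lx normrM gtr0_norm.
  have -> : x * Q.[ln x] = tau_sumR k x - piltz_error k Q x by rewrite /piltz_error; ring.
  apply: le_trans (ler_normB _ _) _; rewrite ger0_norm ?tau_sumR_ge0 //.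
  have h1 : tau_sumR k x <= x * (1 + t) ^+ k.-1.
    by rewrite -lx -{1}(prednK k0) tau_sumR_le.
  have h2 : `|piltz_error k Q x| <= C * x.
    apply: le_trans (H x xM) _; rewrite ler_wpM2l ?(ltW C0) // -[leRHS]powRr1 ?(ltW x0) //.
    by rewrite ler_powR // ltW.
  have h3 : C * x <= C * x * (1 + t) ^+ k.-1.
    by rewrite ler_peMr ?mulr_ge0 ?(ltW C0) ?(ltW x0) // exprn_ege1 // lerDl ltW.
  lra.
rewrite ler_pM2l // in hQx; apply: le_lt_trans hQx _.
apply: le_lt_trans (_ : (1 + C) * (2 * t) ^+ k.-1 < _).
  by rewrite ler_wpM2l ?addr_ge0 ?(ltW C0) // lerXn2r ?nnegrE; lra.
apply: lt_le_trans (_ : c * t ^+ k <= _); last first.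
  by rewrite ler_wpM2l ?(ltW c0) // ler_weXn2l // -ltnS prednK // (leq_ltn_trans _ sQ).
rewrite -[X in t ^+ X](prednK k0) exprMn exprS !mulrA ltr_pM2r ?exprn_gt0 //.
rewrite [ltRHS]mulrC -ltr_pdivrMr //.
apply: le_lt_trans (_ : (1 + C) * 2 ^+ k / c < _); last by rewrite /t /K; lra.
rewrite ler_wpM2r ?invr_ge0 ?(ltW c0) // ler_wpM2l ?addr_ge0 ?(ltW C0) //.
by rewrite ler_weXn2l ?ler1n // leq_pred.
Qed.

(** The arguments x / m fall below 1 as soon as m > x. There the summatory function vanishes, and
    [main_le] with eps = 1 - a bounds the main term by a multiple of y ^ a. Between 1 and M the
    crude bound is constant. *)
Lemma piltz_error_all (R : realType) (k : nat) (Q : {poly R}) (a : R) : (0 < k)%N ->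
  is_main_poly k Q -> 0 <= a < 1 -> alpha_exp k a ->
  exists2 C : R, 0 < C & forall y, 0 < y -> `|piltz_error k Q y| <= C * y `^ a.
Proof.
move=> k0 hQ /andP[a0 a1] /(alpha_expP _ _ _ _ hQ)[C [M [C0 M1 H]]].
have e0 : 0 < 1 - a by rewrite subr_gt0.
have [D D0 HD] := piltz_error_le R k Q 1 k0 ltr01.
have [E E0 HE] := main_le R Q _ e0.
have DM0 : 0 < D * M `^ (1 + 1) by rewrite mulr_gt0 ?powR_gt0 // (lt_le_trans ltr01).
exists (C + D * M `^ (1 + 1) + 2 * E); first by rewrite !addr_gt0 // mulr_gt0.
move=> y y0; have ya0 : 0 <= y `^ a := powR_ge0 _ _.
rewrite !mulrDl.
have p1 : 0 <= C * y `^ a by rewrite mulr_ge0 // ltW.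
have p2 : 0 <= D * M `^ (1 + 1) * y `^ a by rewrite mulr_ge0 // ltW.
have p3 : 0 <= 2 * E * y `^ a by rewrite !mulr_ge0 // ltW.
have [My|yM] := leP M y; first by have := H y My; lra.
have [y1|y1] := leP 1 y.
  have h : `|piltz_error k Q y| <= D * M `^ (1 + 1) * y `^ a.
    apply: le_trans (HD y y1) _; rewrite -mulrA ler_wpM2l ?(ltW D0) //.
    apply: le_trans (_ : M `^ (1 + 1) <= _).
      by rewrite powR_le_powRr ?(ltW y0) ?(ltW yM).
    by rewrite ler_peMr ?powR_ge0 // powR_ge1.
  lra.
have h : `|piltz_error k Q y| <= 2 * E * y `^ a.
  rewrite /piltz_error tau_sumR_lt1 // sub0r normrN; apply: le_trans (HE y y0) _.
  have -> : 1 - (1 - a) = a by ring.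
  have -> : 2 * E * y `^ a = E * (y `^ a + y `^ a) by ring.
  rewrite ler_wpM2l ?(ltW E0) // lerD2r ger_powR ?y0 ?(ltW y1) //; lra.
lra.
Qed.

Lemma piltz_error0 (R : realType) (k : nat) (Q : {poly R}) : piltz_error k Q 0 = 0.
Proof. by rewrite /piltz_error tau_sumR_lt1 // mul0r subrr. Qed.

(** Dilation by m brings in intervals [0, T / m] that may be shorter than 1. On those a pointwise
    bound V y ^ b, from [main_le] with eps = 1 - b, integrates to the required power. *)
Lemma sqint_all (R : realType) (k : nat) (Q : {poly R}) (b : R) : (0 < k)%N ->
  is_main_poly k Q -> 0 <= b < 1 -> beta_exp k b ->
  exists2 C : R, 0 < C & forall Y, 0 < Y ->
    (sqint (piltz_error k Q) `[0%R, Y] <= (C * Y `^ (1 + 2 * b))%R%:E)%E.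
Proof.
move=> k0 hQ /andP[b0 b1] /(beta_expP _ _ _ _ k0 hQ)[C [M [C0 M1 H]]].
have e0 : 0 < 1 - b by rewrite subr_gt0.
have [E E0 HE] := main_le R Q _ e0.
pose err := piltz_error k Q.
have merr : measurable_fun setT err by exact: measurable_piltz_error.
have [D D0 HD] := piltz_error_le R k Q 1 k0 ltr01.
pose V := 2 * E + D; have V0 : 0 < V by rewrite addr_gt0 ?mulr_gt0.
have small y : 0 <= y -> y <= 1 -> `|err y| <= V * y `^ b.
  rewrite le_eqVlt => /predU1P[<- _|y0 y1].
    by rewrite /err piltz_error0 normr0 mulr_ge0 ?powR_ge0 ?(ltW V0).
  have [y1'|y1'] := ltP y 1; last first.
    have -> : y = 1 by apply/eqP; rewrite eq_le y1.
    have := HD 1 (lexx _); rewrite !one_powR !mulr1 => h.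
    by apply: le_trans h _; rewrite lerDr mulr_ge0 // ltW.
  apply: le_trans (_ : 2 * E * y `^ b <= _); last first.
    by rewrite ler_wpM2r ?powR_ge0 // lerDl ltW.
  rewrite /err /piltz_error tau_sumR_lt1 // sub0r normrN; apply: le_trans (HE y y0) _.
  have -> : 1 - (1 - b) = b by ring.
  have -> : 2 * E * y `^ b = E * (y `^ b + y `^ b) by ring.
  rewrite ler_wpM2l ?(ltW E0) // lerD2r ger_powR ?y0 //; lra.
have low Y : 0 < Y -> Y <= 1 -> (sqint err `[0%R, Y] <= (V ^+ 2 * Y `^ (1 + 2 * b))%R%:E)%E.
  move=> Y0 Y1; apply: le_trans (sqint_le_cst _ _ _ _ (V * Y `^ b) (ltW Y0) _ _) _.
  - exact: measurable_funTS.
  - move=> y /andP[y0 yY]; apply: le_trans (small y y0 (le_trans yY Y1)) _.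
    by rewrite ler_wpM2l ?(ltW V0) // powR_le_powRr.
  rewrite lee_fin subr0 exprMn -mulrA ler_wpM2l ?exprn_ge0 ?(ltW V0) //.
  rewrite -powR_mulrn ?powR_ge0 // -powRrM [b * _]mulrC addrC gt0_powRD // powRr1 //.
  exact: ltW.
have M0 : 0 < M := lt_le_trans ltr01 M1.
have e12 : 0 <= 1 + 2 * b by lra.
exists (V ^+ 2 + C * M `^ (1 + 2 * b) + C).
  by rewrite !addr_gt0 ?mulr_gt0 ?powR_gt0 ?exprn_gt0.
move=> Y Y0.
have W0 : 0 <= Y `^ (1 + 2 * b) := powR_ge0 _ _.
have CM0 : 0 <= C * M `^ (1 + 2 * b) by rewrite mulr_ge0 ?powR_ge0 // ltW.
have V20 : 0 <= V ^+ 2 by rewrite exprn_ge0 // ltW.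
have [Y1|Y1] := leP Y 1.
  apply: le_trans (low Y Y0 Y1) _; rewrite lee_fin ler_wpM2r //; lra.
rewrite (@sqint_cat _ _ _ 1) ?(ltW Y1) //.
apply: le_trans (_ : (sqint err `[0%R, 1%R] + sqint err `[1%R, Y] <= _)%E).
  apply: leeD => //; apply: sqint_sub => //; first exact: measurable_funTS.
  by move=> y; rewrite /= !in_itv /= => /andP[y1 ->]; rewrite (ltW y1).
have W1 : 1 <= Y `^ (1 + 2 * b) by rewrite powR_ge1 // ltW.
have l1 := low 1 ltr01 (lexx _); rewrite one_powR mulr1 in l1.
have l2 : (sqint err `[1%R, Y] <= ((C * M `^ (1 + 2 * b) + C) * Y `^ (1 + 2 * b))%R%:E)%E.
  have [MY|YM] := leP M Y.
    apply: le_trans (H Y MY) _; rewrite lee_fin ler_wpM2r //; lra.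
  apply: le_trans (_ : (sqint err `[1%R, M] <= _)%E).
    apply: sqint_sub => //; first exact: measurable_funTS.
    by move=> y; rewrite /= !in_itv /= => /andP[-> yY] /=; rewrite (le_trans yY) // ltW.
  apply: le_trans (H M (lexx _)) _; rewrite lee_fin [leRHS]mulrDl.
  apply: le_trans (_ : C * M `^ (1 + 2 * b) * Y `^ (1 + 2 * b) <= _).
    by rewrite ler_peMr.
  by rewrite lerDl mulr_ge0 // ltW.
apply: le_trans (leeD l1 l2) _; rewrite -EFinD lee_fin.
rewrite -addrA [leRHS]mulrDl lerD2r ler_peMr //.
Qed.

(** * The polynomial main term of the multiple sum *)

Lemma poly_norm_wide (R : numDomainType) (P : {poly R}) (n : nat) : (size P <= n)%N ->
  poly_norm P = \sum_(0 <= j < n) `|P`_j|.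
Proof.
move=> sn; rewrite /poly_norm -(big_mkord predT (fun j => `|P`_j|)).
rewrite [RHS](big_cat_nat (n := size P)) //= [X in _ + X]big_nat_cond.
rewrite [X in _ + X]big1 ?addr0 // => j /andP[/andP[sj _] _].
by rewrite nth_default // normr0.
Qed.

Lemma coef_le_poly_norm (R : numDomainType) (P : {poly R}) (l : nat) : `|P`_l| <= poly_norm P.
Proof.
have [lP|Pl] := ltnP l (size P); last by rewrite nth_default // normr0 poly_norm_ge0.
by rewrite /poly_norm (bigD1 (Ordinal lP)) //= lerDl; exact: sumr_ge0.
Qed.

Lemma poly_normD (R : numDomainType) (P Q : {poly R}) :
  poly_norm (P + Q) <= poly_norm P + poly_norm Q.
Proof.
pose n := maxn (size P) (size Q).
rewrite !(poly_norm_wide _ _ n) ?leq_maxl ?leq_maxr ?(leq_trans (size_polyD _ _)) //.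
by rewrite -big_split /=; apply: ler_sum => j _; rewrite coefD ler_normD.
Qed.

Lemma poly_norm0 (R : numDomainType) : poly_norm (0 : {poly R}) = 0.
Proof. by rewrite /poly_norm size_poly0 big_ord0. Qed.

Lemma poly_norm_sum (R : numDomainType) (I : Type) (s : seq I) (F : I -> {poly R}) :
  poly_norm (\sum_(j <- s) F j) <= \sum_(j <- s) poly_norm (F j).
Proof.
elim/big_rec2: _ => [|j x P _ H]; first by rewrite poly_norm0.
by apply: le_trans (poly_normD _ _ _) _; rewrite lerD2l.
Qed.

Lemma poly_normZ (R : numDomainType) (c : R) (P : {poly R}) :
  poly_norm (c *: P) <= `|c| * poly_norm P.
Proof.
rewrite !(poly_norm_wide _ _ (size P)) ?size_scale_leq // mulr_sumr.
by apply: ler_sum => j _; rewrite coefZ normrM.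
Qed.

Lemma poly_normM (R : numDomainType) (P Q : {poly R}) :
  poly_norm (P * Q) <= poly_norm P * poly_norm Q.
Proof.
pose n := (size P + size Q)%N.
rewrite !(poly_norm_wide _ _ n) ?leq_addl ?leq_addr //; last first.
  by rewrite (leq_trans (size_polyMleq _ _)) // leq_pred.
apply: le_trans (_ : \sum_(0 <= l < n) \sum_(0 <= p < l.+1) `|P`_p| * `|Q`_(l - p)| <= _).
  apply: ler_sum => l _; rewrite coefM (le_trans (ler_norm_sum _ _ _)) //.
  by rewrite big_mkord; apply: ler_sum => p _; rewrite normrM.
rewrite (sum_triangle _ n (fun p q => `|P`_p| * `|Q`_q|)) big_distrl /=.
apply: ler_sum => p _; rewrite mulr_sumr [leRHS](big_cat_nat (n := (n - p)%N)) ?leq_subr //=.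
by rewrite lerDl; apply: sumr_ge0 => q _; exact: mulr_ge0.
Qed.

Lemma poly_normC (R : numDomainType) (c : R) : poly_norm c%:P = `|c|.
Proof. by rewrite (poly_norm_wide _ _ 1) ?size_polyC_leq1 // big_nat1 coefC. Qed.

Lemma poly_norm_exp (R : numDomainType) (P : {poly R}) (n : nat) :
  poly_norm (P ^+ n) <= poly_norm P ^+ n.
Proof.
elim: n => [|n IH]; first by rewrite !expr0 poly_normC normr1.
rewrite !exprS (le_trans (poly_normM _ _ _)) // ler_wpM2l //.
exact: poly_norm_ge0.
Qed.

Lemma poly_norm_comp_shift (R : numDomainType) (P : {poly R}) (c : R) :
  poly_norm (P \Po ('X - c%:P)) <= poly_norm P * (1 + `|c|) ^+ size P.
Proof.
rewrite comp_polyE (le_trans (poly_norm_sum _ _ _ _)) // {2}/poly_norm mulr_suml.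
apply: ler_sum => j _; rewrite (le_trans (poly_normZ _ _ _)) // ler_wpM2l //.
rewrite (le_trans (poly_norm_exp _ _ _)) //.
have -> : poly_norm ('X - c%:P) = 1 + `|c|.
  rewrite (poly_norm_wide _ _ 2) ?size_XsubC // big_nat_recr //= big_nat1.
  by rewrite !coefB !coefX !coefC /= sub0r subr0 normrN normr1 addrC.
by rewrite ler_weXn2l ?lerDl // ltnW.
Qed.

(** The truncated main polynomial: x ^ r times its value at log x is \sum_m h(m) \prod_i (x / m_i)
    Q(log(x / m_i)) over the box of side Y. The composition with X - log m is the shift log(x / m) =
    log x - log m. *)
Definition box_poly {R : realType} (k r Y : nat) (Q : {poly R}) : {poly R} :=
  \sum_(ms <- boxes r Y) (corr k ms 1 / (\prod_(m <- ms) m)%N%:R) *: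
    \prod_(m <- ms) (Q \Po ('X - (ln m%:R)%:P)).

Lemma size_box_poly (R : realType) (k r Y : nat) (Q : {poly R}) : (size Q <= k)%N ->
  (size (box_poly k r Y Q) <= (r * (k - 1)).+1)%N.
Proof.
move=> sQ; rewrite /box_poly big_seq; apply: (leq_trans (size_sum _ _ _)).
apply/bigmax_leqP_seq => ms _; rewrite mem_boxes => /andP[/eqP sms _].
apply: (leq_trans (size_scale_leq _ _)); rewrite -sms {sms}.
elim: ms => [|m ms IH]; first by rewrite big_nil size_poly1.
rewrite big_cons /=; apply: (leq_trans (size_polyMleq _ _)).
rewrite size_comp_poly2 ?size_XsubC //; move: IH sQ; rewrite mulSn; move: (\prod_(_ <- ms) _) => Z.
by move: (size ms * _)%N (size Z) (size Q) => u z q; lia.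
Qed.

Lemma horner_box_poly (R : realType) (k r Y : nat) (Q : {poly R}) (x : R) : 0 < x ->
  x ^+ r * (box_poly k r Y Q).[ln x] =
  \sum_(ms <- boxes r Y) corr k ms 1 * \prod_(m <- ms) (x / m%:R * Q.[ln (x / m%:R)]).
Proof.
move=> x0; rewrite /box_poly horner_sum mulr_sumr big_seq [RHS]big_seq.
apply: eq_bigr => ms; rewrite mem_boxes => /andP[/eqP sms ams].
rewrite hornerZ horner_prod.
have -> : x ^+ r * (corr k ms 1 / (\prod_(m <- ms) m)%N%:R *
    \prod_(m <- ms) (Q \Po ('X - (ln m%:R)%:P)).[ln x]) =
    corr k ms 1 * (x ^+ r / (\prod_(m <- ms) m)%N%:R *
    \prod_(m <- ms) (Q \Po ('X - (ln m%:R)%:P)).[ln x]) by ring.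
congr (_ * _); rewrite -sms {sms}.
elim: ms ams => [|m ms IH] /=; first by rewrite !big_nil expr0 divr1 mulr1.
move=> /andP[/andP[m0 _] ams]; rewrite !big_cons -IH //.
rewrite horner_comp hornerXsubC ln_div ?posrE ?ltr0n // natrM invfM exprS.
by ring.
Qed.

(** The l^1 norm of coefficients is submultiplicative, and the shift by log m costs a power of 1 +
    log m, which is at most C m ^ eps. The bound is then the convergent weighted sum of |h|,
    uniformly in Y. *)
Lemma coef_box_poly_bounded (R : realType) (k r : nat) (Q : {poly R}) : (0 < r)%N ->
  exists2 B : R, 0 < B & forall Y l, `|(box_poly k r Y Q)`_l| <= B.
Proof.
move=> r0.
pose sigma : R := 1 / 2; pose eps : R := 1 / 16.
have e0 : 0 < eps by rewrite /eps divr_gt0.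
have [B B0 HB] := corr_weight_bounded R k r sigma eps ltac:(by rewrite /sigma; lra)
  ltac:(by rewrite /sigma /eps; lra) ltac:(by rewrite /sigma /eps; lra).
have [C C0 HC] := log_power_powR_le R (size Q) eps e0.
pose N := (poly_norm Q + 1) * C.
have N0 : 0 < N by rewrite mulr_gt0 // ltr_wpDl ?poly_norm_ge0.
exists (N ^+ r * B); first by rewrite mulr_gt0 ?exprn_gt0.
move=> Y l; apply: le_trans (coef_le_poly_norm _ _ _) _.
apply: le_trans (poly_norm_sum _ _ _ _) _.
apply: le_trans (ler_wpM2l (exprn_ge0 r (ltW N0)) (HB Y)).
rewrite mulr_sumr big_seq [leRHS]big_seq; apply: ler_sum => ms.
rewrite mem_boxes => /andP[/eqP sms ams].
have ms0 : all (leq 1) ms by apply: sub_all ams => m /andP[].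
set P := (\prod_(m <- ms) m)%N.
have P0 : (0 < P)%N by rewrite /P big_seq prodn_cond_gt0 // => j /(allP ms0).
have PR : 0 < P%:R :> R by rewrite ltr0n.
have hprod : poly_norm (\prod_(m <- ms) (Q \Po ('X - (ln m%:R)%:P))) <= N ^+ r * P%:R `^ eps.
  rewrite /P natr_prod_powR -sms; elim: (ms) ms0 => [|m s IH] /=.
    by rewrite !big_nil expr0 mulr1 poly_normC normr1.
  move=> /andP[m0 s0]; rewrite !big_cons exprS mulrACA.
  apply: le_trans (poly_normM _ _ _) _.
  apply: ler_pM; rewrite ?poly_norm_ge0 ?IH //.
  have m1 : 1 <= m%:R :> R by rewrite ler1n.
  apply: le_trans (poly_norm_comp_shift _ _ _) _; rewrite ger0_norm ?ln_ge0 // /N -mulrA.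
  by apply: ler_pM; rewrite ?poly_norm_ge0 ?exprn_ge0 ?addr_ge0 ?ln_ge0 ?lerDl ?HC.
(* [corr_weight_bounded] carries this extra factor; being at least 1 for a nonempty tuple, it can be
   inserted. *)
have hsum : 1 <= \sum_(m <- ms) m%:R `^ (1 - eps - sigma) :> R.
  case: (ms) sms ms0 => [|m s] /= sms; first by rewrite -sms in r0.
  move=> /andP[m0 s0]; rewrite big_cons.
  apply: le_trans (_ : m%:R `^ (1 - eps - sigma) <= _).
    by rewrite powR_ge1 ?ler1n // /eps /sigma; lra.
  by rewrite lerDl; apply: sumr_ge0 => j _; exact: powR_ge0.
apply: le_trans (poly_normZ _ _ _) _.
apply: le_trans (ler_wpM2l (normr_ge0 _) hprod) _.
rewrite normrM normfV (ger0_norm (ltW PR)).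
apply: le_trans (_ : N ^+ r * (`|corr k ms 1| * P%:R `^ (- (1 - eps))) <= _); last first.
  by rewrite ler_wpM2l ?exprn_ge0 ?(ltW N0) // ler_peMr // mulr_ge0 ?powR_ge0.
have -> : - (1 - eps) = (- 1) + eps by ring.
rewrite gt0_powRD // powR_inv1 ?(ltW PR) // le_eqVlt; apply/orP; left; apply/eqP; ring.
Qed.

(** Compactness of [- B, B] gives a cluster point, and along an ultrafilter a cluster point is a
    limit. *)
Lemma bounded_ultra_limit (R : realType) (U : set_system nat) (c : nat -> R) (B : R) :
  UltraFilter U -> (forall n, `|c n| <= B) ->
  exists d, forall tol, 0 < tol -> U [set n | `|c n - d| < tol].
Proof.
move=> UU cB.
have [d [_ Hd]] : `[- B, B]%classic `&` cluster (c @ U) !=set0.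
  apply: segment_compact; change (U (c @^-1` `[- B, B]%classic)).
  suff -> : c @^-1` `[- B, B]%classic = setT by exact: filterT.
  by apply/seteqP; split=> // n _; rewrite /= in_itv /= -ler_norml.
exists d => tol t0.
have [//|Hc] := in_ultra_setVsetC [set n | `|c n - d| < tol] UU.
have h1 : (c @ U) [set y : R | ~ (`|y - d| < tol)] by [].
have h2 : nbhs d (ball d tol) by exact: nbhsx_ballx.
have [y [hy1 hy2]] := Hd _ _ h1 h2; exfalso; apply: hy1.
by move: hy2; rewrite /ball /= distrC.
Qed.

(** A single ultrafilter finer than the neighbourhoods of infinity serves all indices l, so one and
    the same n >= N approximates every component. *)
Lemma bounded_cluster (R : realType) (I : finType) (c : nat -> I -> R) (B : R) :
  (forall n l, `|c n l| <= B) ->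
  exists d : {ffun I -> R}, forall (tol : R) (N : nat), 0 < tol ->
    exists2 n, (N <= n)%N & forall l, `|c n l - d l| < tol.
Proof.
move=> cB.
have [U [UU HU]] := @ultraFilterLemma nat \oo _.
have H l : exists d, forall tol, 0 < tol -> U [set n | `|c n l - d| < tol].
  by apply: (bounded_ultra_limit R U (fun n => c n l) B) => // n; exact: cB.
have [d Hd] := choice H.
exists [ffun l => d l] => tol N t0.
have h1 : U [set n | (N <= n)%N] by apply: HU; exists N.
have h2 : U [set n | forall l, `|c n l - d l| < tol].
  have : \forall n \near U, forall l, `|c n l - d l| < tol.
    by apply: filter_forall => l; exact: Hd.
  by [].
have [n [hn1 hn2]] := filter_ex (filterI h1 h2).
by exists n => // l; rewrite ffunE; exact: hn2.
Qed.

(** * Error bounds for the multiple sum *)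

(** Factors are exchanged one at a time; division by c m removes from the full product the majorant
    of the factor being exchanged. *)
Lemma prod_diff_le (R : realFieldType) (ms : seq nat) (a b c : nat -> R) :
  (forall m, m \in ms -> 0 < c m) -> (forall m, m \in ms -> `|a m| <= c m) ->
  (forall m, m \in ms -> `|b m| <= c m) ->
  `|\prod_(m <- ms) a m - \prod_(m <- ms) b m| <=
  (\prod_(m <- ms) c m) * \sum_(m <- ms) `|a m - b m| / c m.
Proof.
elim: ms => [|m ms IH] hc ha hb.
  by rewrite !big_nil subrr normr0 mulr0.
have cm : 0 < c m by rewrite hc // inE eqxx.
have sub j : j \in ms -> j \in m :: ms by rewrite inE orbC => ->.
have {}IH := IH (fun j h => hc j (sub j h)) (fun j h => ha j (sub j h)) (fun j h => hb j (sub j h)).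
rewrite !big_cons.
set A := \prod_(j <- ms) a j; set B := \prod_(j <- ms) b j.
set C := \prod_(j <- ms) c j; set S := \sum_(j <- ms) _.
have AC : `|A| <= C.
  rewrite /A /C normr_prod big_seq [leRHS]big_seq; apply: ler_prod => j jms.
  by rewrite normr_ge0 ha // sub.
have -> : a m * A - b m * B = (a m - b m) * A + b m * (A - B) by ring.
apply: le_trans (ler_normD _ _) _; rewrite !normrM.
apply: le_trans (_ : `|a m - b m| * C + c m * (C * S) <= _).
  apply: lerD; first by rewrite ler_wpM2l.
  by apply: ler_pM => //; rewrite hb // inE eqxx.
rewrite le_eqVlt; apply/orP; left; apply/eqP.
by field; rewrite gt_eqF.
Qed.

(** After symmetrization in p and q, twice the right side minus twice the left is the double sum of
    u_p u_q (w_q e_q - w_p e_p) ^ 2 / (w_p w_q). *)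
Lemma cauchy_schwarz_seq (R : realFieldType) (T : eqType) (s : seq T) (u w e : T -> R) :
  (forall p, p \in s -> 0 <= u p) -> (forall p, p \in s -> 0 < w p) ->
  (\sum_(p <- s) u p * e p) ^+ 2 <=
  (\sum_(p <- s) u p / w p) * \sum_(p <- s) u p * w p * e p ^+ 2.
Proof.
move=> u0 w0.
have -> : (\sum_(p <- s) u p * e p) ^+ 2 =
    \sum_(p <- s) \sum_(q <- s) (u p * u q) * (e p * e q).
  rewrite expr2 big_distrl /=; apply: eq_bigr => p _; rewrite big_distrr /=.
  by apply: eq_bigr => q _; ring.
have ER : (\sum_(p <- s) u p / w p) * (\sum_(p <- s) u p * w p * e p ^+ 2) =
    \sum_(p <- s) \sum_(q <- s) (u p * u q) * (w q / w p * e q ^+ 2).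
  rewrite big_distrl /=; apply: eq_bigr => p _; rewrite big_distrr /=.
  by apply: eq_bigr => q _; ring.
have ER' : (\sum_(p <- s) u p / w p) * (\sum_(p <- s) u p * w p * e p ^+ 2) =
    \sum_(p <- s) \sum_(q <- s) (u p * u q) * (w p / w q * e p ^+ 2).
  rewrite ER exchange_big /=; apply: eq_bigr => p _; apply: eq_bigr => q _; ring.
suff : 2 * (\sum_(p <- s) \sum_(q <- s) (u p * u q) * (e p * e q)) <=
    2 * ((\sum_(p <- s) u p / w p) * (\sum_(p <- s) u p * w p * e p ^+ 2)).
  by rewrite ler_pM2l.
rewrite [leRHS]mulr_natl mulr2n [X in _ <= X + _]ER [X in _ <= _ + X]ER' -big_split /= mulr_sumr.
rewrite [leLHS]big_seq [leRHS]big_seq; apply: ler_sum => p ps.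
rewrite -big_split /= mulr_sumr [leLHS]big_seq [leRHS]big_seq; apply: ler_sum => q qs.
have wp := w0 p ps; have wq := w0 q qs.
rewrite -mulrDr mulrCA ler_wpM2l ?mulr_ge0 ?u0 //.
have -> : w q / w p * e q ^+ 2 + w p / w q * e p ^+ 2 =
    2 * (e p * e q) + (w q * e q - w p * e p) ^+ 2 / (w p * w q).
  by field; rewrite !gt_eqF.
by rewrite lerDl divr_ge0 ?sqr_ge0 ?mulr_ge0 ?(ltW wp) ?(ltW wq).
Qed.

(** * The error majorant over a box, pointwise and in mean square *)

Definition box_weight {R : realType} (k : nat) (eps : R) (ms : seq nat) : R :=
  `|corr k ms 1 : R| * (\prod_(m <- ms) m)%N%:R `^ (- (1 - eps)).

Definition box_error {R : realType} (k r Y : nat) (Q : {poly R}) (eps x : R) : R :=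
  \sum_(ms <- boxes r Y) box_weight k eps ms *
    \sum_(m <- ms) m%:R `^ (1 - eps) * `|piltz_error k Q (x / m%:R)|.

Lemma box_weight_ge0 (R : realType) (k : nat) (eps : R) (ms : seq nat) :
  0 <= box_weight k eps ms.
Proof. by rewrite mulr_ge0 ?powR_ge0. Qed.

(** Both y ^ (1 + eps) and y ^ (1 - eps) at y = x / m must be covered. The common majorant takes the
    larger power of x and the smaller decay in m, so it holds also for m > x. *)
Lemma factor_le (R : realType) (k : nat) (Q : {poly R}) (eps : R) : (0 < k)%N ->
  0 < eps -> exists2 K : R, 0 < K & forall (x : R) (m : nat), 1 <= x -> (0 < m)%N ->
    tau_sumR k (x / m%:R) <= K * x `^ (1 + eps) * m%:R `^ (- (1 - eps)) /\
    `|x / m%:R * Q.[ln (x / m%:R)]| <= K * x `^ (1 + eps) * m%:R `^ (- (1 - eps)).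
Proof.
move=> k0 e0; have [C C0 HC] := tau_sumR_powR_le R k _ k0 e0.
have [D D0 HD] := main_le R Q _ e0.
exists (C + 2 * D); first by rewrite addr_gt0 ?mulr_gt0.
move=> x m x1 m0; have x0 : 0 < x := lt_le_trans ltr01 x1.
have m1 : 1 <= m%:R :> R by rewrite ler1n.
have mR : 0 < m%:R :> R by rewrite ltr0n.
have xm0 : 0 < x / m%:R by rewrite divr_gt0.
set W := x `^ (1 + eps) * m%:R `^ (- (1 - eps)).
have W0 : 0 <= W by rewrite mulr_ge0 ?powR_ge0.
have split s : (x / m%:R) `^ s = x `^ s * m%:R `^ (- s).
  by rewrite powRM ?(ltW x0) ?invr_ge0 ?ler0n // -powR_inv1 ?ler0n // -powRrM mulN1r.
have h1 : (x / m%:R) `^ (1 + eps) <= W.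
  by rewrite split /W ler_wpM2l ?powR_ge0 // ler_powR //; lra.
have h2 : (x / m%:R) `^ (1 - eps) <= W.
  by rewrite split /W ler_wpM2r ?powR_ge0 // ler_powR //; lra.
have -> : (C + 2 * D) * x `^ (1 + eps) * m%:R `^ (- (1 - eps)) = (C + 2 * D) * W.
  by rewrite /W mulrA.
split.
  apply: le_trans (HC _ xm0) _; rewrite mulrDl.
  apply: le_trans (ler_wpM2l (ltW C0) h1) _.
  by rewrite lerDl mulr_ge0 // mulr_ge0 // ltW.
apply: le_trans (HD _ xm0) _.
apply: le_trans (ler_wpM2l (ltW D0) (lerD h1 h2)) _.
have -> : (C + 2 * D) * W = D * (W + W) + C * W by ring.
by rewrite lerDl mulr_ge0 // ltW.
Qed.

(** In each term of the product difference one majorant K x ^ (1 + eps) m ^ (- (1 - eps)) is traded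
    for the error at x / m. This leaves r - 1 powers of x ^ (1 + eps) and puts m ^ (1 - eps) into
    [box_error]. *)
Lemma box_error_bound (R : realType) (k r : nat) (Q : {poly R}) (eps : R) : (0 < k)%N ->
  (0 < r)%N -> 0 < eps ->
  exists2 A : R, 0 < A & forall (x : R) (Y : nat), 1 <= x -> (Num.truncn x <= Y)%N ->
    `|(tauSum r k x)%:R - x ^+ r * (box_poly k r Y Q).[ln x]| <=
    A * (x `^ (1 + eps)) ^+ r.-1 * box_error k r Y Q eps x.
Proof.
move=> k0 r0 e0; have [K K0 HK] := factor_le R k Q _ k0 e0.
exists (K ^+ r.-1); first exact: exprn_gt0.
move=> x Y x1 xY; have x0 : 0 < x := lt_le_trans ltr01 x1.
rewrite horner_box_poly // tauSum_box -(@corr_convolution R r k 1 _ Y xY).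
rewrite -sumrB /box_error mulr_sumr (le_trans (ler_norm_sum _ _ _)) //.
rewrite [leLHS]big_seq [leRHS]big_seq; apply: ler_sum => ms.
rewrite mem_boxes => /andP[/eqP sms ams].
have ms0 m : m \in ms -> (0 < m)%N by move=> /(allP ams) /andP[].
rewrite -mulrBr normrM.
have -> : \prod_(m <- ms) (tau_sum k (Num.truncn x %/ m))%:R = \prod_(m <- ms) tau_sumR k (x / m%:R) :> R.
  rewrite big_seq [RHS]big_seq; apply: eq_bigr => m /ms0 m0.
  by rewrite /tau_sumR truncn_div // ltW.
pose c (m : nat) : R := K * x `^ (1 + eps) * m%:R `^ (- (1 - eps)).
have c0 m : m \in ms -> 0 < c m.
  by move=> /ms0 m0; rewrite !mulr_gt0 ?powR_gt0 // ltr0n.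
have ha m : m \in ms -> `|tau_sumR k (x / m%:R) : R| <= c m.
  by move=> /ms0 m0; rewrite ger0_norm ?tau_sumR_ge0 //; exact: (HK x m x1 m0).1.
have hb m : m \in ms -> `|x / m%:R * Q.[ln (x / m%:R)]| <= c m.
  by move=> /ms0 m0; exact: (HK x m x1 m0).2.
apply: le_trans (ler_wpM2l (normr_ge0 _) (prod_diff_le R ms _ _ c c0 ha hb)) _.
have Ec : \prod_(m <- ms) c m = K ^+ r * (x `^ (1 + eps)) ^+ r * (\prod_(m <- ms) m)%N%:R `^ (- (1 - eps)).
  rewrite natr_prod_powR -sms {ams ms0 c0 ha hb sms}.
  elim: ms => [|m ms IH]; first by rewrite !big_nil !expr0 !mulr1.
  by rewrite !big_cons IH /c /= !exprS; ring.
rewrite Ec /box_weight !mulr_sumr le_eqVlt; apply/orP; left; apply/eqP.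
rewrite [LHS]big_seq [RHS]big_seq; apply: eq_bigr => m /ms0 m0.
have EK : K ^+ r = K * K ^+ r.-1 by rewrite -exprS prednK.
have Ex : (x `^ (1 + eps)) ^+ r = x `^ (1 + eps) * (x `^ (1 + eps)) ^+ r.-1.
  by rewrite -exprS prednK.
have Em : m%:R `^ (- (1 - eps)) = (m%:R `^ (1 - eps))^-1 :> R := powRN _ _.
rewrite -/(piltz_error k Q (x / m%:R)) /c EK Ex Em.
have mR : 0 < m%:R `^ (1 - eps) :> R by rewrite powR_gt0 // ltr0n.
have xe : 0 < x `^ (1 + eps) by rewrite powR_gt0.
by field; rewrite !gt_eqF.
Qed.

Lemma box_error_pointwise (R : realType) (k r Y : nat) (Q : {poly R}) (eps a B C x : R) :
  0 < x -> 0 <= C -> (forall y, 0 < y -> `|piltz_error k Q y| <= C * y `^ a) ->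
  \sum_(ms <- boxes r Y) box_weight k eps ms * \sum_(m <- ms) m%:R `^ (1 - eps - a) <= B ->
  box_error k r Y Q eps x <= C * x `^ a * B.
Proof.
move=> x0 C0 HC HB.
apply: le_trans (ler_wpM2l _ HB); last by rewrite mulr_ge0 ?powR_ge0.
rewrite /box_error mulr_sumr [leLHS]big_seq [leRHS]big_seq; apply: ler_sum => ms.
rewrite mem_boxes => /andP[/eqP sms ams].
rewrite mulrCA ler_wpM2l ?box_weight_ge0 // mulr_sumr.
rewrite [leLHS]big_seq [leRHS]big_seq; apply: ler_sum => m /(allP ams) /andP[m0 _].
have mR : 0 < m%:R :> R by rewrite ltr0n.
apply: le_trans (ler_wpM2l (powR_ge0 _ _) (HC _ _)) _; first by rewrite divr_gt0.
rewrite [m%:R `^ (1 - eps - a)]gt0_powRD // powRM ?(ltW x0) ?invr_ge0 ?(ltW mR) //.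
rewrite -[m%:R^-1]powR_inv1 ?(ltW mR) // -powRrM mulN1r.
by rewrite le_eqVlt; apply/orP; left; apply/eqP; ring.
Qed.

Lemma measurable_box_error (R : realType) (k r Y : nat) (Q : {poly R}) (eps : R) :
  measurable_fun setT (box_error k r Y Q eps).
Proof.
apply: measurable_sum => ms; apply: measurable_funM; first exact: measurable_cst.
apply: measurable_sum => m; apply: measurable_funM; first exact: measurable_cst.
apply: measurableT_comp; first exact: normr_measurable.
apply: measurableT_comp; first exact: measurable_piltz_error.
by apply: measurable_funM; [exact: measurable_id|exact: measurable_cst].
Qed.

(** Cauchy-Schwarz is applied with weight w = m ^ b. The sum of u / w is the convergent one, bounded
    by B. Dilation turns the square integral at x / m into C T ^ (1 + 2 b) m ^ (- 2 b), so u w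
    becomes u m ^ (- b) = u / w and the same sum appears again, whence B ^ 2. *)
Lemma box_error_sqint (R : realType) (k r Y : nat) (Q : {poly R}) (eps b B C T : R) :
  0 < T -> 0 <= C ->
  (forall y, 0 < y -> (sqint (piltz_error k Q) `[0%R, y] <= (C * y `^ (1 + 2 * b))%R%:E)%E) ->
  \sum_(ms <- boxes r Y) box_weight k eps ms * \sum_(m <- ms) m%:R `^ (1 - eps - b) <= B ->
  (sqint (box_error k r Y Q eps) `[1%R, T] <= (B ^+ 2 * C * T `^ (1 + 2 * b))%R%:E)%E.
Proof.
move=> T0 C0 HC HB.
pose L := [seq (ms, m) | ms <- boxes r Y, m <- ms].
pose u (p : seq nat * nat) : R := box_weight k eps p.1 * p.2%:R `^ (1 - eps).
pose w (p : seq nat * nat) : R := p.2%:R `^ b.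
have L0 p : p \in L -> (0 < p.2)%N.
  move=> /allpairsPdep[ms [m [/= + mms ->]]] /=.
  by rewrite mem_boxes => /andP[_ /allP /(_ m mms) /andP[]].
have u0 p : 0 <= u p by rewrite mulr_ge0 ?powR_ge0 ?box_weight_ge0.
have w0 p : p \in L -> 0 < w p by move=> /L0 p0; rewrite powR_gt0 // ltr0n.
have B0 : 0 <= B.
  apply: le_trans HB; apply: sumr_ge0 => ms _; rewrite mulr_ge0 ?box_weight_ge0 //.
  by apply: sumr_ge0 => m _; rewrite powR_ge0.
have ES x : box_error k r Y Q eps x = \sum_(p <- L) u p * `|piltz_error k Q (x / p.2%:R)|.
  rewrite /L big_allpairs_dep /box_error /u /=; apply: eq_bigr => ms _.
  by rewrite mulr_sumr; apply: eq_bigr => m _; rewrite mulrA.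
have EW : \sum_(p <- L) u p / w p <= B.
  apply: le_trans HB; rewrite /L big_allpairs_dep /u /w /=.
  rewrite [leLHS]big_seq [leRHS]big_seq; apply: ler_sum => ms.
  rewrite mem_boxes => /andP[_ ams].
  rewrite mulr_sumr [leLHS]big_seq [leRHS]big_seq; apply: ler_sum => m /(allP ams) /andP[m0 _].
  by rewrite -mulrA -powRN -gt0_powRD // ltr0n.
have CS x : (box_error k r Y Q eps x) ^+ 2 <=
    \sum_(p <- L) B * (u p * w p) * piltz_error k Q (x / p.2%:R) ^+ 2.
  rewrite ES; apply: le_trans (cauchy_schwarz_seq R _ _ u w _ (fun p _ => u0 p) w0) _.
  apply: le_trans (ler_wpM2r _ EW) _.
    by apply: sumr_ge0 => p _; rewrite !mulr_ge0 ?sqr_ge0 ?powR_ge0.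
  rewrite mulr_sumr; apply: ler_sum => p _; rewrite -normrX ger0_norm ?sqr_ge0 //.
  by rewrite !mulrA.
have uw0 p : 0 <= B * (u p * w p) by rewrite !mulr_ge0 ?powR_ge0.
have mcomp (m : nat) : measurable_fun setT (fun x : R => piltz_error k Q (x / m%:R)).
  apply: measurableT_comp; first exact: measurable_piltz_error.
  by apply: measurable_funM; [exact: measurable_id|exact: measurable_cst].
have mterm p : measurable_fun `[1%R, T]%classic
    (fun x => (B * (u p * w p) * piltz_error k Q (x / p.2%:R) ^+ 2)%:E).
  apply: measurable_funTS; apply/measurable_EFinP; apply: measurable_funM.
    exact: measurable_cst.
  by apply: measurable_funX.
apply: le_trans (_ : (\int[@lebesgue_measure R]_(x in `[1%R, T])
   (\sum_(p <- L) (B * (u p * w p) * piltz_error k Q (x / p.2%:R) ^+ 2)%:E) <= _)%E).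
  apply: ge0_le_integral => //.
  - by move=> x _; rewrite lee_fin sqr_ge0.
  - by apply: measurable_sqr_EFin; apply: measurable_funTS; exact: measurable_box_error.
  - by apply: emeasurable_sum => p; exact: mterm.
  - by move=> x _; rewrite sumEFin lee_fin.
rewrite ge0_integral_sum //; last first.
  by move=> p x _; rewrite lee_fin mulr_ge0 ?sqr_ge0.
have Eint p : (\int[@lebesgue_measure R]_(x in `[1%R, T])
    (B * (u p * w p) * piltz_error k Q (x / p.2%:R) ^+ 2)%:E =
    (B * (u p * w p))%:E * sqint (fun x => piltz_error k Q (x / p.2%:R)) `[1%R, T])%E.
  rewrite /sqint -ge0_integralZl_EFin //.
  - by move=> x _; rewrite lee_fin sqr_ge0.
  - by apply: measurable_sqr_EFin; exact: measurable_funTS.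
apply: le_trans (_ : ((\sum_(p <- L) (B * C * T `^ (1 + 2 * b)) * (u p / w p))%R%:E <= _)%E); last first.
  rewrite lee_fin -mulr_sumr.
  apply: le_trans (ler_wpM2l _ EW) _; first by rewrite !mulr_ge0 ?powR_ge0.
  by rewrite le_eqVlt; apply/orP; left; apply/eqP; ring.
rewrite -sumEFin big_seq [X in (_ <= X)%E]big_seq; apply: lee_sum => p pL.
rewrite Eint; have p0 := L0 p pL; have pR : 0 < p.2%:R :> R by rewrite ltr0n.
apply: le_trans (lee_pmul _ _ (lexx _) (sqint_scale_le _ _ _ T _ pR)) _.
- by rewrite lee_fin.
- exact: sqint_ge0.
- exact: measurable_piltz_error.
apply: le_trans (lee_pmul _ _ (lexx _) (lee_pmul _ _ (lexx _) (HC _ (divr_gt0 T0 pR)))) _.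
- by rewrite lee_fin.
- by rewrite mule_ge0 ?sqint_ge0 // lee_fin ltW.
- by rewrite lee_fin ltW.
- exact: sqint_ge0.
rewrite -!EFinM lee_fin powRM ?(ltW T0) ?invr_ge0 ?(ltW pR) //.
rewrite -[p.2%:R^-1]powR_inv1 ?(ltW pR) // -powRrM mulN1r /w.
have -> : - (1 + 2 * b) = -1 + - b + - b by ring.
rewrite !gt0_powRD // powR_inv1 ?(ltW pR) // powRN.
rewrite le_eqVlt; apply/orP; left; apply/eqP.
by field; rewrite !gt_eqF // powR_gt0.
Qed.

(** * The error of the multiple sum and its main coefficients *)

Definition log_poly {R : realType} (n : nat) (d : {ffun 'I_n -> R}) : {poly R} :=
  \poly_(l < n) (if insub l is Some j then d j else 0).

Lemma polyLogE (R : realType) (r k : nat) (d : {ffun 'I_(r * (k - 1)).+1 -> R}) (x : R) :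
  polyLog d x = x ^+ r * (log_poly _ d).[ln x].
Proof.
rewrite /polyLog /log_poly horner_poly; congr (_ * _); apply: eq_bigr => l _.
by rewrite valK.
Qed.

Lemma measurable_polyLog (R : realType) (r k : nat) (d : {ffun 'I_(r * (k - 1)).+1 -> R}) :
  measurable_fun setT (polyLog d).
Proof.
rewrite (_ : polyLog d = fun x => x ^+ r * (log_poly _ d).[ln x]); last first.
  by apply/funext => x; exact: polyLogE.
apply: measurable_funM; last exact: measurable_horner_ln.
by apply: measurable_funX; exact: measurable_id.
Qed.

Lemma polyLog_norm_le (R : realType) (r k : nat) (d : {ffun 'I_(r * (k - 1)).+1 -> R}) (x y v : R) :
  1 <= y <= x -> (forall l, `|d l| <= v) ->
  `|polyLog d y| <= x ^+ r * (v * (r * (k - 1)).+1%:R * (1 + ln x) ^+ (r * (k - 1))).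
Proof.
move=> /andP[y1 yx] dv; have y0 : 0 < y := lt_le_trans ltr01 y1.
have x1 : 1 <= x := le_trans y1 yx.
have ly : 0 <= ln y <= ln x by rewrite ln_ge0 // ler_ln // posrE // (lt_le_trans y0).
have v0 : 0 <= v := le_trans (normr_ge0 _) (dv ord0).
have lx : 1 <= 1 + ln x by rewrite lerDl ln_ge0.
rewrite /polyLog normrM; apply: ler_pM => //.
  by rewrite ger0_norm ?exprn_ge0 ?(ltW y0) // lerXn2r ?nnegrE // ltW // (lt_le_trans y0).
apply: le_trans (ler_norm_sum _ _ _) _.
apply: le_trans (_ : \sum_(l < (r * (k - 1)).+1) v * (1 + ln x) ^+ (r * (k - 1)) <= _); last first.
  by rewrite sumr_const card_ord -mulr_natr le_eqVlt; apply/orP; left; apply/eqP; ring.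
apply: ler_sum => l _; rewrite normrM; apply: ler_pM => //.
case/andP: ly => ly0 lyx; rewrite normrX ger0_norm //.
apply: le_trans (_ : (1 + ln x) ^+ l <= _).
  by rewrite lerXn2r ?nnegrE //; lra.
by rewrite ler_weXn2l // -ltnS.
Qed.

Lemma tau_box_sum_mono (r k E N M : nat) : (N <= M)%N ->
  (tau_box_sum r k E N <= tau_box_sum r k E M)%N.
Proof.
move=> NM; elim: r E => [|r IH] E //=.
rewrite [leqRHS](big_cat_nat (n := N.+1)) ?ltnS //=.
by apply: leq_trans (leq_addr _ _); apply: leq_sum => n _; exact: IH.
Qed.

Lemma measurable_tauSum (R : realType) (r k : nat) :
  measurable_fun setT (fun x : R => (tauSum r k x)%:R : R).
Proof.
apply: nondecreasing_measurable => // x y xy; rewrite ler_nat !tauSum_box.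
by apply: tau_box_sum_mono; exact: le_truncn.
Qed.

Lemma tauSum_le (R : realType) (r k : nat) (eps : R) : (0 < r)%N -> 0 < eps ->
  exists2 C : R, 0 < C & forall x : R, 1 <= x -> (tauSum r k x)%:R <= C * x `^ (r%:R + eps).
Proof.
move=> r0 e0; have rR : 0 < r%:R :> R by rewrite ltr0n.
(* The exponent is eps / r because the argument of [tau] can be as large as x ^ r. *)
have eta0 : 0 < eps / r%:R by rewrite divr_gt0.
have [C C0 HC] := tau_le R k _ eta0.
exists C => // x x1; have x0 : 0 < x := lt_le_trans ltr01 x1.
have Nx : (Num.truncn x)%:R <= x by rewrite truncn_le // ltW.
rewrite /tauSum; move: (Num.truncn x) Nx => N Nx; rewrite natr_sum.
have NX : N%:R ^+ r <= x ^+ r by rewrite lerXn2r ?nnegrE ?ler0n // ltW.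
apply: le_trans (_ : \sum_(t : {ffun 'I_r -> 'I_N}) C * x `^ eps <= _).
  apply: ler_sum => t _; have p0 : (0 < \prod_(i < r) (t i).+1)%N by rewrite prodn_gt0.
  apply: le_trans (HC _ p0) _; rewrite ler_wpM2l ?(ltW C0) //.
  have -> : x `^ eps = (x ^+ r) `^ (eps / r%:R).
    by rewrite -powR_mulrn ?(ltW x0) // -powRrM mulrC divfK ?gt_eqF.
  rewrite ge0_ler_powR ?nnegrE ?(ltW eta0) ?exprn_ge0 ?(ltW x0) //.
  apply: le_trans (_ : (N ^ r)%N%:R <= _).
    rewrite ler_nat -[r in (N ^ r)%N]card_ord -prod_nat_const.
    by apply: leq_prod => i _; exact: ltn_ord.
  by rewrite natrX.
rewrite sumr_const card_ffun !card_ord -[leLHS]mulr_natl gt0_powRD // powR_mulrn ?(ltW x0) //.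
rewrite natrX mulrCA ler_wpM2l ?(ltW C0) // ler_wpM2r ?powR_ge0 //.
Qed.

Definition multi_error {R : realType} {r k : nat} (d : {ffun 'I_(r * (k - 1)).+1 -> R}) (x : R) : R :=
  (tauSum r k x)%:R - polyLog d x.

Lemma measurable_multi_error (R : realType) (r k : nat) (d : {ffun 'I_(r * (k - 1)).+1 -> R}) :
  measurable_fun setT (multi_error d).
Proof. apply: measurable_funB; [exact: measurable_tauSum|exact: measurable_polyLog]. Qed.

Lemma fine_le_of_le (R : realType) (e : \bar R) (c : R) :
  (0 <= e)%E -> (e <= c%:E)%E -> fine e <= c.
Proof. by case: e. Qed.

(** Stated for an arbitrary coefficient vector, since for beta_k >= 1 nothing is established about
    the vector that [mainCoefs] selects. In that case 2 r + 1 <= 2 r - 1 + 2 beta_k. *)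
Lemma sqint_tauSum_trivial (R : realType) (r k : nat)
    (d : {ffun 'I_(r * (k - 1)).+1 -> R}) (eps : R) : (0 < r)%N -> 0 < eps ->
  exists2 C : R, 0 < C & forall T : R, 1 <= T ->
    (sqint (multi_error d) `[1%R, T] <= (C * T `^ (2 * r%:R + 1 + eps))%:E)%E.
Proof.
move=> r0 e0; have e2 : 0 < eps / 2 by rewrite divr_gt0.
have [C C0 HC] := tauSum_le R r k _ r0 e2.
have [D D0 HD] := log_power_powR_le R (r * (k - 1)) _ e2.
pose v := \sum_l `|d l|; have dv l : `|d l| <= v.
  by rewrite /v (bigD1 l) //= lerDl; exact: sumr_ge0.
have v0 : 0 <= v by exact: sumr_ge0.
pose w := C + v * (r * (k - 1)).+1%:R * D.
have w0 : 0 < w by rewrite ltr_wpDr // !mulr_ge0 // ltW.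
exists (w ^+ 2) => [|T T1]; first exact: exprn_gt0.
have T0 : 0 < T := lt_le_trans ltr01 T1.
apply: le_trans (sqint_le_cst _ _ _ _ (w * T `^ (r%:R + eps / 2)) T1 _ _) _.
- by apply: measurable_funTS; exact: measurable_multi_error.
- move=> y yT; case/andP: (yT) => y1 yleT.
  have y0 : 0 < y := lt_le_trans ltr01 y1.
  apply: le_trans (ler_normB _ _) _; rewrite /w mulrDl; apply: lerD.
    rewrite ger0_norm //; apply: le_trans (HC _ y1) _; rewrite ler_wpM2l ?(ltW C0) //.
    by rewrite ge0_ler_powR ?nnegrE ?(ltW y0) ?(ltW T0) // addr_ge0 // ltW.
  apply: le_trans (polyLog_norm_le _ _ _ _ _ _ _ yT dv) _.
  rewrite gt0_powRD // powR_mulrn ?(ltW T0) //.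
  apply: le_trans (_ : T ^+ r * (v * (r * (k - 1)).+1%:R * (D * T `^ (eps / 2))) <= _).
    rewrite ler_wpM2l ?exprn_ge0 ?(ltW T0) // ler_wpM2l ?mulr_ge0 //; exact: HD.
  by rewrite le_eqVlt; apply/orP; left; apply/eqP; ring.
have E : w ^+ 2 * T `^ (2 * r%:R + 1 + eps) = (w * T `^ (r%:R + eps / 2)) ^+ 2 * T.
  have -> : 2 * r%:R + 1 + eps = (r%:R + eps / 2) + (r%:R + eps / 2) + 1 :> R.
    by field.
  rewrite [T `^ (_ + 1)]gt0_powRD // [T `^ (_ + _)]gt0_powRD // powRr1 ?(ltW T0) //.
  by ring.
by rewrite lee_fin E ler_wpM2l ?sqr_ge0 // gerBl.
Qed.

(** d is a cluster point of the truncated coefficient vectors. Y is chosen after x: the tolerance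
    for the coefficients is 1 / K, where K is the factor by which their differences can be magnified
    on [1, x]. *)
Lemma main_coefs_approx (R : realType) (k r : nat) (Q : {poly R}) : (0 < r)%N ->
  (size Q <= k)%N -> exists d : {ffun 'I_(r * (k - 1)).+1 -> R}, forall (x : R) (N : nat),
    1 <= x -> exists2 Y, (N <= Y)%N & forall y, 1 <= y <= x ->
      `|y ^+ r * (box_poly k r Y Q).[ln y] - polyLog d y| <= 1.
Proof.
move=> r0 sQ; have [B B0 HB] := coef_box_poly_bounded R k r Q r0.
pose c Y (l : 'I_(r * (k - 1)).+1) := (box_poly k r Y Q)`_l.
have [d Hd] := bounded_cluster R _ c B (fun Y l => HB Y l).
exists d => x N x1; have x0 : 0 < x := lt_le_trans ltr01 x1.
have lx : 0 < 1 + ln x by rewrite ltr_pwDl ?ln_ge0.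
pose K := x ^+ r * ((r * (k - 1)).+1%:R * (1 + ln x) ^+ (r * (k - 1))).
have K0 : 0 < K by rewrite !mulr_gt0 ?exprn_gt0 // ltr0n.
have [|Y NY HY] := Hd K^-1 N; first by rewrite invr_gt0.
exists Y => // y yx.
have y0 : 0 < y by case/andP: yx => y1 _; exact: lt_le_trans ltr01 y1.
have -> : y ^+ r * (box_poly k r Y Q).[ln y] - polyLog d y =
    polyLog [ffun l => c Y l - d l] y.
  rewrite (horner_coef_wide _ (size_box_poly R k r Y Q sQ)) /polyLog -mulrBr -sumrB.
  by congr (_ * _); apply: eq_bigr => l _; rewrite ffunE mulrBl.
apply: le_trans (polyLog_norm_le _ _ _ _ _ _ K^-1 yx _) _.
  by move=> l; rewrite ffunE ltW.
have -> : x ^+ r * (K^-1 * (r * (k - 1)).+1%:R * (1 + ln x) ^+ (r * (k - 1))) = K * K^-1.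
  by rewrite /K; ring.
by rewrite divff // gt_eqF.
Qed.

(** Y depends on X, both for the exact convolution identity and for the approximation by d; this is
    harmless because the later bounds on [box_error] are uniform in Y. *)
Lemma multi_error_le_box_error (R : realType) (k r : nat) (Q : {poly R}) (eps : R)
    (d : {ffun 'I_(r * (k - 1)).+1 -> R}) : (0 < k)%N -> (0 < r)%N -> 0 < eps ->
  (forall (x : R) (N : nat), 1 <= x -> exists2 Y, (N <= Y)%N & forall y, 1 <= y <= x ->
      `|y ^+ r * (box_poly k r Y Q).[ln y] - polyLog d y| <= 1) ->
  exists2 A : R, 0 < A & forall X, 1 <= X -> exists Y, forall x, 1 <= x <= X ->
    `|multi_error d x| <= A * (X `^ (1 + eps)) ^+ r.-1 * box_error k r Y Q eps x + 1.
Proof.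
move=> k0 r0 e0 Hd; have [A A0 HA] := box_error_bound R k r Q eps k0 r0 e0.
exists A => // X X1; have [Y XY HY] := Hd X (Num.truncn X) X1; exists Y => x xX.
case/andP: (xX) => x1 xleX; have x0 : 0 < x := lt_le_trans ltr01 x1.
have -> : multi_error d x = ((tauSum r k x)%:R - x ^+ r * (box_poly k r Y Q).[ln x]) +
    (x ^+ r * (box_poly k r Y Q).[ln x] - polyLog d x) by rewrite /multi_error; ring.
apply: le_trans (ler_normD _ _) _; apply: lerD; last exact: HY.
apply: le_trans (HA _ Y x1 _) _; first by apply: leq_trans XY; exact: le_truncn.
rewrite ler_wpM2r //.
  apply: sumr_ge0 => ms _; rewrite mulr_ge0 ?box_weight_ge0 //.
  by apply: sumr_ge0 => m _; rewrite mulr_ge0 ?powR_ge0.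
rewrite ler_wpM2l ?(ltW A0) // lerXn2r ?nnegrE ?powR_ge0 //.
by apply: ge0_ler_powR; rewrite // ?nnegrE; lra.
Qed.

Lemma powR_exprn (R : realType) (x s : R) (n : nat) : (x `^ s) ^+ n = x `^ (s * n%:R).
Proof. by rewrite powRrM powR_mulrn ?powR_ge0. Qed.

Lemma is_mainCoefs_of_approx (R : realType) (k r : nat) (Q : {poly R}) (a0 : R)
    (d : {ffun 'I_(r * (k - 1)).+1 -> R}) : (0 < k)%N -> (0 < r)%N -> is_main_poly k Q ->
  alpha_exp k a0 -> alpha R k < 1 ->
  (forall (x : R) (N : nat), 1 <= x -> exists2 Y, (N <= Y)%N & forall y, 1 <= y <= x ->
      `|y ^+ r * (box_poly k r Y Q).[ln y] - polyLog d y| <= 1) ->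
  is_mainCoefs d.
Proof.
move=> k0 r0 hQ ha0 al1 Hd eps e0.
have al0 := alpha_ge0 R k Q a0 k0 hQ ha0.
have rR : 1 <= r%:R :> R by rewrite ler1n.
(* The exponent a lies above alpha_k, so the pointwise bound is available, below 1, and within eps /
   2 of alpha_k. *)
pose a := Num.min (alpha R k + eps / 2) ((1 + alpha R k) / 2).
have [aal [ale a1]] : alpha R k < a /\ a <= alpha R k + eps / 2 /\ a < 1.
  by rewrite /a lt_min gt_min ge_min lexx /=; split; [|split]; [apply/andP; split| |apply/orP; right]; lra.
have a_gt0 : 0 < a := le_lt_trans al0 aal.
(* The first two bounds are the hypotheses of [corr_weight_bounded] with sigma = a; the third makes
   e (r - 1) <= eps / 2. *)
pose e := Num.min (Num.min (a / 8) (1 - a)) (eps / (2 * r%:R)).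
have er0 : 0 < eps / (2 * r%:R) by rewrite divr_gt0 // mulr_gt0 //; lra.
have [e_gt0 [ea [e1 er]]] : 0 < e /\ e <= a / 8 /\ e <= 1 - a /\ e <= eps / (2 * r%:R).
  by rewrite /e !lt_min !ge_min er0 !lexx /= ?orbT; split; [apply/andP; split; [apply/andP; split|]|]; lra.
have [B B0 HB] := corr_weight_bounded R k r a e a_gt0 ltac:(by rewrite e_gt0) ltac:(lra).
have [|C C0 HC] := piltz_error_all R k Q a k0 hQ _ (alpha_exp_gt R k Q a a0 k0 hQ ha0 aal).
  by rewrite (ltW a_gt0).
have [A A0 HA] := multi_error_le_box_error R k r Q e d k0 r0 e_gt0 Hd.
apply/isO_powRP; exists (A * C * B + 1), 1; split => //.
  by rewrite ltr_wpDl // !mulr_ge0 // ltW.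
move=> x x1; have x0 : 0 < x := lt_le_trans ltr01 x1.
have [Y HY] := HA x x1.
apply: le_trans (HY x _) _; first by rewrite x1 lexx.
have h := box_error_pointwise R k r Y Q e a B C x x0 (ltW C0) HC (HB Y).
set s := r%:R - 1 + alpha R k + eps.
have er' : e * (r%:R - 1) <= eps / 2.
  apply: le_trans (_ : eps / (2 * r%:R) * r%:R <= _).
    by apply: ler_pM; rewrite ?(ltW e_gt0) //; lra.
  by rewrite le_eqVlt; apply/orP; left; apply/eqP; field; rewrite gt_eqF //; lra.
rewrite mulrDl mul1r; apply: lerD; last by rewrite powR_ge1 // /s; lra.
apply: le_trans (ler_wpM2l _ h) _; first by rewrite mulr_ge0 ?exprn_ge0 ?powR_ge0 // ltW.
rewrite powR_exprn.
have -> : A * x `^ ((1 + e) * r.-1%:R) * (C * x `^ a * B) =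
    A * C * B * (x `^ ((1 + e) * r.-1%:R) * x `^ a) by ring.
rewrite ler_wpM2l ?mulr_ge0 ?(ltW A0) ?(ltW B0) ?(ltW C0) // -gt0_powRD // ler_powR //.
by rewrite -subn1 natrB // /s; lra.
Qed.

(** A nonzero difference polynomial has absolute value at least some c > 0 at log x for large x, so
    the two main terms differ by at least c x ^ r. With e = (1 - alpha_k) / 2 both error terms are
    O(x ^ (r - e)), a contradiction. *)
Lemma is_mainCoefs_uniq (R : realType) (k r : nat) (d1 d2 : {ffun 'I_(r * (k - 1)).+1 -> R}) :
  alpha R k < 1 -> is_mainCoefs d1 -> is_mainCoefs d2 -> d1 = d2.
Proof.
move=> al1 h1 h2; pose e := (1 - alpha R k) / 2.
have e0 : 0 < e by rewrite /e; lra.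
have /isO_powRP[C1 [M1 [C10 M11 H1]]] := h1 e e0.
have /isO_powRP[C2 [M2 [C20 M21 H2]]] := h2 e e0.
pose d : {ffun 'I_(r * (k - 1)).+1 -> R} := [ffun l => d1 l - d2 l].
have [P0|P0] := eqVneq (log_poly _ d) 0.
  apply/ffunP => l; apply/eqP; rewrite -subr_eq0; apply/eqP.
  have := congr1 (fun P : {poly R} => P`_l) P0.
  by rewrite coef_poly ltn_ord valK ffunE coef0.
have [c [M [c0 M1' HM]]] := horner_lower R _ P0.
have [M' M'1 HM'] := powR_unbounded R e ((C1 + C2) / c) e0.
pose x := Num.max (Num.max M1 M2) (Num.max M' (expR M)).
have [xM1 [xM2 [xM' xM]]] : M1 <= x /\ M2 <= x /\ M' <= x /\ expR M <= x.
  by rewrite /x !le_max !lexx ?orbT.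
have x0 : 0 < x := lt_le_trans (expR_gt0 _) xM.
have lM : M <= ln x by rewrite -[M]expRK ler_ln // posrE expR_gt0.
have h := HM' x xM'; have hP := HM _ lM.
have hc : c <= `|(log_poly _ d).[ln x]|.
  by apply: le_trans hP; rewrite ler_peMr ?(ltW c0) // exprn_ege1 // (le_trans M1').
have hd : x ^+ r * `|(log_poly _ d).[ln x]| <= (C1 + C2) * x `^ (r%:R - 1 + alpha R k + e).
  rewrite -[x ^+ r]ger0_norm ?exprn_ge0 ?(ltW x0) // -normrM -polyLogE.
  have -> : polyLog d x = multi_error d2 x - multi_error d1 x.
    rewrite /multi_error /polyLog.
    have -> : \sum_l d l * ln x ^+ l = \sum_l d1 l * ln x ^+ l - \sum_l d2 l * ln x ^+ l.
      by rewrite -sumrB; apply: eq_bigr => l _; rewrite ffunE mulrBl.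
    by ring.
  rewrite [C1 + C2]addrC mulrDl; apply: le_trans (ler_normB _ _) _; apply: lerD; [exact: H2|exact: H1].
have : x ^+ r * c <= (C1 + C2) * x `^ (r%:R - 1 + alpha R k + e).
  by apply: le_trans hd; rewrite ler_wpM2l // exprn_ge0 // ltW.
have -> : r%:R - 1 + alpha R k + e = r%:R + - e by rewrite /e; lra.
rewrite gt0_powRD // powR_mulrn ?(ltW x0) // powRN mulrCA ler_pM2l ?exprn_gt0 //.
by rewrite ler_pdivlMr ?powR_gt0 // leNgt -ltr_pdivrMl // mulrC h.
Qed.

Lemma sqint_multi_error_le (R : realType) (k r Y : nat) (Q : {poly R}) (eps A T : R)
    (d : {ffun 'I_(r * (k - 1)).+1 -> R}) : 1 <= T -> 0 <= A ->
  (forall x, 1 <= x <= T -> `|multi_error d x| <= A * box_error k r Y Q eps x + 1) ->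
  (sqint (multi_error d) `[1%R, T] <=
    (2 * A ^+ 2)%:E * sqint (box_error k r Y Q eps) `[1%R, T] + (2 * T)%:E)%E.
Proof.
move=> T1 A0 H; have mb := measurable_box_error R k r Y Q eps.
have mb2 : measurable_fun `[1%R, T]%classic (fun x => (box_error k r Y Q eps x ^+ 2)%:E).
  by apply: measurable_sqr_EFin; exact: measurable_funTS.
have c0 : 0 <= 2 * A ^+ 2 by rewrite mulr_ge0 ?sqr_ge0.
apply: le_trans (_ : (\int[@lebesgue_measure R]_(x in `[1%R, T])
   (((2 * A ^+ 2)%:E * (box_error k r Y Q eps x ^+ 2)%:E) + (cst 2%:E x)) <= _)%E).
  apply: ge0_le_integral => //.
  - by move=> x _; rewrite lee_fin sqr_ge0.
  - by apply: measurable_sqr_EFin; apply: measurable_funTS; exact: measurable_multi_error.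
  - by apply: emeasurable_funD; [exact: measurable_funeM|exact: measurable_cst].
  - move=> x; rewrite /= in_itv /= => /H h; rewrite -EFinM -EFinD lee_fin.
    rewrite -[leLHS]ger0_norm ?sqr_ge0 // normrX.
    apply: le_trans (_ : (A * box_error k r Y Q eps x + 1) ^+ 2 <= _).
      by rewrite lerXn2r // nnegrE // (le_trans _ h).
    rewrite -subr_ge0 (_ : _ - _ = (A * box_error k r Y Q eps x - 1) ^+ 2) ?sqr_ge0 //.
    by ring.
rewrite ge0_integralD //; first last.
- by move=> x _; rewrite lee_fin.
- exact: measurable_funeM.
- by move=> x _; rewrite -EFinM lee_fin mulr_ge0 ?sqr_ge0.
apply: leeD.
  by rewrite ge0_integralZl_EFin // => x _; rewrite lee_fin sqr_ge0.
apply: le_trans (_ : ((2 * (T - 1))%:E <= _)%E); last by rewrite lee_fin ler_pM2l // gerBl.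
by rewrite EFinM -lebesgue_itvcc // -integral_cst.
Qed.

Lemma sqint_multi_error_bound (R : realType) (k r : nat) (Q : {poly R}) (eps : R)
    (d : {ffun 'I_(r * (k - 1)).+1 -> R}) : (0 < k)%N -> (0 < r)%N -> 0 < eps ->
  is_main_poly k Q -> beta R k < 1 ->
  (forall (x : R) (N : nat), 1 <= x -> exists2 Y, (N <= Y)%N & forall y, 1 <= y <= x ->
      `|y ^+ r * (box_poly k r Y Q).[ln y] - polyLog d y| <= 1) ->
  exists2 C : R, 0 < C & forall T : R, 1 <= T ->
    (sqint (multi_error d) `[1%R, T] <= (C * T `^ (2 * r%:R - 1 + 2 * beta R k + eps))%:E)%E.
Proof.
move=> k0 r0 e0 hQ be1 Hd; have be0 := beta_ge0 R k Q k0 hQ.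
have rR : 1 <= r%:R :> R by rewrite ler1n.
(* Together with e (r - 1) <= eps / 4, the bound b <= beta_k + eps / 4 keeps 2 (1 + e) (r - 1) + 1 +
   2 b within 2 r - 1 + 2 beta_k + eps. *)
pose b := Num.min (beta R k + eps / 4) ((1 + beta R k) / 2).
have [bbe [bbe' b1]] : beta R k < b /\ b <= beta R k + eps / 4 /\ b < 1.
  by rewrite /b lt_min gt_min ge_min lexx /=; split; [|split]; [apply/andP; split| |apply/orP; right]; lra.
have b_gt0 : 0 < b := le_lt_trans be0 bbe.
pose e := Num.min (Num.min (b / 8) (1 - b)) (eps / (4 * r%:R)).
have er0 : 0 < eps / (4 * r%:R) by rewrite divr_gt0 // mulr_gt0 //; lra.
have [e_gt0 [eb [e1 er]]] : 0 < e /\ e <= b / 8 /\ e <= 1 - b /\ e <= eps / (4 * r%:R).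
  by rewrite /e !lt_min !ge_min er0 !lexx /= ?orbT; split; [apply/andP; split; [apply/andP; split|]|]; lra.
have er' : e * (r%:R - 1) <= eps / 4.
  apply: le_trans (_ : eps / (4 * r%:R) * r%:R <= _).
    by apply: ler_pM; rewrite ?(ltW e_gt0) //; lra.
  by rewrite le_eqVlt; apply/orP; left; apply/eqP; field; rewrite gt_eqF //; lra.
have [B B0 HB] := corr_weight_bounded R k r b e b_gt0 ltac:(by rewrite e_gt0) ltac:(lra).
have [|C C0 HC] := sqint_all R k Q b k0 hQ _ (beta_exp_gt R k Q b k0 hQ bbe).
  by rewrite (ltW b_gt0).
have [A A0 HA] := multi_error_le_box_error R k r Q e d k0 r0 e_gt0 Hd.
exists (2 * A ^+ 2 * B ^+ 2 * C + 2); first by rewrite ltr_wpDl // !mulr_ge0 ?sqr_ge0 // ltW.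
move=> T T1; have T0 : 0 < T := lt_le_trans ltr01 T1.
have [Y HY] := HA T T1.
have A'0 : 0 <= A * (T `^ (1 + e)) ^+ r.-1 by rewrite mulr_ge0 ?exprn_ge0 ?powR_ge0 ?(ltW A0).
apply: le_trans (sqint_multi_error_le R k r Y Q e _ T d T1 A'0 HY) _.
have h := box_error_sqint R k r Y Q e b B C T T0 (ltW C0) HC (HB Y).
set s := 2 * r%:R - 1 + 2 * beta R k + eps.
rewrite [(_ + 2) * _]mulrDl EFinD; apply: leeD; last first.
  rewrite lee_fin ler_pM2l // -[leLHS]powRr1 ?(ltW T0) // ler_powR // /s; lra.
apply: le_trans (lee_pmul _ _ (lexx _) h) _.
- by rewrite lee_fin mulr_ge0 ?sqr_ge0.
- exact: sqint_ge0.
rewrite -EFinM lee_fin powR_exprn.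
set u := (1 + e) * _.
have -> : 2 * (A * T `^ u) ^+ 2 * (B ^+ 2 * C * T `^ (1 + 2 * b)) =
    2 * A ^+ 2 * B ^+ 2 * C * (T `^ u * T `^ u * T `^ (1 + 2 * b)) by ring.
apply: ler_wpM2l; first by rewrite !mulr_ge0 ?sqr_ge0 // ltW.
rewrite -!gt0_powRD // ler_powR //.
by rewrite /u -subn1 natrB // /s; lra.
Qed.

Theorem theorem5 (R : realType) (r k : nat) (hr : (2 <= r)%N) (hk : (4 <= k)%N)
    (eps : R) (heps : 0 < eps) :
  exists C : R, forall T : R, 2 <= T ->
    \int[@lebesgue_measure R]_(x in `[1, T]) (DeltaMulti r k x ^+ 2)
      <= C * T `^ (2 * r%:R - 1 + 2 * beta R k + eps).
Proof.
have r0 : (0 < r)%N by exact: leq_trans hr.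
have k0 : (0 < k)%N by exact: leq_trans hk.
suff [C C0 HC] : exists2 C : R, 0 < C & forall T : R, 1 <= T ->
    (sqint (multi_error (mainCoefs R r k)) `[1%R, T] <=
      (C * T `^ (2 * r%:R - 1 + 2 * beta R k + eps))%:E)%E.
  exists C => T T2; apply: fine_le_of_le; first exact: sqint_ge0.
  by apply: HC; lra.
have [be1|be1] := leP 1 (beta R k).
  have [C C0 HC] := sqint_tauSum_trivial R r k (mainCoefs R r k) eps r0 heps.
  exists C => // T T1; apply: le_trans (HC T T1) _.
  by rewrite lee_fin ler_wpM2l ?(ltW C0) // ler_powR //; lra.
have [Q hQ] : exists Q : {poly R}, is_main_poly k Q by exact: mainTerm_poly.
pose b := (1 + beta R k) / 2.
have [bb b1] : beta R k < b /\ b < 1 by rewrite /b; lra.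
have al1 := alpha_lt1 R k Q k0 hQ be1.
have ha := alpha_exp_of_beta_exp R k Q b k0 hQ b1 (beta_exp_gt R k Q b k0 hQ bb).
have sQ : (size Q <= k)%N by apply: size_main_poly k0 hQ _ ha; lra.
have [d Hd] := main_coefs_approx R k r Q r0 sQ.
have dP := is_mainCoefs_of_approx R k r Q _ d k0 r0 hQ ha al1 Hd.
(* The choice operator returns some vector satisfying [is_mainCoefs], because d is one; uniqueness
   then identifies it with d. *)
have -> : mainCoefs R r k = d.
  apply: (is_mainCoefs_uniq _ _ _ _ _ al1 _ dP).
  exact: (xgetPex _ (ex_intro _ d dP)).
exact: sqint_multi_error_bound k0 r0 heps hQ be1 Hd.
Qed.
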